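(* Let $n\ge 1$ be an integer and $m>0$ real. For $s\in\mathbb{N}^n$ let $f_s(W,z)=\frac{1}{\sqrt{s!}}P_s(2\sqrt{2\pi m}\,z,W)$ for $(W,z)\in\mathfrak{D}_n^J=\mathfrak{D}_n\times\mathbb{C}^n$. a) The generating function of $\{f_s\mid s\in\mathbb{N}^n\}$ is $$\exp\left(\sqrt{8\pi m}\,U\,{}^tz+\tfrac12UW\,{}^tU\right)=\sum_{s\in\mathbb{N}^n}\frac{U^s}{\sqrt{s!}}f_s(W,z),\qquad U\in\mathbb{C}^n,\ (W,z)\in\mathfrak{D}_n^J,$$ and the (reproducing) kernel function of the Hilbert space $\mathfrak{F}_m(\mathfrak{D}_n^J)$ admits the expansion $$\left(\det(I_n-W'\bar W)\right)^{-1/2}\exp\left(8\pi m\,A(W',z';W,z)\right)=\sum_{s\in\mathbb{N}^n}f_s(W',z')\,\overline{f_s(W,z)},\qquad (W,z),(W',z')\in\mathfrak{D}_n^J.$$ b) A holomorphic function $f\in\mathcal{O}(\mathfrak{D}_n^J)$ is a solution of the system of differential equations $$\frac{\partial^2 f}{\partial z_j\,\partial z_k}=8\pi m\,(1+\delta_{jk})\,\frac{\partial f}{\partial W_{jk}},\qquad 1\le j\le k\le n,$$ if and only if $f\in\mathcal{H}_0(\mathfrak{D}_n^J)$.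
   Context: Elements of $\mathbb{C}^n$ are row vectors; ${}^tX$ is the transpose, $\bar X$ the entrywise complex conjugate; $\mathbb{N}=\{0,1,2,\dots\}$. For $U\in\mathbb{C}^n$, $s\in\mathbb{N}^n$: $U^s=\prod_iU_i^{s_i}$, $s!=\prod_is_i!$, $|s|=\sum_is_i$. $\delta_{jk}$ is the Kronecker delta. The Siegel disk $\mathfrak{D}_n$ is the set of symmetric $W\in M_n(\mathbb{C})$ with $I_n-W\bar W$ positive definite; the Siegel-Jacobi disk is $\mathfrak{D}_n^J=\mathfrak{D}_n\times\mathbb{C}^n$. The holomorphic coordinates on $\mathfrak{D}_n^J$ are $W_{jk}$ ($1\le j\le k\le n$, with $W_{kj}=W_{jk}$ regarded as the same variable) and $z_1,\dots,z_n$. $\mathcal{O}(\mathfrak{D}_n^J)$ is the space of holomorphic functions on $\mathfrak{D}_n^J$ with the topology of uniform convergence on compact sets. The polynomials $P_s(Z,W)$ are defined by $\exp(U\,{}^tZ+\frac12UW\,{}^tU)=\sum_{s\in\mathbb{N}^n}\frac{U^s}{s!}P_s(Z,W)$ for all $U\in\mathbb{C}^n$. For $(W,z),(W',z')\in\mathfrak{D}_n^J$, $$A(W',z';W,z)=\left(\bar z+\tfrac12 z'\bar W\right)(I_n-W'\bar W)^{-1}\,{}^tz'+\tfrac12\,\bar z\,(I_n-W'\bar W)^{-1}W'\,{}^t\bar z .$$ The power $(\det(I_n-W'\bar W))^{-1/2}$ is the continuous branch on $\mathfrak{D}_n\times\mathfrak{D}_n$ equal to $1$ at $W'=0$. $\mathfrak{F}_m(\mathfrak{D}_n^J)$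 is the Hilbert space of holomorphic functions on $\mathfrak{D}_n^J$ whose inner product is defined by requiring $\{f_s\mid s\in\mathbb{N}^n\}$ to be an orthonormal basis; that is, it consists of all $f=\sum_sc_sf_s$ with $c_s\in\mathbb{C}$, $\sum_s|c_s|^2<\infty$. $\mathcal{H}_0(\mathfrak{D}_n^J)$ is the complex linear subspace of $\mathcal{O}(\mathfrak{D}_n^J)$ with (topological) basis $\{f_s\}$: it consists of all $f\in\mathcal{O}(\mathfrak{D}_n^J)$ that can be written as $f=\sum_{N=0}^\infty\sum_{|s|=N}c_sf_s$ with constants $c_s\in\mathbb{C}$, the series over $N$ converging uniformly on compact subsets of $\mathfrak{D}_n^J$. *)

(* Defs.v *)
From HB Require Import structures.
From mathcomp Require Import all_boot all_order all_algebra finmap.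
From mathcomp Require Import all_classical all_reals all_analysis.
From mathcomp Require Import summability.
From mathcomp Require Import complex.

Set Implicit Arguments.
Unset Strict Implicit.
Unset Printing Implicit Defensive.

Import Order.TTheory GRing.Theory Num.Theory.
Import numFieldNormedType.Exports.

Local Open Scope classical_set_scope.
Local Open Scope ring_scope.
Local Open Scope complex_scope.

(* R[i] with the topology of its modulus. *)
HB.instance Definition _ (R : realType) := NormedModule.copy R[i] R[i]^o.

Section Defs.
Variable R : realType.
Notation C := R[i].

Definition expC (z : C) : C :=
  (expR (complex.Re z))%:C * (cos (complex.Im z) +i* sin (complex.Im z)).

(* Unordered (net) summation over the finite subsets of I. *)
Definition has_sum (I : choiceType) (x : I -> C) (l : C) : Prop :=
  partial_sum x @ totally --> l.

Definition conjmat a b (M : 'M[C]_(a, b)) : 'M[C]_(a, b) := map_mx Num.conj M.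

(* The order of R[i] makes 0 < w mean that w is real and positive, so this
   includes that M is Hermitian. *)
Definition posdefmx k (M : 'M[C]_k) : Prop :=
  forall x : 'rV[C]_k, x != 0 -> 0 < (x *m M *m (conjmat x)^T) 0 0.

Definition reproducing_kernel (T : Type) (D : set T) (H : set (T -> C))
    (ip : (T -> C) -> (T -> C) -> C) (K : T -> T -> C) : Prop :=
  forall p, D p -> H (K ^~ p) /\ forall f, H f -> f p = ip f (K ^~ p).

Section SiegelJacobi.
Variable n : nat.

Definition multi := {ffun 'I_n -> nat}.
Definition mdeg (s : multi) : nat := (\sum_i s i)%N.
Definition mfact (s : multi) : nat := (\prod_i (s i)`!)%N.
Definition mpow (U : 'rV[C]_n) (s : multi) : C := \prod_i U 0 i ^+ s i.
Definition sqrt_mfact (s : multi) : C := (Num.sqrt (mfact s)%:R)%:C.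

Definition Pgen (Z : 'rV[C]_n) (W : 'M[C]_n) (U : 'rV[C]_n) : C :=
  expC ((U *m Z^T) 0 0 + 2^-1 * (U *m W *m U^T) 0 0).

(* The coefficients are unique: they are those of a power series in U that
   converges on all of C^n. *)
Definition Pcoef (Z : 'rV[C]_n) (W : 'M[C]_n) : multi -> C :=
  xget (fun=> 0) [set c : multi -> C | forall U : 'rV[C]_n,
    has_sum (fun s => mpow U s / (mfact s)%:R * c s) (Pgen Z W U)].

Definition Ppoly (s : multi) (Z : 'rV[C]_n) (W : 'M[C]_n) : C := Pcoef Z W s.

Definition siegel_disk : set 'M[C]_n :=
  [set W | W^T = W /\ posdefmx (1%:M - W *m conjmat W)].

Definition sjpoint := ('M[C]_n * 'rV[C]_n)%type.

Definition siegel_jacobi_disk : set sjpoint := siegel_disk `*` setT.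

(* The symmetric matrix whose coordinates W_jk, j <= k, are the upper
   triangular entries of V; the entries of V below the diagonal are ignored. *)
Definition symU (V : 'M[C]_n) : 'M[C]_n :=
  \matrix_(j, k) if (j <= k)%N then V j k else V k j.

(* f read in the coordinates (W_jk)_(j <= k), z. It is constant in the
   redundant strictly lower triangular entries, so its complex
   differentiability is that of f on the open subset siegel_jacobi_disk of
   (symmetric matrices) * C^n. *)
Definition in_coords (f : sjpoint -> C) : sjpoint -> C :=
  fun q => f (symU q.1, q.2).

Definition holomorphic (f : sjpoint -> C) : Prop :=
  forall p, siegel_jacobi_disk p -> differentiable (in_coords f) p.

(* For j <= k only. *)
Definition dW (j k : 'I_n) (f : sjpoint -> C) : sjpoint -> C :=
  fun p => 'D_((delta_mx j k, 0) : sjpoint) (in_coords f) p.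

Definition dz (j : 'I_n) (f : sjpoint -> C) : sjpoint -> C :=
  fun p => 'D_((0, delta_mx 0 j) : sjpoint) (in_coords f) p.

Variable m : R.

Definition fs (s : multi) (p : sjpoint) : C :=
  (sqrt_mfact s)^-1 * Ppoly s ((2 * Num.sqrt (2 * pi * m))%:C *: p.2) p.1.

Definition Aform (p' p : sjpoint) : C :=
  let: (W', z') := p' in
  let: (W, z) := p in
  let Q := invmx (1%:M - W' *m conjmat W) in
  ((conjmat z + 2^-1 *: (z' *m conjmat W)) *m Q *m z'^T) 0 0
  + 2^-1 * (conjmat z *m Q *m W' *m (conjmat z)^T) 0 0.

(* (det (I - W' conj W))^(-1/2) as a function of (W', W). The branch is unique
   on siegel_disk * siegel_disk, which is connected. *)
Definition det_invsqrt : 'M[C]_n * 'M[C]_n -> C :=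
  xget (fun=> 1) [set b : 'M[C]_n * 'M[C]_n -> C |
    [/\ {within siegel_disk `*` siegel_disk, continuous b},
        forall W' W, siegel_disk W' -> siegel_disk W ->
          b (W', W) ^+ 2 = (\det (1%:M - W' *m conjmat W))^-1
      & forall W, siegel_disk W -> b (0, W) = 1]].

Definition kernel_fun (p' p : sjpoint) : C :=
  det_invsqrt (p'.1, p.1) * expC ((8 * pi * m)%:C * Aform p' p).

Definition Fm_expansion (f : sjpoint -> C) (c : multi -> C) : Prop :=
  cvg (partial_sum (fun s => `|c s| ^+ 2) @ totally) /\
  forall p, siegel_jacobi_disk p -> has_sum (fun s => c s * fs s p) (f p).

Definition Fm : set (sjpoint -> C) :=
  [set f | holomorphic f /\ exists c, Fm_expansion f c].

(* c is unique: fs s (0, z) is a nonzero multiple of the monomial z^s. *)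
Definition Fm_coef (f : sjpoint -> C) : multi -> C :=
  xget (fun=> 0) [set c | Fm_expansion f c].

(* The inner product for which (fs s)_s is an orthonormal basis. *)
Definition Fm_ip (f g : sjpoint -> C) : C :=
  summability.sum (fun s => Fm_coef f s * Num.conj (Fm_coef g s)).

Definition H0 : set (sjpoint -> C) :=
  [set f | holomorphic f /\ exists c : multi -> C,
    forall K : set sjpoint, compact K -> K `<=` siegel_jacobi_disk ->
      {uniform K, (fun (M : nat) (p : sjpoint) =>
         \sum_(N < M) \sum_(s \in [set s : multi | mdeg s = N]) c s * fs s p)
         @ \oo --> f}].

End SiegelJacobi.
End Defs.

(* Main.v *)
(* In the coordinates W_jk and z_j the generating function is a product of
   exponentials, so f_s is a multiple of the sum of all normalized monomials of
   weight s, where W_jk counts for one j and one k. The differential equations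
   identify d/dW_jk with d/dz_j d/dz_k (up to constants); hence the Taylor
   coefficients at the origin of a solution depend only on the weight and its
   Taylor series regroups into a series in the f_s. Cauchy's estimates on the
   curves t |-> (t^2 W, t z) make that series converge uniformly on compact sets;
   they also show that the equations pass to such limits.
   The kernel solves the equations in its first argument, hence has an expansion
   in the f_s, and its coefficients are read off at W' = 0, where the kernel is a
   value of the generating function. On the diagonal the expansion has nonnegative
   terms, so that (f_s(p))_s is square summable, which gives the unordered
   convergence off the diagonal. The square root of the determinant is
   constructed from the leading minors of I - W' conj W, whose consecutive
   quotients have positive real part. *)
Require Import Defs.
From HB Require Import structures.
From mathcomp Require Import all_boot all_order all_algebra finmap fingroup perm.
From mathcomp Require Import all_classical all_reals all_analysis.
From mathcomp Require Import summability.
From mathcomp Require Import complex.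
From mathcomp Require Import ring lra zify.
Import Order.TTheory GRing.Theory Num.Theory.
Import numFieldNormedType.Exports.
Local Open Scope classical_set_scope.
Local Open Scope ring_scope.
Local Open Scope complex_scope.
Set Implicit Arguments.
Unset Strict Implicit.
Unset Printing Implicit Defensive.

(** * The real-valued modulus on the complex numbers *)

Section ComplexModulus.
Variable R : realType.
Notation C := R[i].
Implicit Types (z w : C) (x : R).

(** The predicate [holomorphic] grants complex differentiability at each point, not continuity of
    derivatives, so power series are extracted by Goursat's bisection. Contour integrals are Riemann
    sums over the [2 ^ N]-th roots of unity, for which the Cauchy kernel has an exact mean. Each
    finite mean of Cauchy kernels is a power series obeying Cauchy's estimates with the same
    constant; an ultrafilter limit of the coefficients then gives the series of the function from
    pointwise convergence alone. Each [W_jk] is split into [x_(j,k) + x_(k,j)], one variable for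
    each ordered pair. With coefficients taken against divided monomials, both [8 pi m] and
    [1 + delta_jk] are absorbed, and the system says that the shifts by [x_j x_l] and by [x_(j,l)]
    agree. Two kinds of convergence are kept apart: [has_sum] is unordered, hence absolute, while
    membership in [H0] gives convergence by degrees only. The coefficients of such an expansion must
    be separated by degree, through dilations, before monomials can be compared. *)

Definition cabs z : R := complex.Re `|z|.

(** The norm of [R[i]] takes its values in [R[i]] itself; [cabs] is the same number read in [R],
    where estimates can use a total order. *)
Lemma normE z : `|z| = (cabs z)%:C.
Proof. by rewrite /cabs normc_def. Qed.

Lemma cabs_ge0 z : 0 <= cabs z.
Proof. by rewrite /cabs normc_def /= sqrtr_ge0. Qed.

Lemma cabsM z w : cabs (z * w) = cabs z * cabs w.
Proof. by apply: (@complexI R); rewrite rmorphM /= -!normE normrM. Qed.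

Lemma cabsR x : cabs x%:C = `|x|.
Proof. by rewrite /cabs normc_def /= expr0n /= addr0 sqrtr_sqr. Qed.

Lemma cabs0 : cabs 0 = 0. Proof. by rewrite /cabs normr0. Qed.
Lemma cabs1 : cabs 1 = 1. Proof. by rewrite /cabs normr1. Qed.
Lemma cabsN z : cabs (- z) = cabs z. Proof. by rewrite /cabs normrN. Qed.

Lemma cabsD z w : cabs (z + w) <= cabs z + cabs w.
Proof. by rewrite -lecR rmorphD /= -!normE ler_normD. Qed.

Lemma cabsB z w : cabs (z - w) <= cabs z + cabs w.
Proof. by rewrite -(cabsN w) cabsD. Qed.

Lemma cabs_distC z w : cabs (z - w) = cabs (w - z).
Proof. by rewrite -cabsN opprB. Qed.

Lemma cabs_triang w z u : cabs (z - u) <= cabs (z - w) + cabs (w - u).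
Proof. by have := cabsD (z - w) (w - u); rewrite addrA subrK. Qed.

Lemma cabs_eq0 z : (cabs z == 0) = (z == 0).
Proof.
by rewrite -(normr_eq0 z) normE -(inj_eq (@complexI R)).
Qed.

Lemma cabs_gt0 z : (0 < cabs z) = (z != 0).
Proof. by rewrite lt_def cabs_eq0 cabs_ge0 andbT. Qed.

Lemma cabsX z k : cabs (z ^+ k) = cabs z ^+ k.
Proof. by elim: k => [|k IH]; rewrite ?expr0 ?cabs1 // !exprS cabsM IH. Qed.

Lemma cabsV z : cabs z^-1 = (cabs z)^-1.
Proof.
have [->|z0] := eqVneq z 0; first by rewrite invr0 cabs0 invr0.
apply: (@mulfI _ (cabs z)); first by rewrite cabs_eq0.
by rewrite -cabsM !mulfV ?cabs1 ?cabs_eq0.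
Qed.

Lemma cabs_natr k : cabs k%:R = k%:R.
Proof. by rewrite -(rmorph_nat (real_complex R)) cabsR ger0_norm. Qed.

Lemma cabsJ z : cabs (Num.conj z) = cabs z.
Proof. by rewrite /cabs norm_conjC. Qed.

Lemma cabs_sum I (r : seq I) (P : pred I) (F : I -> C) :
  cabs (\sum_(i <- r | P i) F i) <= \sum_(i <- r | P i) cabs (F i).
Proof.
elim/big_rec2: _ => [|i y z _ h]; first by rewrite cabs0.
by apply: le_trans (cabsD _ _) _; rewrite lerD2l.
Qed.

Lemma cabs_prod I (r : seq I) (P : pred I) (F : I -> C) :
  cabs (\prod_(i <- r | P i) F i) = \prod_(i <- r | P i) cabs (F i).
Proof. by elim/big_rec2: _ => [|i y z _ h]; rewrite ?cabs1 // cabsM h. Qed.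

Lemma cabs_lt z x : (`|z| < x%:C) = (cabs z < x).
Proof. by rewrite normE ltcR. Qed.

Lemma cabs_le0P z : (forall e : R, 0 < e -> cabs z <= e) -> z = 0.
Proof.
move=> h; apply/eqP; rewrite -cabs_eq0 eq_le cabs_ge0 andbT.
by apply/ler_addgt0Pl => e e0; rewrite addr0 h.
Qed.

Lemma cabs_Re z : `|complex.Re z| <= cabs z.
Proof. by rewrite -lecR -normE normc_ge_Re. Qed.

Lemma cabs_Im z : `|complex.Im z| <= cabs z.
Proof.
rewrite /cabs normc_def /= -sqrtr_sqr ler_wsqrtr // lerDr sqr_ge0 //.
Qed.

Lemma cabs_ReIm z : cabs z <= `|complex.Re z| + `|complex.Im z|.
Proof.
rewrite {1}[z]complexE; apply: le_trans (cabsD _ _) _.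
rewrite cabsM !cabsR; suff -> : cabs 'i%C = 1 by rewrite mul1r.
by rewrite /cabs normc_def /= expr0n /= expr1n add0r sqrtr1.
Qed.

End ComplexModulus.

(** * Limits along filters and unordered sums *)

Section Families.
Variable R : realType.
Notation C := R[i].

(** One epsilon form serves all filters of the proof: [\oo], [totally], ultrafilters, neighborhoods
    and the filter [small] of increments. The bound is real and non-strict, so that it chains with
    [cabs] estimates. *)
Definition flim T (F : set_system T) (u : T -> C) (l : C) :=
  forall e : R, 0 < e -> F [set t | cabs (u t - l) <= e].

Lemma flimP T (F : set_system T) {FF : Filter F} (u : T -> C) (l : C) :
  flim F u l <-> u @ F --> l.
Proof.
split=> [h|/cvgrPdist_le h].
  apply/cvgrPdist_le => e e0.
  have ee : e = (complex.Re e)%:C by rewrite RRe_real ?gtr0_real.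
  have e0' : 0 < complex.Re e by rewrite -ltcR -ee.
  near=> t.
  rewrite ee normE lecR cabs_distC; near: t; exact: h.
move=> e e0; have e0' : (0 : C) < e%:C by rewrite ltcR.
apply: filterS (h _ e0') => t /=.
by rewrite normE lecR cabs_distC.
Unshelve. all: by end_near.
Qed.

Lemma flim_unique T (F : set_system T) {FF : ProperFilter F} u l l' :
  flim F u l -> flim F u l' -> l = l'.
Proof.
move=> h h'; apply/eqP; rewrite -subr_eq0; apply/eqP/cabs_le0P => e e0.
have e2 : 0 < e / 2 by rewrite divr_gt0.
near F => t; apply: le_trans (cabs_triang (u t) _ _) _.
rewrite [e]splitr lerD //; first rewrite cabs_distC; near: t; first exact: h.
exact: h'.
Unshelve. all: by end_near.
Qed.

Variable I : choiceType.
Implicit Types (x y : I -> C) (A B : {fset I}) (D : I -> R).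

Lemma partial_sumE (V : zmodType) (x : I -> V) A :
  partial_sum x A = \sum_(i <- A) x i.
Proof. by rewrite /partial_sum big_seq_fsetE. Qed.

Lemma has_sum_flim x l : has_sum x l <-> flim totally (partial_sum x) l.
Proof.
exact: iff_sym (@flimP _ _ (@filter_filter _ _ totally_filter) _ _).
Qed.

Lemma has_sumP x l : has_sum x l <-> forall e : R, 0 < e ->
  exists A, forall B, (A `<=` B)%fset -> cabs (\sum_(i <- B) x i - l) <= e.
Proof.
split=> [/has_sum_flim h e e0|h].
  have [A _ hA] := h _ e0; exists A => B AB.
  by have := hA B AB; rewrite /= partial_sumE.
apply/has_sum_flim => e e0; have [A hA] := h _ e0.
by exists A => // B AB /=; rewrite partial_sumE hA.
Qed.

Lemma has_sum_unique x l l' : has_sum x l -> has_sum x l' -> l = l'.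
Proof.
move=> /has_sum_flim h /has_sum_flim h'.
exact: (@flim_unique _ _ totally_filter _ _ _ h h').
Qed.

Lemma eq_has_sum x y l : x =1 y -> has_sum x l -> has_sum y l.
Proof. by move=> /funext ->. Qed.

Lemma has_sum0 : has_sum (fun _ : I => 0 : C) 0.
Proof.
by apply/has_sumP => e e0; exists fset0 => B _; rewrite big1 // subr0 cabs0 ltW.
Qed.

Lemma has_sumD x y l k :
  has_sum x l -> has_sum y k -> has_sum (fun i => x i + y i) (l + k).
Proof.
move=> /has_sumP h /has_sumP h'; apply/has_sumP => e e0.
have e2 : 0 < e / 2 by rewrite divr_gt0.
have [A hA] := h _ e2; have [B hB] := h' _ e2.
exists (A `|` B)%fset => D; rewrite fsubUset => /andP[/hA a /hB b].
rewrite big_split /= opprD addrACA; apply: le_trans (cabsD _ _) _.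
by rewrite [e]splitr lerD.
Qed.

Lemma has_sumZ c x l : has_sum x l -> has_sum (fun i => c * x i) (c * l).
Proof.
move=> /has_sumP h; apply/has_sumP => e e0.
have c1 : 0 < cabs c + 1 by rewrite ltr_wpDl ?cabs_ge0.
have [A hA] := h (e / (cabs c + 1)) (divr_gt0 e0 c1).
exists A => B /hA a; rewrite -mulr_sumr -mulrBr cabsM.
apply: le_trans (_ : (cabs c + 1) * (e / (cabs c + 1)) <= _).
  by apply: ler_pM => //; rewrite ?cabs_ge0 ?lerDl.
by rewrite mulrC divfK ?gt_eqF.
Qed.
Arguments has_sumZ c {x l}.

Lemma has_sumB x y l k :
  has_sum x l -> has_sum y k -> has_sum (fun i => x i - y i) (l - k).
Proof.
move=> h /(has_sumZ (-1)) h'; rewrite -[- k]mulN1r.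
by apply: eq_has_sum (has_sumD h h') => i; rewrite mulN1r.
Qed.

Lemma has_sum_sum J (r : seq J) (x : J -> I -> C) (l : J -> C) :
  (forall j, has_sum (x j) (l j)) ->
  has_sum (fun i => \sum_(j <- r) x j i) (\sum_(j <- r) l j).
Proof.
move=> h; elim: r => [|j r IH].
  by rewrite big_nil; apply: eq_has_sum has_sum0 => i; rewrite big_nil.
rewrite big_cons; apply: eq_has_sum (has_sumD (h j) IH) => i.
by rewrite big_cons.
Qed.

Definition bsum D := exists M, forall A, \sum_(i <- A) D i <= M.
Definition asum x := bsum (fun i => cabs (x i)).

Lemma bsum_le D D' : (forall i, D i <= D' i) -> bsum D' -> bsum D.
Proof.
by move=> h [M hM]; exists M => A; apply: le_trans (hM A); apply: ler_sum.
Qed.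

Lemma bsumZ c D : 0 <= c -> bsum D -> bsum (fun i => c * D i).
Proof.
by move=> c0 [M hM]; exists (c * M) => A; rewrite -mulr_sumr ler_wpM2l.
Qed.

Lemma sum_fsetD (V : zmodType) (x : I -> V) A B : (A `<=` B)%fset ->
  \sum_(i <- B) x i = \sum_(i <- A) x i + \sum_(i <- (B `\` A)%fset) x i.
Proof.
by move=> AB; rewrite [LHS](big_fsetID _ (fun i => i \in A)) /=; congr (_ + _);
  apply: eq_fbigl => i; rewrite !inE /= andbC //; case: (boolP (i \in A)) => //= iA;
  rewrite (fsubsetP AB).
Qed.

Lemma ler_sum_fset D A B : (forall i, 0 <= D i) -> (A `<=` B)%fset ->
  \sum_(i <- A) D i <= \sum_(i <- B) D i.
Proof. by move=> D0 AB; rewrite (sum_fsetD _ AB) lerDl sumr_ge0. Qed.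

(** For [A] with a sum within [e] of the supremum of all finite sums, a disjoint [B] can add no more
    than the missing [e]. *)
Lemma bsum_tail D : (forall i, 0 <= D i) -> bsum D -> forall e, 0 < e ->
  exists A, forall B, [disjoint A & B]%fset -> \sum_(i <- B) D i <= e.
Proof.
move=> D0 [M hM] e e0.
pose S := [set r | exists A, r = \sum_(i <- A) D i].
have hS : has_sup S.
  by split; [exists 0, fset0; rewrite big_seq_fset0|exists M => _ [A ->]].
have [_ [A ->] hA] := sup_adherent e0 hS.
exists A => B AB.
have AU : (A `<=` A `|` B)%fset by rewrite fsubsetUl.
have : \sum_(i <- (A `|` B)%fset) D i <= sup S.
  by apply: ub_le_sup; [exact: hS.2|exists (A `|` B)%fset].
rewrite (sum_fsetD _ AU).
have -> : ((A `|` B) `\` A)%fset = B.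
  by rewrite fsetDUl fsetDv fset0U; apply/fsetDidPl; rewrite fdisjoint_sym.
by move=> h; lra.
Qed.

Lemma bsum_has_sum D : (forall i, 0 <= D i) -> bsum D ->
  exists s : R, has_sum (fun i => (D i)%:C) s%:C.
Proof.
move=> D0 hD; have [M hM] := hD.
pose S := [set r | exists A, r = \sum_(i <- A) D i].
have hS : has_sup S.
  by split; [exists 0, fset0; rewrite big_seq_fset0|exists M => _ [A ->]].
exists (sup S); apply/has_sumP => e e0.
have [_ [A ->] hA] := sup_adherent e0 hS; exists A => B AB.
rewrite -rmorph_sum -rmorphB cabsR /= distrC ger0_norm; last first.
  by rewrite subr_ge0; apply: ub_le_sup; [exact: hS.2|exists B].
rewrite lerBlDr -lerBlDl; apply: le_trans (ltW hA) _.
exact: ler_sum_fset.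
Qed.

Lemma asum_has_sum x : asum x -> exists l, has_sum x l.
Proof.
move=> hx.
(* For [g] the real or imaginary part, [cabs + g] is nonnegative and at most [2 * cabs], so [g] is a
   difference of two summable nonnegative families. *)
have key (g : C -> R) : (forall z, `|g z| <= cabs z) ->
    exists s : R, has_sum (fun i => (g (x i))%:C) s%:C.
  move=> hg.
  have [||s1 h1] := @bsum_has_sum (fun i => cabs (x i) + g (x i)).
  - by move=> i; have := hg (x i); rewrite ler_norml => /andP[]; lra.
  - apply: bsum_le (bsumZ (_ : 0 <= 2) hx) => // i /=.
    by have := hg (x i); rewrite ler_norml => /andP[]; lra.
  have [s2 h2] := @bsum_has_sum (fun i => cabs (x i)) (fun i => cabs_ge0 _) hx.
  exists (s1 - s2); rewrite rmorphB; apply: eq_has_sum (has_sumB h1 h2) => i.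
  by rewrite -rmorphB /= addrC addKr.
have [s hs] := key _ (@cabs_Re R); have [t ht] := key _ (@cabs_Im R).
exists (s%:C + 'i%C * t%:C); apply: eq_has_sum (has_sumD hs (has_sumZ _ ht)) => i.
by rewrite -complexE.
Qed.

Lemma has_sum_tail x l A M : has_sum x l ->
  (forall B, [disjoint A & B]%fset -> \sum_(i <- B) cabs (x i) <= M) ->
  cabs (l - \sum_(i <- A) x i) <= M.
Proof.
move=> /has_sumP h hM; apply/ler_addgt0Pr => e e0; have [B hB] := h _ e0.
have /hB {}hB : (B `<=` A `|` B)%fset by rewrite fsubsetUr.
have AU : (A `<=` A `|` B)%fset by rewrite fsubsetUl.
rewrite cabs_distC.
apply: le_trans (cabs_triang (\sum_(i <- (A `|` B)%fset) x i) _ _) _.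
apply: lerD => //; rewrite (sum_fsetD _ AU) opprD addrA subrr sub0r cabsN.
apply: le_trans (cabs_sum _ _ _) (hM _ _).
by apply/fdisjointP => i iA; rewrite !inE iA.
Qed.

(** Tannery's theorem along an arbitrary proper filter: outside a finite set the majorant [D] makes
    both tails small, and on the finite set termwise convergence suffices. *)
Lemma has_sum_dominated T (F : set_system T) {FF : ProperFilter F}
    (x : T -> I -> C) (g : T -> C) y l D :
  bsum D -> (\forall t \near F, forall i, cabs (x t i) <= D i) ->
  (forall i, flim F (x ^~ i) (y i)) ->
  (\forall t \near F, has_sum (x t) (g t)) -> has_sum y l -> flim F g l.
Proof.
move=> hD hxD hxy hxg hyl e e0.
have D0 i : 0 <= D i.
  by have [t /(_ i)] := filter_ex hxD; apply: le_trans; rewrite cabs_ge0.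
have hyD i : cabs (y i) <= D i.
  apply/ler_addgt0Pr => d d0.
  near F => t.
  rewrite -[y i](subKr (x t i)); apply: le_trans (cabsB _ _) _.
  rewrite lerD //; last by near: t; exact: hxy.
  by have /(_ i) : forall i, cabs (x t i) <= D i by near: t.
have e3 : 0 < e / 3 by rewrite divr_gt0.
have [A hA] := bsum_tail D0 hD e3.
have fA : F [set t | cabs (\sum_(i <- A) x t i - \sum_(i <- A) y i) <= e / 3].
  (* The added 1 keeps the divisor positive when [A] is empty. *)
  have n0 : 0 < e / 3 / (#|`A|%:R + 1) by rewrite divr_gt0 // ltr_wpDl.
  have : F [set t | forall i, i \in A ->
       cabs (x t i - y i) <= e / 3 / (#|`A|%:R + 1)].
    have -> : [set t | forall i, i \in A -> cabs (x t i - y i) <= e / 3 / (#|`A|%:R + 1)]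
        = \bigcap_(i in [set` A]) [set t | cabs (x t i - y i) <= e / 3 / (#|`A|%:R + 1)].
      by apply/seteqP; split=> t h i /h.
    by apply: filter_bigI => i _; exact: hxy.
  apply: filterS => t h /=; rewrite -sumrB; apply: le_trans (cabs_sum _ _ _) _.
  apply: le_trans (_ : \sum_(i <- A) e / 3 / (#|`A|%:R + 1) <= _).
    by rewrite big_seq [leRHS]big_seq; apply: ler_sum => i /h.
  rewrite big_const_seq count_predT iter_addr_0 -[_ *+ _]mulr_natr.
  rewrite -mulrA ler_piMr ?(ltW e3) //.
  by rewrite ler_pdivrMl ?ltr_wpDl // mulr1 lerDl.
near=> t => /=.
have h1 : cabs (g t - \sum_(i <- A) x t i) <= e / 3.
  apply: has_sum_tail; first by near: t.
  move=> B AB; apply: le_trans (hA B AB); apply: ler_sum => i _.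
  by have /(_ i) : forall i, cabs (x t i) <= D i by near: t.
have h2 : cabs (l - \sum_(i <- A) y i) <= e / 3.
  apply: has_sum_tail hyl _ => B AB; apply: le_trans (hA B AB).
  by apply: ler_sum.
have h3 : cabs (\sum_(i <- A) x t i - \sum_(i <- A) y i) <= e / 3 by near: t.
apply: le_trans (cabs_triang (\sum_(i <- A) x t i) _ _) _.
have := cabs_triang (\sum_(i <- A) y i) (\sum_(i <- A) x t i) l.
move: h2; rewrite cabs_distC; lra.
Unshelve. all: by end_near.
Qed.

(** An absolutely summable family has some unordered sum, whose value can therefore be read along
    any one exhaustion by finite sets. *)
Lemma has_sum_seq x l (A : nat -> {fset I}) : asum x ->
  (forall B, exists N0, forall N, (N0 <= N)%N -> (B `<=` A N)%fset) ->
  flim \oo (fun N => \sum_(i <- A N) x i) l -> has_sum x l.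
Proof.
move=> /asum_has_sum [k hk] hA hl.
suff <- : k = l by [].
apply: flim_unique hl => e e0; have /has_sumP/(_ _ e0)[B hB] := hk.
by have [N0 h] := hA B; exists N0 => // N /h; exact: hB.
Qed.

End Families.

(** * Absolute convergence, regrouping and products of families *)

Section Rearrangement.
Variable R : realType.
Notation C := R[i].

Lemma big_seq_fset (V : nmodType) (I : choiceType) (s : seq I) (x : I -> V) :
  uniq s -> \sum_(i <- seq_fset tt s) x i = \sum_(i <- s) x i.
Proof.
move=> us; apply: perm_big.
by rewrite (perm_trans (seq_fset_perm tt s)) // undup_id.
Qed.

Section Asum.
Variable I : choiceType.
Implicit Types (x : I -> C) (A B : {fset I}).

(** The Cauchy criterion bounds every finite sum outside [A] by 2. Applied to the indices where the
    real or the imaginary part has a fixed sign, it bounds the sum of absolute values by 4 for each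
    part, hence by 8 for the modulus. *)
Lemma has_sum_asum x l : has_sum x l -> asum x.
Proof.
move=> /has_sumP /(_ _ ltr01) [A hA].
have h2 B : [disjoint A & B]%fset -> cabs (\sum_(i <- B) x i) <= 2.
  move=> AB; have AU : (A `<=` A `|` B)%fset by rewrite fsubsetUl.
  have := hA _ AU; have := hA A (fsubset_refl _); rewrite (sum_fsetD _ AU).
  have -> : ((A `|` B) `\` A)%fset = B.
    by rewrite fsetDUl fsetDv fset0U; apply/fsetDidPl; rewrite fdisjoint_sym.
  set a := \sum_(i <- A) _; set b := \sum_(i <- B) _ => h1 h3.
  have -> : b = (a + b - l) - (a - l) by ring.
  by apply: le_trans (cabsB _ _) _; lra.
have key (g : {additive C -> R}) : (forall z, `|g z| <= cabs z) ->
    forall B, [disjoint A & B]%fset -> \sum_(i <- B) `|g (x i)| <= 4.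
  move=> hg B AB.
  have half (P : pred I) : `|\sum_(i <- B | P i) g (x i)| <= 2.
    rewrite -raddf_sum; apply: le_trans (hg _) _.
    rewrite big_fset_condE; apply: h2; apply/fdisjointP => i iA.
    by rewrite !inE negb_and (fdisjointP AB).
  have := half (fun i => 0 <= g (x i)); have := half (fun i => ~~ (0 <= g (x i))) => b1 b2.
  rewrite (bigID (fun i => 0 <= g (x i))) /=.
  have -> : \sum_(i <- B | 0 <= g (x i)) `|g (x i)| =
            \sum_(i <- B | 0 <= g (x i)) g (x i).
    by apply: eq_bigr => i h; rewrite ger0_norm.
  have -> : \sum_(i <- B | ~~ (0 <= g (x i))) `|g (x i)| =
            - \sum_(i <- B | ~~ (0 <= g (x i))) g (x i).
    by rewrite -sumrN; apply: eq_bigr => i h; rewrite ltr0_norm // ltNge.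
  by move: b1 b2; rewrite !ler_norml => /andP[? ?] /andP[? ?]; lra.
exists (\sum_(i <- A) cabs (x i) + 8) => B.
have AU : (A `<=` A `|` B)%fset by rewrite fsubsetUl.
apply: le_trans (ler_sum_fset (fun i => cabs_ge0 (x i)) (fsubsetUr A B)) _.
rewrite (sum_fsetD _ AU) lerD2l.
set D := (_ `\` _)%fset; have AD : [disjoint A & D]%fset.
  by apply/fdisjointP => i iA; rewrite !inE iA.
apply: le_trans (ler_sum _ (fun i _ => cabs_ReIm (x i))) _.
have Rea : zmod_morphism (@complex.Re R) by move=> [a b] [c d].
have Ima : zmod_morphism (@complex.Im R) by move=> [a b] [c d].
pose Rem := GRing.isZmodMorphism.Build _ _ _ Rea.
pose Imm := GRing.isZmodMorphism.Build _ _ _ Ima.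
pose Ref : {additive C -> R} := HB.pack (@complex.Re R) Rem.
pose Imf : {additive C -> R} := HB.pack (@complex.Im R) Imm.
rewrite big_split /=; have := key Ref (@cabs_Re R) D AD.
have := key Imf (@cabs_Im R) D AD; rewrite /= => h3 h4; lra.
Qed.

Lemma has_sum_group (J : choiceType) (x : I -> C) (phi : I -> J) (F : J -> {fset I}) l :
  (forall i j, (i \in F j) = (phi i == j)) -> has_sum x l ->
  has_sum (fun j => \sum_(i <- F j) x i) l.
Proof.
move=> hF /has_sumP h; apply/has_sumP => e e0; have [A hA] := h _ e0.
exists [fset phi i | i in A]%fset => B AB.
(* [U] is the union of the fibers over [B], so the sum of the fiber sums over [B] is a single
   partial sum of [x]. *)
have [U sP] : exists U : {fset I}, forall i, (i \in U) = (phi i \in B).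
  exists (seq_fset tt [seq i | j <- enum_fset B, i <- enum_fset (F j)]) => i.
  rewrite seq_fsetE; apply/allpairsPdep/idP => [[j [k [jB kF ->]]]|iB].
    by move: kF; rewrite hF => /eqP ->.
  by exists (phi i), i; rewrite hF.
have -> : \sum_(j <- B) \sum_(i <- F j) x i = \sum_(i <- U) x i.
  rewrite [RHS](_ : _ = \sum_(i <- U) \sum_(j <- B | phi i == j) x i).
    rewrite (exchange_big_dep predT) //= [LHS]big_seq [RHS]big_seq.
    apply: eq_bigr => j jB; rewrite [RHS]big_fset_condE; apply: eq_fbigl => i.
    by rewrite !inE /= sP hF; case: eqP => [->|]; rewrite ?jB ?andbF.
  rewrite [LHS]big_seq [RHS]big_seq; apply: eq_bigr => i; rewrite sP => iB.
  rewrite (big_rem (phi i)) //= eqxx big1_seq ?addr0 // => j.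
  by rewrite mem_rem_uniq ?fset_uniq // inE eq_sym; case: eqP.
apply: hA; apply/fsubsetP => i iA; rewrite sP.
by apply: (fsubsetP AB); apply: in_imfset.
Qed.

Lemma has_sum_reindex (J : choiceType) (x : I -> C) (h : J -> I) (k : I -> J) l :
  cancel h k -> (forall i, (forall j, i <> h j) -> x i = 0) ->
  has_sum x l -> has_sum (x \o h) l.
Proof.
move=> hk x0 /has_sumP hx; apply/has_sumP => e e0; have [A hA] := hx _ e0.
exists [fset k i | i in A]%fset => B AB.
have AU : ([fset h j | j in B] `<=` [fset h j | j in B] `|` A)%fset.
  by rewrite fsubsetUl.
have := hA _ (fsubsetUr [fset h j | j in B]%fset A).
rewrite (sum_fsetD _ AU) (big_imfset (@GRing.add C)) /=; last first.
  by move=> ? ? _ _; exact: (can_inj hk).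
rewrite [X in _ + X - _](_ : _ = 0) ?addr0 // big1_seq // => i /=.
rewrite !inE => /andP[iB iA]; apply: x0 => j ij; move: iB iA.
rewrite ij => /negP jB; case/orP => [|jA]; first by move/jB.
by apply: jB; apply: in_imfset; apply: (fsubsetP AB); rewrite -(hk j); apply: in_imfset.
Qed.

Lemma has_sum_finite x A : (forall i, i \notin A -> x i = 0) ->
  has_sum x (\sum_(i <- A) x i).
Proof.
move=> x0; apply/has_sumP => e e0; exists A => B AB.
rewrite (sum_fsetD _ AB) addrAC subrr add0r big1_seq ?cabs0 ?ltW // => i.
by rewrite !inE => /andP[_ /andP[iA _]]; exact: x0.
Qed.

End Asum.

Lemma flim_cst T (F : set_system T) {FF : Filter F} (c : C) : flim F (fun=> c) c.
Proof.
by move=> e e0; apply: filterE => t /=; rewrite subrr cabs0 ltW.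
Qed.

Lemma flim_ext T (F : set_system T) {FF : Filter F} (u v : T -> C) l :
  (\forall t \near F, u t = v t) -> flim F u l -> flim F v l.
Proof.
by move=> uv h e e0; apply: filterS2 uv (h _ e0) => t /= ->.
Qed.

Lemma flimD T (F : set_system T) {FF : Filter F} (u v : T -> C) l k :
  flim F u l -> flim F v k -> flim F (fun t => u t + v t) (l + k).
Proof.
move=> hu hv e e0; have e2 : 0 < e / 2 by rewrite divr_gt0.
apply: filterS2 (hu _ e2) (hv _ e2) => t /= a b.
by rewrite opprD addrACA [e]splitr; apply: le_trans (cabsD _ _) _; rewrite lerD.
Qed.

Lemma flimZ T (F : set_system T) {FF : Filter F} (c : C) (u : T -> C) l :
  flim F u l -> flim F (fun t => c * u t) (c * l).
Proof.
move=> hu e e0; have c1 : 0 < cabs c + 1 by rewrite ltr_wpDl ?cabs_ge0.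
apply: filterS (hu _ (divr_gt0 e0 c1)) => t /= a; rewrite -mulrBr cabsM.
apply: le_trans (_ : (cabs c + 1) * (e / (cabs c + 1)) <= _).
  by apply: ler_pM; rewrite ?cabs_ge0 ?lerDl.
by rewrite mulrC divfK ?gt_eqF.
Qed.

Lemma flimM0 T (F : set_system T) {FF : Filter F} (u v : T -> C) :
  flim F u 0 -> flim F v 0 -> flim F (fun t => u t * v t) 0.
Proof.
move=> hu hv e e0; apply: filterS2 (hu _ e0) (hv _ ltr01) => t /=.
rewrite !subr0 cabsM => a b; rewrite -[e]mulr1.
by apply: ler_pM; rewrite ?cabs_ge0.
Qed.

Lemma flimM T (F : set_system T) {FF : Filter F} (u v : T -> C) l k :
  flim F u l -> flim F v k -> flim F (fun t => u t * v t) (l * k).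
Proof.
move=> hu hv.
have d (w : T -> C) a : flim F w a -> flim F (fun t => w t - a) 0.
  by move=> h e /h; apply: filterS => t /=; rewrite subr0.
have -> : (fun t => u t * v t) =
    (fun t => (u t - l) * (v t - k) + l * (v t - k) + (k * (u t - l) + l * k)).
  by apply/funext => t; ring.
suff: flim F (fun t => (u t - l) * (v t - k) + l * (v t - k) + (k * (u t - l) + l * k))
    (0 + l * 0 + (k * 0 + l * k)) by rewrite !mulr0 !add0r.
apply: flimD; apply: flimD.
- by apply: flimM0; exact: d.
- by apply: flimZ; exact: d.
- by apply: flimZ; exact: d.
- exact: flim_cst.
Qed.

Lemma flim_prod T (F : set_system T) {FF : Filter F} (I : finType)
    (u : I -> T -> C) (l : I -> C) :
  (forall i, flim F (u i) (l i)) ->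
  flim F (fun t => \prod_i u i t) (\prod_i l i).
Proof.
move=> h; elim: (index_enum I) => [|i r IH].
  by rewrite big_nil; under eq_fun do rewrite big_nil; exact: flim_cst.
rewrite big_cons; under eq_fun do rewrite big_cons; exact: flimM.
Qed.

Lemma has_sum_nat (x : nat -> C) l : has_sum x l ->
  flim \oo (fun N => \sum_(i < N) x i) l.
Proof.
move=> /has_sumP h e e0; have [A hA] := h _ e0.
exists (\max_(i <- A) i).+1 => // N /= hN.
have -> : \sum_(i < N) x i = \sum_(i <- seq_fset tt (iota 0 N)) x i.
  by rewrite big_seq_fset ?iota_uniq // -[N in iota _ N]subn0 -/(index_iota 0 N) big_mkord.
apply: hA; apply/fsubsetP => i iA; rewrite seq_fsetE mem_iota /=.
by apply: leq_trans hN; rewrite ltnS; apply: leq_bigmax_seq.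
Qed.

Lemma has_sum_geom (t : C) : cabs t < 1 ->
  has_sum (fun k => t ^+ k) (1 - t)^-1.
Proof.
move=> t1; have ct : `|cabs t| < 1 by rewrite ger0_norm ?cabs_ge0.
have nt : 1 - t != 0.
  by apply: contraTneq t1 => /eqP; rewrite subr_eq0 => /eqP <-; rewrite cabs1 ltxx.
apply: (@has_sum_seq _ _ _ _ (fun N => seq_fset tt (iota 0 N))).
- exists (1 - cabs t)^-1 => A.
  have AS : (A `<=` seq_fset tt (iota 0 (\max_(i <- A) i).+1))%fset.
    by apply/fsubsetP => i iA; rewrite seq_fsetE mem_iota /= ltnS; apply: leq_bigmax_seq.
  apply: le_trans (ler_sum_fset (fun i => cabs_ge0 _) AS) _.
  rewrite big_seq_fset ?iota_uniq //; set N := _.+1.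
  rewrite -[N in iota _ N]subn0 -/(index_iota 0 N) big_mkord.
  have t0 : 0 < 1 - cabs t by rewrite subr_gt0.
  rewrite -(ler_pM2l t0) mulfV ?gt_eqF //.
  under eq_bigr do rewrite cabsX.
  have := subrX1 (cabs t) N; have : 0 <= cabs t ^+ N by rewrite exprn_ge0 ?cabs_ge0.
  lra.
- move=> B; exists (\max_(i <- B) i).+1 => N hN; apply/fsubsetP => i iB.
  by rewrite seq_fsetE mem_iota /=; apply: leq_trans hN; rewrite ltnS; apply: leq_bigmax_seq.
have -> : (1 - t)^-1 = (1 - 0) * (1 - t)^-1 by rewrite subr0 mul1r.
apply: (@flim_ext _ _ _ (fun N => (1 - t ^+ N) * (1 - t)^-1)).
  near=> N; rewrite big_seq_fset ?iota_uniq // -[N in iota _ N]subn0 -/(index_iota 0 N).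
  rewrite big_mkord; apply: (mulIf nt); rewrite mulfVK //.
  by rewrite -[LHS]opprB (subrX1 t N); ring.
apply: flimM; last exact: flim_cst.
move=> e e0; have /cvgrPdist_le/(_ _ e0) := cvg_expr ct.
apply: filterS => N /=; rewrite sub0r normrN normrX ger0_norm ?cabs_ge0 //.
by rewrite subr0 addrAC subrr sub0r cabsN cabsX.
Unshelve. all: by end_near.
Qed.

(** Sums over the boxes [a i < N] factor, for the terms and for their moduli; this gives both the
    value and absolute summability. *)
Lemma has_sum_prod (I : finType) (u : I -> nat -> C) (s : I -> C) :
  (forall i, has_sum (u i) (s i)) ->
  has_sum (fun a : {ffun I -> nat} => \prod_i u i (a i)) (\prod_i s i).
Proof.
move=> hu.
pose conv N (a : {ffun I -> 'I_N}) : {ffun I -> nat} := [ffun i => val (a i)].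
have conv_inj N : injective (@conv N).
  move=> a b /ffunP h; apply/ffunP => i; apply: val_inj.
  by have := h i; rewrite !ffunE.
pose box N := seq_fset tt [seq conv N a | a <- enum {: {ffun I -> 'I_N}}].
have boxP N a : (a \in box N) = [forall i, (a i < N)%N].
  rewrite seq_fsetE; apply/mapP/forallP => [[b _ ->] i|h].
    by rewrite ffunE ltn_ord.
  exists [ffun i => Ordinal (h i)]; first by rewrite mem_enum inE.
  by apply/ffunP => i; rewrite !ffunE.
have sum_box (V : comNzRingType) N (w : I -> nat -> V) :
    \sum_(a <- box N) \prod_i w i (a i) = \prod_i \sum_(k < N) w i k.
  rewrite big_seq_fset; last by rewrite (map_inj_uniq (@conv_inj N)) enum_uniq.
  rewrite big_map.
  rewrite big_enum /= bigA_distr_bigA.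
  by apply: eq_bigr => a _; apply: eq_bigr => i _; rewrite ffunE.
have box_cover (B : {fset {ffun I -> nat}}) : exists N0, forall N, (N0 <= N)%N -> (B `<=` box N)%fset.
  exists (\max_(a <- B) \max_i a i).+1 => N hN; apply/fsubsetP => a aB.
  rewrite boxP; apply/forallP => i; apply: leq_trans hN; rewrite ltnS.
  by apply: leq_trans (leq_bigmax i) _; apply: (@leq_bigmax_seq _ _ _ (fun a : {ffun I -> nat} => \max_i a i)).
apply: (@has_sum_seq _ _ _ _ box) => //.
  have hM i := has_sum_asum (hu i).
  have /choice[M hM'] i : exists M, forall A : {fset nat}, \sum_(k <- A) cabs (u i k) <= M by exact: hM.
  exists (\prod_i M i) => B; have [N hN] := box_cover B.
  apply: le_trans (_ : \sum_(a <- box N) \prod_i cabs (u i (a i)) <= _).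
    rewrite (eq_bigr (fun a : {ffun I -> nat} => \prod_i cabs (u i (a i)))) => [|a _].
      by apply: ler_sum_fset (hN _ (leqnn N)) => a; rewrite prodr_ge0 // => i _; exact: cabs_ge0.
    by rewrite cabs_prod.
  rewrite (sum_box _ _ (fun i k => cabs (u i k))); apply: ler_prod => i _.
  apply/andP; split; first by apply: sumr_ge0 => k _; exact: cabs_ge0.
  apply: le_trans (hM' i (seq_fset tt (iota 0 N))); rewrite big_seq_fset ?iota_uniq //.
  by rewrite -[N in iota _ N]subn0 -/(index_iota 0 N) big_mkord.
under eq_fun do rewrite sum_box.
by apply: flim_prod => i; apply: has_sum_nat.
Qed.

Lemma has_sum_prod_geom (I : finType) (t : I -> C) : (forall i, cabs (t i) < 1) ->
  has_sum (fun a : {ffun I -> nat} => \prod_i t i ^+ a i) (\prod_i (1 - t i)^-1).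
Proof.
by move=> t1; apply: (has_sum_prod (u := fun i k => t i ^+ k)) => i; apply: has_sum_geom.
Qed.

End Rearrangement.

(** * Goursat's theorem for Lipschitz images of the unit square *)

Section Goursat.
Variable R : realType.
Notation C := R[i].

(** The increment [h = 0], where the non-strict estimate is trivial, is not excluded, so no
    punctured neighborhood enters. *)
Definition cderiv (g : C -> C) (t l : C) := forall e : R, 0 < e ->
  exists2 d : R, 0 < d &
    forall h, cabs h < d -> cabs (g (t + h) - g t - h * l) <= e * cabs h.

Definition riemann_sum (h : C -> C) (z : nat -> C) (n : nat) : C :=
  \sum_(i < n) h (z i) * (z i.+1 - z i).

Lemma riemann_sum_cat h z n k :
  riemann_sum h z (n + k) = riemann_sum h z n + riemann_sum h (fun i => z (n + i)%N) k.
Proof.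
rewrite /riemann_sum big_split_ord /=; congr (_ + _).
by apply: eq_bigr => i _; rewrite addnS.
Qed.

(* The main terms telescope: they only depend on the end points of the path. *)
Lemma riemann_sum_affine h z n (a l : C) (rho eta : R) :
  (forall i, (i < n)%N -> cabs (z i.+1 - z i) <= eta) ->
  (forall i, (i < n)%N -> cabs (h (z i) - (a + l * z i)) <= rho) ->
  cabs (riemann_sum h z n - a * (z n - z 0%N) - l / 2 * (z n ^+ 2 - z 0%N ^+ 2))
  <= n%:R * (rho * eta + cabs l * eta ^+ 2).
Proof.
elim: n => [|n IH] hz hh.
  by rewrite /riemann_sum big_ord0 !subrr !mulr0 !subr0 cabs0 mul0r.
have -> : riemann_sum h z n.+1 = riemann_sum h z n + h (z n) * (z n.+1 - z n).
  by rewrite /riemann_sum big_ord_recr.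
have {}IH := IH (fun i ni => hz i (ltnW ni)) (fun i ni => hh i (ltnW ni)).
have := hz n (ltnSn n); have := hh n (ltnSn n).
set d := z n.+1 - z n; set r := h (z n) - _ => hr hd.
rewrite -[n.+1%:R]natr1 mulrDl mul1r.
have -> : riemann_sum h z n + h (z n) * d - a * (z n.+1 - z 0%N) -
    l / 2 * (z n.+1 ^+ 2 - z 0%N ^+ 2) =
    (riemann_sum h z n - a * (z n - z 0%N) - l / 2 * (z n ^+ 2 - z 0%N ^+ 2))
    + (r * d - l / 2 * d ^+ 2) by rewrite /r /d; field.
apply: le_trans (cabsD _ _) _; rewrite lerD //.
apply: le_trans (cabsB _ _) _; rewrite !cabsM -expr2; apply: lerD.
  by apply: ler_pM; rewrite ?cabs_ge0.
rewrite cabsV (cabs_natr _ 2) -mulrA ler_wpM2l ?cabs_ge0 //.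
apply: le_trans (_ : 2^-1 * eta ^+ 2 <= _).
  by rewrite ler_wpM2l ?invr_ge0 // lerXn2r ?nnegrE ?cabs_ge0 // (le_trans _ hd) ?cabs_ge0.
by rewrite ler_piMl ?sqr_ge0 // invf_le1 ?ler1n.
Qed.

(** The supremum of the left end points lies in all the nested dyadic intervals; this is the limit
    point of a bisection. *)
Lemma dyadic_limit (a : nat -> nat) :
  (forall k, a k.+1 = (2 * a k)%N \/ a k.+1 = (2 * a k).+1) ->
  exists x : R, forall k, (a k)%:R / 2 ^+ k <= x <= (a k).+1%:R / 2 ^+ k.
Proof.
move=> ha.
have p2 k : 0 < 2 ^+ k :> R by rewrite exprn_gt0.
have lo k d : (a k)%:R / 2 ^+ k <= (a (k + d)%N)%:R / 2 ^+ (k + d) :> R.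
  elim: d => [|d IH]; rewrite ?addn0 //; apply: le_trans IH _; rewrite addnS exprS.
  rewrite invfM mulrA ler_pM2r ?invr_gt0 // ler_pdivlMr // -natrM ler_nat.
  by case: (ha (k + d)%N) => ->; lia.
have hi k d : (a (k + d)%N).+1%:R / 2 ^+ (k + d) <= (a k).+1%:R / 2 ^+ k :> R.
  elim: d => [|d IH]; rewrite ?addn0 //; apply: le_trans IH; rewrite addnS exprS.
  rewrite invfM mulrA ler_pM2r ?invr_gt0 // ler_pdivrMr // -natrM ler_nat.
  by case: (ha (k + d)%N) => ->; lia.
have lohi j k : (a j)%:R / 2 ^+ j <= (a k).+1%:R / 2 ^+ k :> R.
  apply: le_trans (lo j k) _; rewrite addnC; apply: le_trans _ (hi k j).
  by rewrite ler_pM2r ?invr_gt0 // ler_nat leqW.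
pose S := [set y : R | exists k, y = (a k)%:R / 2 ^+ k].
have hS : has_sup S.
  split; first by exists ((a 0%N)%:R / 2 ^+ 0), 0%N.
  by exists ((a 0%N).+1%:R / 2 ^+ 0) => _ [k ->].
exists (sup S) => k; apply/andP; split.
  by apply: ub_le_sup; [exact: hS.2|exists k].
by apply: ge_sup; [exact: hS.1|move=> _ [j ->]].
Qed.

Lemma dist_interval (p q r w : R) : r <= q <= r + w -> r <= p -> p <= r + w ->
  `|p - q| <= w.
Proof. by move=> /andP[? ?] ? ?; rewrite ler_norml; apply/andP; split; lra. Qed.

Variables (h : C -> C) (H : R -> R -> C) (L : R).
Hypothesis L_gt0 : 0 < L.
Hypothesis H_lip : forall x y x' y' : R, 0 <= x <= 1 -> 0 <= y <= 1 ->
  0 <= x' <= 1 -> 0 <= y' <= 1 ->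
  cabs (H x y - H x' y') <= L * (`|x - x'| + `|y - y'|).
Hypothesis h_der : forall x y : R, 0 <= x <= 1 -> 0 <= y <= 1 ->
  exists l, cderiv h (H x y) l.

(** Sums run over the image under [H] of the grid of mesh [2 ^- N]. Since [H] is only Lipschitz, it
    may glue sides of the square, for instance into an annulus. *)
Definition gridpt N i j : C := H (i%:R / 2 ^+ N) (j%:R / 2 ^+ N).
Definition hside N i j s := riemann_sum h (fun t => gridpt N (i + t) j) s.
Definition vside N i j s := riemann_sum h (fun t => gridpt N i (j + t)) s.

Definition square_sum N i j s :=
  hside N i j s + vside N (i + s) j s - hside N i (j + s) s - vside N i j s.

Lemma square_sum_split N i j s :
  square_sum N i j (s + s) =
  square_sum N i j s + square_sum N (i + s) j s +
  square_sum N i (j + s) s + square_sum N (i + s) (j + s) s.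
Proof.
have hs i' j' : hside N i' j' (s + s) = hside N i' j' s + hside N (i' + s) j' s.
  rewrite /hside riemann_sum_cat; congr (_ + riemann_sum _ _ _).
  by apply/funext => t; rewrite addnA.
have vs i' j' : vside N i' j' (s + s) = vside N i' j' s + vside N i' (j' + s) s.
  rewrite /vside riemann_sum_cat; congr (_ + riemann_sum _ _ _).
  by apply/funext => t; rewrite addnA.
rewrite /square_sum !hs !vs !addnA; ring.
Qed.

(** A square of level [k] has side [2 ^- k]; its boundary sum is allowed a share of [e] proportional
    to its area. A square that fails thus has a quarter that fails. *)
Definition small_square (e : R) k a b := exists N0, forall N, (N0 <= N)%N ->
  cabs (square_sum N (a * 2 ^ (N - k)) (b * 2 ^ (N - k)) (2 ^ (N - k)))
  <= e / 4 ^+ k.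

Lemma small_square_split e k a b :
  small_square e k.+1 (2 * a) (2 * b) -> small_square e k.+1 (2 * a).+1 (2 * b) ->
  small_square e k.+1 (2 * a) (2 * b).+1 ->
  small_square e k.+1 (2 * a).+1 (2 * b).+1 -> small_square e k a b.
Proof.
move=> [N1 h1] [N2 h2] [N3 h3] [N4 h4].
exists (k.+1 + N1 + N2 + N3 + N4)%N => N hN.
have [l1 l2 l3 l4 lk] : [/\ N1 <= N, N2 <= N, N3 <= N, N4 <= N & k < N]%N by split; lia.
move: (h1 N l1) (h2 N l2) (h3 N l3) (h4 N l4) => {}h1 {}h2 {}h3 {}h4.
have es : (2 ^ (N - k) = 2 ^ (N - k.+1) + 2 ^ (N - k.+1))%N.
  by rewrite addnn -mul2n -expnS; congr (2 ^ _)%N; lia.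
have ea c s : (c * (s + s) = 2 * c * s)%N by rewrite addnn -mul2n mulnCA mulnA.
rewrite es !ea square_sum_split.
have eb c s : (2 * c * s + s = (2 * c).+1 * s)%N by rewrite mulSn addnC.
rewrite !eb.
apply: le_trans (cabsD _ _) _; apply: le_trans (lerD (cabsD _ _) (lexx _)) _.
apply: le_trans (lerD (lerD (cabsD _ _) (lexx _)) (lexx _)) _.
move: h1 h2 h3 h4; rewrite exprS invfM; set q := (4 ^+ k)^-1; lra.
Qed.

(** Near [H x y] the integrand is affine up to a small multiple of the distance. By
    [riemann_sum_affine] the affine parts cancel around the boundary and only the errors of the four
    sides remain. *)
Lemma small_square_point (e x y : R) : 0 < e -> 0 <= x <= 1 -> 0 <= y <= 1 ->
  exists k0, forall k a b, (k0 <= k)%N -> (a < 2 ^ k)%N -> (b < 2 ^ k)%N ->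
    a%:R / 2 ^+ k <= x <= a.+1%:R / 2 ^+ k ->
    b%:R / 2 ^+ k <= y <= b.+1%:R / 2 ^+ k -> small_square e k a b.
Proof.
move=> e0 hx hy; have [l hl] := h_der hx hy.
(* With side [2 ^- k] and Lipschitz constant [L], this tolerance costs [e / 8 / 4 ^+ k] on each of
   the four sides: half of the allowance. *)
have e1 : 0 < e / (16 * L ^+ 2) by rewrite divr_gt0 // mulr_gt0 // exprn_gt0.
have [d d0 hd] := hl _ e1.
have p2 k : 0 < 2 ^+ k :> R by rewrite exprn_gt0.
have arch (r : R) : 0 < r -> exists k0, forall k, (k0 <= k)%N -> 2 ^- k <= r :> R.
  move=> r0; exists (Num.bound r^-1) => k hk.
  rewrite -[leRHS]invrK lef_pV2 ?posrE ?invr_gt0 //.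
  apply: le_trans (ltW (archi_boundP _)) _; first by rewrite invr_ge0 ltW.
  apply: le_trans (_ : k%:R <= _); first by rewrite ler_nat.
  by rewrite -natrX ler_nat ltnW // ltn_expl.
have dL : 0 < d / (4 * L) by rewrite divr_gt0 // mulr_gt0.
have [k0 hk0] := arch _ dL.
exists k0 => k a b kk ak bk ax bY.
have dk := hk0 _ kk.
(* The other half pays for the terms in [cabs l], whose total is of order [2 ^- N]. *)
have n0 : 0 < e / 4 ^+ k / (8 * (cabs l + 1) * L ^+ 2 / 2 ^+ k).
  by rewrite !(divr_gt0, mulr_gt0) ?exprn_gt0 // ltr_wpDl ?cabs_ge0.
have [N1 hN1] := arch _ n0.
exists (k + N1)%N => N hN; have kN : (k <= N)%N := leq_trans (leq_addr _ _) hN.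
have {hN1}nN := hN1 N (leq_trans (leq_addl _ _) hN).
set s := (2 ^ (N - k))%N.
have sE : s%:R / 2 ^+ N = 2 ^- k :> R.
  apply: (mulfI (lt0r_neq0 (p2 N))); rewrite mulrC divfK ?lt0r_neq0 //.
  by rewrite /s natrX -{2}(subnK kN) exprD mulrK // unitfE lt0r_neq0.
have inI c t : (c < 2 ^ k)%N -> (t <= s)%N ->
    [/\ 0 <= ((c * s + t)%:R : R) / 2 ^+ N <= 1,
        c%:R / 2 ^+ k <= (c * s + t)%:R / 2 ^+ N :> R
      & (c * s + t)%:R / 2 ^+ N <= c.+1%:R / 2 ^+ k :> R].
  move=> ck ts; have up : (c * s + t)%:R / 2 ^+ N <= c.+1%:R / 2 ^+ k :> R.
    rewrite -sE mulrA ler_pM2r ?invr_gt0 // -natrM ler_nat mulSn addnC.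
    by rewrite leq_add2r.
  split=> //; last by rewrite -sE mulrA ler_pM2r ?invr_gt0 // -natrM ler_nat leq_addr.
  rewrite divr_ge0 ?(ltW (p2 _)) //=; apply: le_trans up _.
  by rewrite ler_pdivrMr // mul1r -natrX ler_nat.
have near0 i j : (i <= s)%N -> (j <= s)%N ->
    cabs (gridpt N (a * s + i) (b * s + j) - H x y) <= 2 * L / 2 ^+ k.
  move=> is_ js; have [i1 i2 i3] := inI a i ak is_; have [j1 j2 j3] := inI b j bk js.
  apply: le_trans (H_lip i1 j1 hx hy) _.
  have -> : 2 * L / 2 ^+ k = L * (2 ^- k + 2 ^- k) by ring.
  rewrite ler_pM2l //.
  have w c : c.+1%:R / 2 ^+ k = c%:R / 2 ^+ k + 2 ^- k :> R by rewrite -addn1 natrD mulrDl mul1r.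
  by move: ax bY i2 i3 j2 j3; rewrite !w => h1 h2 h3 h4 h5 h6; apply: lerD;
    [exact: dist_interval h1 h3 h4|exact: dist_interval h2 h5 h6].
have near1 i j : (i <= s)%N -> (j <= s)%N ->
    cabs (h (gridpt N (a * s + i) (b * s + j)) -
      (h (H x y) - H x y * l + l * gridpt N (a * s + i) (b * s + j)))
    <= e / (16 * L ^+ 2) * (2 * L / 2 ^+ k).
  move=> is_ js; set z := gridpt N _ _; have := near0 i j is_ js; rewrite -/z => hz.
  have /hd : cabs (z - H x y) < d.
    apply: le_lt_trans hz _; apply: le_lt_trans (_ : 2 * L * (d / (4 * L)) < d).
      by apply: ler_wpM2l => //; rewrite mulr_ge0 // ltW.
    have -> : 2 * L * (d / (4 * L)) = d / 2 by field; rewrite gt_eqF.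
    by rewrite gtr_pMr // invf_lt1 ?ltr1n.
  rewrite [H x y + _]addrC subrK => hz1.
  have -> : h z - (h (H x y) - H x y * l + l * z) = h z - h (H x y) - (z - H x y) * l by ring.
  by apply: le_trans hz1 _; rewrite ler_wpM2l // ltW.
have hstep i j : (i < s)%N -> (j <= s)%N ->
    cabs (gridpt N (a * s + i.+1) (b * s + j) - gridpt N (a * s + i) (b * s + j)) <= L / 2 ^+ N.
  move=> is_ js; have [i1 _ _] := inI a i ak (ltnW is_); have [i2 _ _] := inI a i.+1 ak is_.
  have [j1 _ _] := inI b j bk js; apply: le_trans (H_lip i2 j1 i1 j1) _.
  rewrite subrr normr0 addr0 ler_pM2l // -mulrBl addnS -natrB // subSnn mul1r.
  by rewrite ger0_norm // invr_ge0 ltW.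
have vstep i j : (i <= s)%N -> (j < s)%N ->
    cabs (gridpt N (a * s + i) (b * s + j.+1) - gridpt N (a * s + i) (b * s + j)) <= L / 2 ^+ N.
  move=> is_ js; have [i1 _ _] := inI b j bk (ltnW js); have [i2 _ _] := inI b j.+1 bk js.
  have [j1 _ _] := inI a i ak is_; apply: le_trans (H_lip j1 i2 j1 i1) _.
  rewrite subrr normr0 add0r ler_pM2l // -mulrBl addnS -natrB // subSnn mul1r.
  by rewrite ger0_norm // invr_ge0 ltW.
set A0 := h (H x y) - H x y * l in near1.
have hh j : (j <= s)%N -> _ := fun js => @riemann_sum_affine h
  (fun t => gridpt N (a * s + t) (b * s + j)) s A0 l _ _
  (fun i is_ => hstep i j is_ js) (fun i is_ => near1 i j (ltnW is_) js).
have vv i : (i <= s)%N -> _ := fun is_ => @riemann_sum_affine h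
  (fun t => gridpt N (a * s + i) (b * s + t)) s A0 l _ _
  (fun j js => vstep i j is_ js) (fun j js => near1 i j is_ (ltnW js)).
move: (hh 0%N (leq0n _)) (hh s (leqnn _)) (vv 0%N (leq0n _)) (vv s (leqnn _)).
set B := s%:R * (_ + _); rewrite -![riemann_sum _ _ _]/(hside _ _ _ _) -![riemann_sum _ _ _]/(vside _ _ _ _).
rewrite !addn0 => q1 q2 q3 q4.
have BE : 4 * B <= e / 4 ^+ k.
  move: nN; rewrite expr2 => nN; rewrite /B.
  have -> : s%:R = 2 ^+ N * 2 ^- k :> R by rewrite -sE mulrCA mulfV ?mulr1 // lt0r_neq0.
  have e4 : 4 ^+ k = 2 ^+ k * 2 ^+ k :> R by rewrite -exprMn; congr (_ ^+ _); ring.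
  have := p2 k; have := p2 N; move: nN; rewrite e4; set u := 2 ^+ N; set v := 2 ^+ k.
  move=> nN u0 v0.
  have l1 : 0 < cabs l + 1 by rewrite ltr_wpDl ?cabs_ge0.
  have nN' : u^-1 * (8 * (cabs l + 1) * (L * L) / v) <= e / (v * v).
    rewrite -ler_pdivlMr //.
    by rewrite !(divr_gt0, mulr_gt0).
  have -> : 4 * (u / v * (e / (16 * L ^+ 2) * (2 * L / v) * (L / u) + cabs l * (L / u) ^+ 2))
     = e / (v * v) / 2 + 4 * cabs l * (L * L) * u^-1 / v by field; rewrite !gt_eqF.
  have : 4 * cabs l * (L * L) * u^-1 / v <= u^-1 * (8 * (cabs l + 1) * (L * L) / v) / 2.
    rewrite -subr_ge0 [X in 0 <= X](_ : _ = 4 * (L * L) * u^-1 / v); last by field; rewrite !gt_eqF.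
    by rewrite !(divr_ge0, mulr_ge0, invr_ge0) // ltW.
  lra.
apply: le_trans BE.
rewrite /square_sum.
set z00 := gridpt N (a * s) (b * s) in q1 q3 *.
set z10 := gridpt N (a * s + s) (b * s) in q1 q4 *.
set z01 := gridpt N (a * s) (b * s + s) in q2 q3 *.
set z11 := gridpt N (a * s + s) (b * s + s) in q2 q4 *.
rewrite [X in cabs X](_ : _ =
  (hside N (a * s) (b * s) s - A0 * (z10 - z00) - l / 2 * (z10 ^+ 2 - z00 ^+ 2)) +
  (vside N (a * s + s) (b * s) s - A0 * (z11 - z10) - l / 2 * (z11 ^+ 2 - z10 ^+ 2)) -
  (hside N (a * s) (b * s + s) s - A0 * (z11 - z01) - l / 2 * (z11 ^+ 2 - z01 ^+ 2)) -
  (vside N (a * s) (b * s) s - A0 * (z01 - z00) - l / 2 * (z01 ^+ 2 - z00 ^+ 2))); last by field.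
apply: le_trans (cabsB _ _) _; apply: le_trans (lerD (cabsB _ _) (lexx _)) _.
apply: le_trans (lerD (lerD (cabsD _ _) (lexx _)) (lexx _)) _; lra.
Qed.

(** If the whole square were bad, repeated quartering would give nested bad squares, against
    [small_square_point] at their common point. *)
Lemma goursat (e : R) : 0 < e -> exists N0, forall N, (N0 <= N)%N ->
  cabs (square_sum N 0 0 (2 ^ N)) <= e.
Proof.
move=> e0; suff [N0 hN] : small_square e 0 0 0.
  by exists N0 => N /hN; rewrite !subn0 !mul0n expr0 divr1.
apply: contrapT => bad.
pose bsq k (p : nat * nat) := ~ small_square e k p.1 p.2 /\ (p.1 < 2 ^ k)%N /\ (p.2 < 2 ^ k)%N.
have step k p : bsq k p -> exists q, bsq k.+1 q /\
   ((q.1 = 2 * p.1 \/ q.1 = (2 * p.1).+1) /\ (q.2 = 2 * p.2 \/ q.2 = (2 * p.2).+1))%N.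
  case: p => a b [/= nb [ak bk]].
  have ok c : (c < 2 ^ k)%N -> (2 * c < 2 ^ k.+1)%N /\ ((2 * c).+1 < 2 ^ k.+1)%N.
    by rewrite expnS => ck; split; lia.
  have [a1 a2] := ok a ak; have [b1 b2] := ok b bk.
  apply: contrapT => /forallNP nq; apply: nb; apply: small_square_split; apply: contrapT => bb.
  - by apply: (nq (2 * a, 2 * b)%N); do !split => //; left.
  - by apply: (nq ((2 * a).+1, 2 * b)%N); do !split => //; [right|left].
  - by apply: (nq (2 * a, (2 * b).+1)%N); do !split => //; [left|right].
  - by apply: (nq ((2 * a).+1, (2 * b).+1)%N); do !split => //; right.
(* [F] picks a bad quarter of a bad square; on other squares it has a default value, which the
   sequence [sq] never meets. *)
have /choice[F hF] (kp : nat * (nat * nat)) : exists q, bsq kp.1 kp.2 -> bsq kp.1.+1 q /\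
   ((q.1 = 2 * kp.2.1 \/ q.1 = (2 * kp.2.1).+1) /\ (q.2 = 2 * kp.2.2 \/ q.2 = (2 * kp.2.2).+1))%N.
  have [/step[q hq]|n] := pselect (bsq kp.1 kp.2); first by exists q.
  by exists (0%N, 0%N).
pose sq := fix sq k := if k is k'.+1 then F (k', sq k') else (0%N, 0%N).
have sqb k : bsq k (sq k).
  by elim: k => [|k IH]; [split|have [] := hF (k, sq k) IH].
have sqS k := (hF (k, sq k) (sqb k)).2.
have [x hx] := dyadic_limit (fun k => (sqS k).1).
have [y hy] := dyadic_limit (fun k => (sqS k).2).
have x01 : 0 <= x <= 1 by have := hx 0%N; rewrite /= expr0 mul0r divr1.
have y01 : 0 <= y <= 1 by have := hy 0%N; rewrite /= expr0 mul0r divr1.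
have [k hk] := small_square_point e0 x01 y01.
have [nb [ak bk]] := sqb k; apply: nb.
exact: (hk k _ _ (leqnn k) ak bk (hx k) (hy k)).
Qed.

End Goursat.

(** * Calculus of complex derivatives *)

Section ComplexDerivative.
Variable R : realType.
Notation C := R[i].
Implicit Types (f g : C -> C) (l k : C).

(** The neighborhoods contain 0, so that a factor [phi] may be evaluated at an inner increment that
    vanishes, as happens in the chain rule. *)
Definition small : set_system C :=
  filter_from [set d : R | 0 < d] (fun d => [set h | cabs h < d]).

#[global] Instance small_filter : ProperFilter small.
Proof.
eapply filter_from_proper; last by move=> d /= d0; exists 0; rewrite /= cabs0.
apply: filter_from_filter; first by exists 1 => /=.
move=> d d' /= d0 d0'; exists (Num.min d d'); first by rewrite /= lt_min d0.
by move=> h /=; rewrite lt_min => /andP[].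
Qed.

Lemma small_lt (d : R) : 0 < d -> \forall h \near small, cabs h < d.
Proof. by exists d. Qed.

Lemma flim_id0 : flim small id 0.
Proof. by move=> e e0; exists e => // h /= /ltW; rewrite subr0. Qed.

Lemma flimN T (F : set_system T) {FF : Filter F} (u : T -> C) l :
  flim F u l -> flim F (fun t => - u t) (- l).
Proof. by move=> h e /h; apply: filterS => t /=; rewrite -opprD cabsN. Qed.

Lemma flimV T (F : set_system T) {FF : Filter F} (u : T -> C) l : l != 0 ->
  flim F u l -> flim F (fun t => (u t)^-1) l^-1.
Proof.
move=> l0 h e e0; have cl : 0 < cabs l by rewrite cabs_gt0.
have c2 : 0 < cabs l / 2 by rewrite divr_gt0.
have e2 : 0 < e * (cabs l * (cabs l / 2)) by rewrite !mulr_gt0.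
apply: filterS2 (h _ c2) (h _ e2) => t /= a b.
have ut : cabs l / 2 <= cabs (u t).
  have := cabs_triang (u t) l 0; rewrite !subr0 (cabs_distC l); lra.
have u0 : u t != 0 by rewrite -cabs_gt0; apply: lt_le_trans ut.
have -> : (u t)^-1 - l^-1 = (l - u t) / (l * u t) by field; rewrite ?l0 ?u0.
rewrite cabsM cabsV cabs_distC ler_pdivrMr ?cabs_gt0 ?mulf_neq0 // cabsM.
by apply: le_trans b _; rewrite ler_pM2l // ler_pM2l.
Qed.

Lemma flim_neq0 T (F : set_system T) {FF : Filter F} (u : T -> C) l : l != 0 ->
  flim F u l -> \forall t \near F, u t != 0.
Proof.
move=> l0 h; have c2 : 0 < cabs l / 2 by rewrite divr_gt0 ?cabs_gt0.
apply: filterS (h _ c2) => t /= a; apply/eqP => u0; move: a.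
by rewrite u0 sub0r cabsN; have := cabs_gt0 l; rewrite l0 => ? ?; lra.
Qed.

Lemma flim_comp0 (u v : C -> C) l : flim small u l -> flim small v 0 ->
  flim small (u \o v) l.
Proof.
move=> hu hv e /hu [d d0 hd]; have d2 : 0 < d / 2 by rewrite divr_gt0.
have [r r0 hr] := hv _ d2; exists r => // h /hr /=; rewrite subr0 => vh.
by apply: hd; apply: le_lt_trans vh _; rewrite gtr_pMr // invf_lt1 // ltr1n.
Qed.

(** Caratheodory's form of differentiability: the rules of calculus become rules for limits of
    [phi], with no division by the increment. *)
Lemma cderivP f t l : cderiv f t l <-> exists phi,
  (\forall h \near small, f (t + h) = f t + h * phi h) /\ flim small phi l.
Proof.
split=> [hf|[phi [hphi phil]] e e0].
  exists (fun h => if h == 0 then l else (f (t + h) - f t) / h); split.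
    apply: filterE => h; case: eqVneq => [->|h0]; first by rewrite mul0r !addr0.
    by rewrite mulrC divfK // [RHS]addrC subrK.
  move=> e e0; have [d d0 hd] := hf _ e0; exists d => // h /hd /=.
  case: eqVneq => [_ _|h0 h1]; first by rewrite subrr cabs0 ltW.
  have -> : (f (t + h) - f t) / h - l = (f (t + h) - f t - h * l) / h by field.
  by rewrite cabsM cabsV ler_pdivrMr ?cabs_gt0.
have [d d0 hd] := filterI hphi (phil _ e0); exists d => // h /hd [-> /= h1].
rewrite [f t + _]addrC addrK -mulrBr cabsM mulrC.
by rewrite ler_wpM2r // cabs_ge0.
Qed.

Lemma cderiv_unique f t l l' : cderiv f t l -> cderiv f t l' -> l = l'.
Proof.
move=> hl hl'; apply/eqP; rewrite -subr_eq0; apply/eqP/cabs_le0P => e e0.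
have e2 : 0 < e / 2 by rewrite divr_gt0.
have [d d0 hd] := hl _ e2; have [d' d0' hd'] := hl' _ e2.
pose r := Num.min d d' / 2.
have m0 : 0 < Num.min d d' by rewrite lt_min d0.
have r0 : 0 < r by rewrite divr_gt0.
have rr : cabs (r%:C : C) = r by rewrite cabsR gtr0_norm.
have rd : r < Num.min d d' by rewrite /r gtr_pMr // invf_lt1 // ltr1n.
move: rd; rewrite lt_min => /andP[rd rd'].
have := hd r%:C; have := hd' r%:C; rewrite rr => /(_ rd') h1 /(_ rd) h2.
rewrite -(ler_pM2l r0) -{1}rr -cabsM.
have -> : r%:C * (l - l') = (f (t + r%:C) - f t - r%:C * l') - (f (t + r%:C) - f t - r%:C * l) by ring.
apply: le_trans (cabsB _ _) _; lra.
Qed.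

Lemma cderiv_cont f t l : cderiv f t l -> flim small (fun h => f (t + h)) (f t).
Proof.
move=> /cderivP[phi [h1 h2]].
have h3 : flim small (fun h => f t + h * phi h) (f t + 0 * l).
  by apply: flimD; [exact: flim_cst|apply: flimM => //; exact: flim_id0].
by move: h3; rewrite mul0r addr0; apply: flim_ext; apply: filterS h1 => h ->.
Qed.

Lemma cderiv_ext f g t l : (\forall h \near small, f (t + h) = g (t + h)) ->
  cderiv f t l -> cderiv g t l.
Proof.
move=> fg /cderivP[phi [h1 h2]]; apply/cderivP; exists phi; split=> //.
have fgt : f t = g t.
  by case: fg => d d0 /(_ 0); rewrite /= cabs0 addr0 => ->.
by apply: filterS2 fg h1 => h <- ->; rewrite fgt.
Qed.

Lemma cderiv_cst (c t : C) : cderiv (fun=> c) t (0 : C).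
Proof.
apply/cderivP; exists (fun=> 0); split; last exact: flim_cst.
by apply: filterE => h; rewrite mulr0 addr0.
Qed.

Lemma cderiv_id (t : C) : cderiv id t (1 : C).
Proof.
apply/cderivP; exists (fun=> 1); split; last exact: flim_cst.
by apply: filterE => h; rewrite mulr1.
Qed.

Lemma cderivD f g t l k : cderiv f t l -> cderiv g t k ->
  cderiv (fun x => f x + g x) t (l + k).
Proof.
move=> /cderivP[u [u1 u2]] /cderivP[v [v1 v2]]; apply/cderivP.
exists (fun h => u h + v h); split; last exact: flimD.
by apply: filterS2 u1 v1 => h -> ->; ring.
Qed.

Lemma cderivM f g t l k : cderiv f t l -> cderiv g t k ->
  cderiv (fun x => f x * g x) t (l * g t + f t * k).
Proof.
move=> hf hg; have cg := cderiv_cont hg.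
move: hf hg => /cderivP[u [u1 u2]] /cderivP[v [v1 v2]]; apply/cderivP.
exists (fun h => u h * g (t + h) + f t * v h); split.
  by apply: filterS2 u1 v1 => h -> ->; ring.
by apply: flimD; apply: flimM => //; exact: flim_cst.
Qed.

Lemma cderivZ c f t l : cderiv f t l -> cderiv (fun x => c * f x) t (c * l).
Proof.
by move=> hf; have := cderivM (cderiv_cst c t) hf; rewrite mul0r add0r.
Qed.

Lemma cderivB f g t l k : cderiv f t l -> cderiv g t k ->
  cderiv (fun x => f x - g x) t (l - k).
Proof.
move=> hf hg; have := cderivD hf (cderivZ (-1) hg); rewrite mulN1r.
by apply: cderiv_ext; apply: filterE => h; rewrite mulN1r.
Qed.

Lemma cderivV f t l : f t != 0 -> cderiv f t l ->
  cderiv (fun x => (f x)^-1) t (- l / f t ^+ 2).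
Proof.
move=> f0 hf; have cf := cderiv_cont hf;
have fh : \forall h \near small, f (t + h) != 0 by exact: flim_neq0 f0 cf.
move: hf => /cderivP[u [u1 u2]]; apply/cderivP.
exists (fun h => - u h * (f (t + h) * f t)^-1); split.
  apply: filterS2 u1 fh => h e; rewrite e => n0; by field; rewrite ?f0 ?n0 ?andbT.
rewrite expr2; apply: flimM; first exact: flimN.
by apply: flimV; rewrite ?mulf_neq0 //; apply: flimM => //; exact: flim_cst.
Qed.

Lemma cderiv_comp f g t l k : cderiv g t k -> cderiv f (g t) l ->
  cderiv (f \o g) t (l * k).
Proof.
move=> /cderivP[v [v1 v2]] /cderivP[u [u1 u2]]; apply/cderivP.
have w0 : flim small (fun h => h * v h) 0.
  by rewrite -(mul0r k); apply: flimM => //; exact: flim_id0.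
exists (fun h => u (h * v h) * v h); split; last first.
  by apply: flimM => //; exact: (flim_comp0 u2 w0).
case: u1 => d d0 hd; have d2 : 0 < d / 2 by rewrite divr_gt0.
apply: filterS2 v1 (w0 _ d2) => h /= -> ; rewrite subr0 => hv.
rewrite hd /=; first by ring.
by apply: le_lt_trans hv _; rewrite gtr_pMr // invf_lt1 // ltr1n.
Qed.

Lemma cderiv_sum (I : Type) (r : seq I) (f : I -> C -> C) t (l : I -> C) :
  (forall i, cderiv (f i) t (l i)) ->
  cderiv (fun x => \sum_(i <- r) f i x) t (\sum_(i <- r) l i).
Proof.
move=> h; elim: r => [|i r IH].
  by rewrite big_nil; under eq_fun do rewrite big_nil; exact: cderiv_cst.
by rewrite big_cons; under eq_fun do rewrite big_cons; apply: (cderivD (h i) IH).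
Qed.

Lemma cderiv_shift f t l c : cderiv f (t + c) l <-> cderiv (fun x => f (x + c)) t l.
Proof.
by split=> h e e0; have [d d0 hd] := h e e0; exists d => // x /hd; rewrite [t + _ + _]addrAC.
Qed.

Section Directional.
Variable V : normedModType C.

(** With [derivable_cderiv], this translates between scalar derivatives along a line and the ['D_v]
    that occurs in [dW] and [dz]. *)
Lemma cderiv_is_derive (f : V -> C) (p v : V) l :
  cderiv (fun h => f (p + h *: v)) 0 l -> is_derive p v f l.
Proof.
move=> hf; have hc : h^-1 *: ((f \o shift p) (h *: v) - f p) @[h --> 0^'] --> l.
  apply/cvgrPdist_le => e e0.
  have ee : e = (complex.Re e)%:C by rewrite RRe_real ?gtr0_real.
  have e0' : 0 < complex.Re e by rewrite -ltcR -ee.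
  have [d d0 hd] := hf _ e0'; have d0' : (0 : C) < d%:C by rewrite ltcR.
  near=> h; have h0 : h != 0 by near: h; exact: nbhs_dnbhs_neq.
  have : cabs h < d by rewrite -cabs_lt; near: h; exact: dnbhs0_lt.
  move=> /hd; rewrite add0r scale0r addr0 ee normE lecR /= => h1.
  have -> : l - h^-1 *: (f (h *: v + p) - f p) = - (f (p + h *: v) - f p - h * l) / h.
    by rewrite [h *: v + p]addrC -[h^-1 *: _]/(h^-1 * _); field.
  by rewrite cabsM cabsN cabsV ler_pdivrMr ?cabs_gt0.
by apply: DeriveDef; [apply: cvgP hc|apply: cvg_lim hc].
Unshelve. all: by end_near.
Qed.

Lemma derivable_cderiv (f : V -> C) (p v : V) : derivable f p v ->
  cderiv (fun h => f (p + h *: v)) 0 ('D_v f p).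
Proof.
move=> /cvg_ex[l hl] e e0; have := hl; move/cvg_lim => dE.
rewrite /derive dE //; move: hl => /cvgrPdist_le.
have e0' : (0 : C) < e%:C by rewrite ltcR.
move=> /(_ _ e0') [d /= d0 hd].
have dd : d = (complex.Re d)%:C by rewrite RRe_real ?gtr0_real.
exists (complex.Re d) => [|h hd0]; first by rewrite -ltcR -dd.
rewrite add0r scale0r addr0.
have [->|h0] := eqVneq h 0; first by rewrite scale0r addr0 subrr mul0r subr0 cabs0 mulr0.
have := hd h; rewrite /= sub0r normrN dd cabs_lt => /(_ hd0 h0).
rewrite normE lecR => h1; rewrite [leRHS]mulrC.
have -> : f (p + h *: v) - f p - h * l = - (h * (l - h^-1 *: (f (h *: v + p) - f p))).
  by rewrite [h *: v + p]addrC -[h^-1 *: _]/(h^-1 * _); field.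
by rewrite cabsN cabsM ler_wpM2l ?cabs_ge0.
Qed.

End Directional.
End ComplexDerivative.
Arguments small {R}.

(** * The exponential and the roots of unity of order a power of two *)

Section Exponential.
Variable R : realType.
Notation C := R[i].

Lemma expCD (z w : C) : expC (z + w) = expC z * expC w.
Proof.
case: z w => [a b] [c d]; rewrite /expC /= expRD cosD sinD rmorphM /=.
by apply/eqP; rewrite eq_complex /=; apply/andP; split; apply/eqP; ring.
Qed.

Lemma expC0 : expC 0 = 1 :> C.
Proof. by rewrite /expC /= expR0 cos0 sin0 mul1r. Qed.

Lemma real_derive_le (f : R -> R) (l : R) : is_derive (0 : R) 1 f l ->
  forall e : R, 0 < e ->
  exists2 d, 0 < d & forall h, `|h| < d -> `|f h - f 0 - h * l| <= e * `|h|.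
Proof.
move=> [df dl] e e0; move: df => /cvg_ex[k hk].
have kl : k = l by rewrite -dl; apply/esym/cvg_lim.
move: hk => /cvgrPdist_le/(_ _ e0)[d /= d0 hd]; exists d => // h hd0.
have [->|h0] := eqVneq h 0; first by rewrite subrr mul0r subr0 normr0 mulr0.
have := hd h; rewrite /= sub0r normrN => /(_ hd0 h0); rewrite kl addr0.
rewrite -[h^-1 *: _]/(h^-1 * _) [h *: _]mulr1 => h1.
have -> : f h - f 0 - h * l = - ((l - h^-1 * (f h - f 0)) * h) by field.
by rewrite normrN normrM ler_wpM2r.
Qed.

Lemma cderiv_expC0 : cderiv (@expC R) 0 1.
Proof.
(* The bounds [t1] to [t5] below add up to at most seven times [e / 7 * cabs (a +i* b)]. *)
move=> e e0; have e7 : 0 < e / 7 by rewrite divr_gt0.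
have [d1 d10 h1] := real_derive_le (is_derive_expR 0) e7.
have [d2 d20 h2] := real_derive_le (is_derive_cos 0) e7.
have [d3 d30 h3] := real_derive_le (is_derive_sin 0) e7.
exists (Num.min (Num.min d1 d2) (Num.min d3 (Num.min 1 (e / 7)))).
  by rewrite !lt_min d10 d20 d30 e7 ltr01.
case=> a b; rewrite !lt_min => /andP[/andP[hd1 hd2] /and3P[hd3 hd4 hd5]].
have aH := @cabs_Re R (a +i* b); have bH := @cabs_Im R (a +i* b).
rewrite add0r expC0 mulr1 /= in aH bH *.
have {h1} := h1 a (le_lt_trans aH hd1); have {h2} := h2 b (le_lt_trans bH hd2).
have {h3} := h3 b (le_lt_trans bH hd3).
rewrite expR0 cos0 sin0 !subr0 oppr0 mulr0 !subr0 !mulr1.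
set E := expR a; set s := sin b; set c := cos b => hs hc hE.
have c1 : `|c| <= 1 := cos_max b; have s1 : `|s| <= 1 := sin_max b.
apply: le_trans (cabs_ReIm _) _.
have -> : complex.Re (expC (a +i* b) - 1 - (a +i* b)) = (E - 1 - a) * c + (1 + a) * (c - 1).
  by rewrite /expC /= -/E -/c; ring.
have -> : complex.Im (expC (a +i* b) - 1 - (a +i* b)) = (E - 1 - a) * s + (1 + a) * (s - b) + a * b.
  by rewrite /expC /= -/E -/s; ring.
have a1 : `|1 + a| <= 2.
  by apply: le_trans (ler_normD _ _) _; rewrite normr1; apply: lerD => //; apply: le_trans aH (ltW hd4).
have t1 : `|(E - 1 - a) * c| <= e / 7 * `|a| * 1 by rewrite normrM ler_pM.
have t2 : `|(E - 1 - a) * s| <= e / 7 * `|a| * 1 by rewrite normrM ler_pM.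
have t3 : `|(1 + a) * (c - 1)| <= 2 * (e / 7 * `|b|) by rewrite normrM ler_pM.
have t4 : `|(1 + a) * (s - b)| <= 2 * (e / 7 * `|b|) by rewrite normrM ler_pM.
have t5 : `|a * b| <= e / 7 * `|b| by rewrite normrM ler_wpM2r // (le_trans aH (ltW hd5)).
apply: le_trans (lerD (ler_normD _ _) (ler_normD _ _)) _.
apply: le_trans (lerD (lexx _) (lerD (ler_normD _ _) (lexx _))) _.
have ea : e / 7 * `|a| <= e / 7 * cabs (a +i* b) by rewrite ler_pM2l.
have eb : e / 7 * `|b| <= e / 7 * cabs (a +i* b) by rewrite ler_pM2l.
clear -ea eb t1 t2 t3 t4 t5; lra.
Qed.

Lemma cderiv_expC (z : C) : cderiv (@expC R) z (expC z).
Proof.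
have h := cderivZ (expC z) cderiv_expC0; rewrite mulr1 in h.
move=> e e0; have [d d0 hd] := h e e0; exists d => // x /hd.
by rewrite add0r expC0 mulr1 expCD.
Qed.

Definition cis (y : R) : C := cos y +i* sin y.

Lemma cisE y : cis y = expC (0 +i* y).
Proof. by rewrite /expC /= expR0 mul1r. Qed.

Lemma cisD x y : cis (x + y) = cis x * cis y.
Proof. by rewrite !cisE -expCD; congr expC; apply/eqP; rewrite eq_complex /= addr0 !eqxx. Qed.

Lemma cis0 : cis 0 = 1. Proof. by rewrite /cis cos0 sin0. Qed.

Lemma cis2pi : cis (pi *+ 2) = 1.
Proof.
rewrite mulr2n cisD /cis cospi sinpi; apply/eqP.
by rewrite eq_complex /=; apply/andP; split; apply/eqP; ring.
Qed.

Lemma cisMn y k : cis (y *+ k) = cis y ^+ k.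
Proof. by elim: k => [|k IH]; rewrite ?mulr0n ?cis0 // mulrS cisD IH exprS. Qed.

Lemma cabs_cis y : cabs (cis y) = 1.
Proof. by rewrite /cabs normc_def /= cos2Dsin2 sqrtr1. Qed.

Lemma lipschitz_derive (f df : R -> R) : (forall x : R, is_derive x 1 f (df x)) ->
  (forall x, `|df x| <= 1) -> forall x y, `|f x - f y| <= `|x - y|.
Proof.
move=> h df1; suff le x y : x <= y -> `|f y - f x| <= `|y - x|.
  move=> x y; have [|/ltW] := leP x y; last exact: le.
  by move=> xy; rewrite distrC [leRHS]distrC; exact: le.
move=> xy; have fc : continuous f.
  by move=> z; apply/differentiable_continuous/derivable1_diffP; have [] := h z.
have [c _ ->] := MVT_segment xy (fun z _ => h z) (continuous_subspaceT fc).
by rewrite normrM ler_piMl.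
Qed.

Lemma cis_lipschitz x y : cabs (cis x - cis y) <= 2 * `|x - y|.
Proof.
apply: le_trans (cabs_ReIm _) _; rewrite mulr_natl mulr2n; apply: lerD => /=.
  by apply: lipschitz_derive (@is_derive_cos R) _ _ _ => z; rewrite normrN sin_max.
by apply: lipschitz_derive (@is_derive_sin R) _ _ _ => z; rewrite cos_max.
Qed.

(** The order is a power of two because Goursat's grid is dyadic: its parameters [k / 2 ^ N] are
    sent to these roots. *)
Definition root2 (N : nat) : C := cis (pi *+ 2 / 2 ^+ N).

Lemma root2X N k : root2 N ^+ k = cis (pi *+ 2 * (k%:R / 2 ^+ N)).
Proof. by rewrite -cisMn mulrCA mulr_natl. Qed.

Lemma cabs_root2 N : cabs (root2 N) = 1. Proof. exact: cabs_cis. Qed.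

Lemma root2_half N : root2 N.+1 ^+ (2 ^ N) = -1.
Proof.
have -> : root2 N.+1 ^+ (2 ^ N) = cis pi.
  rewrite root2X natrX exprS -[pi *+ 2]mulr_natr; congr cis.
  have q0 : 2 ^+ N != 0 :> R by rewrite expf_neq0 // pnatr_eq0.
  by field.
by rewrite /cis cospi sinpi; apply/eqP; rewrite eq_complex /= oppr0 !eqxx.
Qed.

Lemma root2_full N : root2 N ^+ (2 ^ N) = 1.
Proof. by rewrite root2X natrX mulfV ?expf_neq0 ?pnatr_eq0 // mulr1 cis2pi. Qed.

(** The order divides [2 ^ N]; a proper divisor would divide half of it, but that power of the root
    is -1. *)
Lemma root2_prim N : (2 ^ N).-primitive_root (root2 N).
Proof.
have p0 : (0 < 2 ^ N)%N by rewrite expn_gt0.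
have [q q1] := prim_order_exists p0 (root2_full N).
case/(dvdn_pfactor q N (isT : prime 2)) => e.
rewrite leq_eqVlt => /orP[/eqP -> <- //|]; case: N p0 q1 => // N p0 q1 eN qe.
have : (q %| 2 ^ N)%N by rewrite qe dvdn_exp2l.
rewrite (prim_order_dvd q1) root2_half => /eqP h.
by move/eqP: h; rewrite eq_sym -subr_eq0 opprK -[1 + 1]/(2%:R) pnatr_eq0.
Qed.

Lemma sum_root2 N j : (0 < j < 2 ^ N)%N ->
  \sum_(k < 2 ^ N) (root2 N ^+ k)^-1 ^+ j = 0.
Proof.
case/andP=> j0 jN; have r0 : root2 N != 0 by rewrite -cabs_gt0 cabs_root2.
have hj : (root2 N ^+ j)^-1 - 1 != 0.
  rewrite subr_eq0 invr_eq1 -(prim_order_dvd (root2_prim N)).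
  by apply/negP => /(dvdn_leq j0); rewrite leqNgt jN.
apply: (mulfI hj); rewrite mulr0; under eq_bigr do rewrite exprVn -exprM mulnC exprM -exprVn.
by rewrite -subrX1 exprVn -exprM mulnC exprM root2_full expr1n invr1 subrr.
Qed.

(** Over half a turn, [w - 1] times the sum of [2 ^ N / 2] powers of modulus 1 equals -2. The bound
    turns small Riemann sums into small means. *)
Lemma root2_sub1_ge N : (0 < N)%N -> 4 <= (2 ^ N)%:R * cabs (root2 N - 1).
Proof.
case: N => // N _; have := subrX1 (root2 N.+1) (2 ^ N); rewrite root2_half => h.
have : cabs (-1 - 1 : C) = 2.
  by rewrite (_ : -1 - 1 = - 2%:R) ?cabsN ?cabs_natr //; ring.
rewrite h cabsM => h2.
have : cabs (\sum_(i < 2 ^ N) root2 N.+1 ^+ i) <= (2 ^ N)%:R.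
  apply: le_trans (cabs_sum _ _ _) _.
  under eq_bigr do rewrite cabsX cabs_root2 expr1n.
  by rewrite sumr_const card_ord.
move=> /(ler_wpM2l (cabs_ge0 (root2 N.+1 - 1))); rewrite h2 => h3.
by rewrite expnS natrM mulrAC -mulrA; move: h3; lra.
Qed.

(** Each term is a finite geometric sum over a common denominator, and orthogonality of the roots
    removes all powers of [u] but the zeroth. The mean of the Cauchy kernel is thus exact at every
    [N]. *)
Lemma mean_root2 N (u : C) : u ^+ (2 ^ N) != 1 ->
  (2 ^ N)%:R^-1 * \sum_(k < 2 ^ N) (1 - u * (root2 N ^+ k)^-1)^-1 = (1 - u ^+ (2 ^ N))^-1.
Proof.
move=> hu; have hu' : 1 - u ^+ (2 ^ N) != 0 by rewrite subr_eq0 eq_sym.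
have r0 : root2 N != 0 by rewrite -cabs_gt0 cabs_root2.
have q0 : (2 ^ N)%:R != 0 :> C by rewrite pnatr_eq0 -lt0n expn_gt0.
have uk k : (u * (root2 N ^+ k)^-1) ^+ (2 ^ N) = u ^+ (2 ^ N).
  by rewrite exprMn exprVn -exprM mulnC exprM root2_full expr1n invr1 mulr1.
under eq_bigr => k _.
  have -> : (1 - u * (root2 N ^+ k)^-1)^-1 =
      (1 - u ^+ (2 ^ N))^-1 * \sum_(j < 2 ^ N) (u * (root2 N ^+ k)^-1) ^+ j.
    have := subrX1 (u * (root2 N ^+ k)^-1) (2 ^ N); rewrite uk.
    set v := u * _; set S := \sum_(j < _) _ => hS.
    have v1 : 1 - v != 0.
      by apply: contra hu; rewrite subr_eq0 => /eqP v1; rewrite -(uk k) -/v -v1 expr1n.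
    have -> : 1 - u ^+ (2 ^ N) = (1 - v) * S by rewrite -[LHS]opprB hS; ring.
    have S0 : S != 0.
      by apply: contraNneq hu' => S0; rewrite -[_ - _]opprB hS S0 mulr0 oppr0.
    by field; rewrite v1 S0.
  over.
rewrite -mulr_sumr exchange_big /= mulrCA; rewrite -[RHS]mulr1; congr (_ * _).
have p0 : (0 < 2 ^ N)%N by rewrite expn_gt0.
rewrite (bigD1 (Ordinal p0)) //= [X in _ + X]big1 ?addr0 => [|j j0].
  by under eq_bigr do rewrite expr0; rewrite sumr_const card_ord mulVf.
under eq_bigr do rewrite exprMn; rewrite -mulr_sumr sum_root2 ?mulr0 //=.
by rewrite ltn_ord andbT lt0n.
Qed.

End Exponential.

(** * Cauchy's formula as a limit of means over roots of unity *)

Section CauchyFormula.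
Variable R : realType.
Notation C := R[i].

Lemma flim_expn (t : C) : cabs t < 1 -> flim \oo (fun N => t ^+ (2 ^ N)) 0.
Proof.
move=> t1 e e0; have ct : `|cabs t| < 1 by rewrite ger0_norm ?cabs_ge0.
have /cvgrPdist_le/(_ _ e0) [N0 _ hN] := cvg_expr ct.
exists N0 => // N /= hN0; have /= := hN N hN0.
rewrite sub0r normrN normrX ger0_norm ?cabs_ge0 // subr0 cabsX; apply: le_trans.
by apply: ler_wiXn2l; [exact: cabs_ge0|exact: ltW|exact/ltnW/ltn_expl].
Qed.

Variables (g : C -> C) (rho : R) (t0 : C).
Hypothesis t0_lt : cabs t0 < rho.
Hypothesis g_der : forall z, cabs z <= rho -> exists l, cderiv g z l.

Let phi z := (g z - g t0) / (z - t0).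
Let rho_gt0 : 0 < rho. Proof. exact: le_lt_trans (cabs_ge0 _) t0_lt. Qed.

Let phi_der z : cabs z <= rho -> z != t0 -> exists l, cderiv phi z l.
Proof.
move=> zr z0; have [l hl] := g_der zr; eexists.
apply: cderivM; first by apply: cderivB hl (cderiv_cst _ _).
by apply: cderivV; [rewrite subr_eq0|apply: cderivB (cderiv_id _) (cderiv_cst _ _)].
Qed.

Let circle_neq y : rho%:C * cis y - t0 != 0.
Proof.
rewrite subr_eq0; apply/eqP => h; move: t0_lt.
by rewrite -h cabsM cabsR cabs_cis mulr1 gtr0_norm // ltxx.
Qed.

Let circle_le y : cabs (rho%:C * cis y - t0) <= 2 * rho.
Proof.
apply: le_trans (cabsB _ _) _; rewrite cabsM cabsR cabs_cis mulr1 gtr0_norm //.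
by have := t0_lt; lra.
Qed.

Let circle_sum N := riemann_sum phi (fun k => rho%:C * root2 R N ^+ k) (2 ^ N).

(** Goursat's theorem applies to the difference quotient [phi] between the circle and its image
    under a strong contraction towards [t0]. As [phi] is bounded near [t0], the small circle
    contributes little. *)
Lemma circle_sum_cvg0 : flim \oo circle_sum 0.
Proof.
move=> e e0; have [l0 hl0] := g_der (ltW t0_lt); have [d d0 hd] := hl0 _ ltr01.
pose M := cabs l0 + 1; have M0 : 0 < M by rewrite ltr_wpDl ?cabs_ge0.
pose Lr := 4 * pi * rho; have Lr0 : 0 < Lr by rewrite !mulr_gt0 // pi_gt0.
have phi_le h : h != 0 -> cabs h < d -> cabs (phi (t0 + h)) <= M.
  move=> h0 /hd; rewrite mul1r => hh.
  have -> : phi (t0 + h) = (g (t0 + h) - g t0) / h by rewrite /phi; congr (_ / _); ring.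
  rewrite cabsM cabsV ler_pdivrMr ?cabs_gt0 // mulrDl mul1r -cabsM (mulrC l0).
  by rewrite -[X in cabs X <= _](subrK (h * l0)); apply: le_trans (cabsD _ _) _; rewrite [leLHS]addrC lerD.
(* [dl] is the contraction ratio: the small circle must lie where [phi] is bounded by [M], and its
   inscribed polygons have length at most [dl * Lr]. *)
have [dl [dl0 dl1 dl2 dl3]] : exists dl : R, [/\ 0 < dl, dl <= 1, dl * (2 * rho) < d & M * dl * Lr <= e / 2].
  exists (Num.min (1 / 2) (Num.min (d / (4 * rho)) (e / 2 / (M * Lr)))); split.
  - have h4 : 0 < 4 * rho by rewrite mulr_gt0.
    have h5 : 0 < M * Lr by rewrite mulr_gt0.
    have h6 : 0 < e / 2 by rewrite divr_gt0.
    by rewrite !lt_min (divr_gt0 ltr01) ?(divr_gt0 d0 h4) ?(divr_gt0 h6 h5).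
  - by rewrite ge_min; apply/orP; left; lra.
  - apply: (@le_lt_trans _ _ (d / (4 * rho) * (2 * rho))).
      by rewrite ler_pM2r ?mulr_gt0 // !ge_min lexx orbT.
    have -> : d / (4 * rho) * (2 * rho) = d / 2 by field; rewrite gt_eqF.
    by rewrite gtr_pMr // invf_lt1 // ltr1n.
  - have h5 : 0 < M * Lr by rewrite mulr_gt0.
    by rewrite mulrAC mulrC -(ler_pdivlMr _ _ h5) !ge_min lexx !orbT.
pose lam (x : R) := dl + (1 - dl) * x.
have lam01 x : 0 <= x <= 1 -> 0 < lam x <= 1.
  move=> /andP[x0 x1]; rewrite /lam; apply/andP; split; first by rewrite ltr_pwDl ?mulr_ge0 ?subr_ge0.
  have : (1 - dl) * x <= (1 - dl) * 1 by rewrite ler_wpM2l ?subr_ge0.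
  by rewrite mulr1; lra.
pose H (x y : R) : C := t0 + (lam x)%:C * (rho%:C * cis (pi *+ 2 * y) - t0).
have cis_step y y' : cabs (rho%:C * cis (pi *+ 2 * y) - rho%:C * cis (pi *+ 2 * y')) <= Lr * `|y - y'|.
  rewrite -mulrBr cabsM cabsR gtr0_norm //.
  apply: le_trans (ler_wpM2l (ltW rho_gt0) (cis_lipschitz _ _)) _.
  have pi0 : 0 <= pi *+ 2 :> R by rewrite mulrn_wge0 // ltW // pi_gt0.
  rewrite -mulrBr normrM (ger0_norm pi0) -[pi *+ 2]mulr_natr.
  by rewrite /Lr le_eqVlt; apply/orP; left; apply/eqP; ring.
have H_lip x y x' y' : 0 <= x <= 1 -> 0 <= y <= 1 -> 0 <= x' <= 1 -> 0 <= y' <= 1 ->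
    cabs (H x y - H x' y') <= (2 * rho + Lr) * (`|x - x'| + `|y - y'|).
  move=> hx _ hx' _.
  have -> : H x y - H x' y' = ((1 - dl) * (x - x'))%:C * (rho%:C * cis (pi *+ 2 * y) - t0)
      + (lam x')%:C * (rho%:C * cis (pi *+ 2 * y) - rho%:C * cis (pi *+ 2 * y')).
    by rewrite /H /lam !(rmorphD, rmorphM, rmorphB) /= rmorph1; ring.
  have /andP[l0' l1'] := lam01 _ hx'.
  apply: le_trans (cabsD _ _) _; rewrite !cabsM !cabsR (gtr0_norm l0') normrM.
  have h1 : `|1 - dl| * `|x - x'| * cabs (rho%:C * cis (pi *+ 2 * y) - t0) <= 2 * rho * `|x - x'|.
    rewrite mulrC mulrCA -[2 * rho * _]mul1r; apply: ler_pM => //.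
    - by rewrite mulr_ge0 ?cabs_ge0.
    - by rewrite ger0_norm ?subr_ge0 // gerBl ltW.
    - by apply: ler_wpM2r => //; exact: circle_le.
  have h2 : lam x' * cabs (rho%:C * cis (pi *+ 2 * y) - rho%:C * cis (pi *+ 2 * y')) <= Lr * `|y - y'|.
    by apply: le_trans (cis_step y y'); rewrite ler_piMl ?cabs_ge0.
  apply: le_trans (lerD h1 h2) _; rewrite -subr_ge0.
  have -> : (2 * rho + Lr) * (`|x - x'| + `|y - y'|) - (2 * rho * `|x - x'| + Lr * `|y - y'|)
     = Lr * `|x - x'| + 2 * rho * `|y - y'| by ring.
  by apply: addr_ge0; apply: mulr_ge0; rewrite ?normr_ge0 // ltW // mulr_gt0.
have H_neq x y : 0 <= x <= 1 -> H x y - t0 != 0.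
  move=> /lam01/andP[l0' _]; rewrite /H addrAC subrr add0r mulf_neq0 //.
  by rewrite -cabs_gt0 cabsR normr_gt0 gt_eqF.
have H_der x y : 0 <= x <= 1 -> 0 <= y <= 1 -> exists l, cderiv phi (H x y) l.
  move=> hx _; apply: phi_der; last by rewrite -subr_eq0 H_neq.
  have /andP[l0' l1'] := lam01 _ hx.
  (* A convex combination of [t0] and a point of the circle stays in the disc where [g] is
     differentiable. *)
  have -> : H x y = (1 - lam x)%:C * t0 + (lam x)%:C * (rho%:C * cis (pi *+ 2 * y)).
    by rewrite /H rmorphB rmorph1; ring.
  apply: le_trans (cabsD _ _) _; rewrite !cabsM !cabsR cabs_cis mulr1 (gtr0_norm l0') (gtr0_norm rho_gt0).
  rewrite ger0_norm ?subr_ge0 //.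
  have : (1 - lam x) * cabs t0 <= (1 - lam x) * rho by rewrite ler_wpM2l ?subr_ge0 // ltW.
  by lra.
have L0 : 0 < 2 * rho + Lr by apply: addr_gt0 => //; apply: mulr_gt0.
have e2 : 0 < e / 2 by rewrite divr_gt0.
have [N0 hN] := goursat L0 H_lip H_der e2.
have HP N k x : H x (k%:R / 2 ^+ N) = t0 + (lam x)%:C * (rho%:C * root2 R N ^+ k - t0).
  by rewrite /H root2X.
have p2 N : 2 ^+ N != 0 :> R by rewrite expf_neq0 // pnatr_eq0.
exists N0 => // N /= /hN; rewrite subr0 /square_sum !add0n.
(* The circle closes up, so both horizontal sides are the same segment and cancel. *)
have -> : hside phi H N 0 (2 ^ N) (2 ^ N) = hside phi H N 0 0 (2 ^ N).
  rewrite /hside; congr riemann_sum; apply/funext => k.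
  by rewrite /gridpt !HP root2_full expr0.
have -> : vside phi H N (2 ^ N) 0 (2 ^ N) = circle_sum N.
  rewrite /vside; congr riemann_sum; apply/funext => k.
  rewrite /gridpt HP add0n natrX divff // /lam mulr1 (addrC dl) subrK mul1r.
  by rewrite addrC subrK.
rewrite [_ + circle_sum N]addrC addrK => h1.
rewrite -(subrK (vside phi H N 0 0 (2 ^ N)) (circle_sum N)).
apply: le_trans (cabsD _ _) _; rewrite [leRHS]splitr; apply: lerD => //.
apply: le_trans (cabs_sum _ _ _) _; apply: le_trans dl3.
have -> : M * dl * Lr = \sum_(i < 2 ^ N) M * (dl * (Lr * 2 ^- N)).
  rewrite sumr_const card_ord -[RHS]mulr_natr natrX; field; exact: p2.
apply: ler_sum => k _; rewrite /gridpt !HP !add0n cabsM mul0r.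
have lam0 : lam 0 = dl by rewrite /lam mulr0 addr0.
have x0 : 0 <= (0 : R) <= 1 by rewrite lexx ler01.
apply: ler_pM; rewrite ?cabs_ge0 //.
  apply: phi_le.
    by have := H_neq _ (k%:R / 2 ^+ N) x0; rewrite HP addrAC subrr add0r.
  rewrite lam0 cabsM cabsR gtr0_norm //; apply: le_lt_trans dl2.
  by rewrite ler_pM2l // root2X circle_le.
have -> : t0 + (lam 0)%:C * (rho%:C * root2 R N ^+ k.+1 - t0) - (t0 + (lam 0)%:C * (rho%:C * root2 R N ^+ k - t0))
  = (lam 0)%:C * (rho%:C * root2 R N ^+ k.+1 - rho%:C * root2 R N ^+ k) by ring.
rewrite lam0 cabsM cabsR gtr0_norm // ler_pM2l //.
rewrite !root2X; apply: le_trans (cis_step _ _) _.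
by rewrite -mulrBl -natrB // subSnn mul1r ger0_norm // invr_ge0 exprn_ge0.
Qed.

Definition circle_pt N k : C := rho%:C * root2 R N ^+ k.

(** As [1 / (1 - t0 / z) = z / (z - t0)] and [g z = phi z (z - t0) + g t0], the mean splits into
    that of [phi z z], which is a Riemann sum divided by [2 ^ N (w - 1)], and [g t0] times the exact
    mean of the kernel. *)
Lemma discrete_cauchy :
  flim \oo (fun N => (2 ^ N)%:R^-1 *
    \sum_(k < 2 ^ N) g (circle_pt N k) * (1 - t0 / circle_pt N k)^-1) (g t0).
Proof.
have rC0 : rho%:C != 0 :> C by rewrite -cabs_gt0 cabsR normr_gt0 gt_eqF.
have w0 N : root2 R N != 0 by rewrite -cabs_gt0 cabs_root2.
have z0 N k : circle_pt N k != 0 by rewrite mulf_neq0 // expf_neq0.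
pose u := t0 / rho%:C.
have u1 : cabs u < 1.
  by rewrite cabsM cabsV cabsR gtr0_norm // ltr_pdivrMr // mul1r.
have un N : u ^+ (2 ^ N) != 1.
  apply/eqP => h; have := congr1 (@cabs R) h; rewrite cabs1 cabsX => /eqP.
  by rewrite lt_eqF // exprn_ilt1 ?cabs_ge0 // -lt0n expn_gt0.
pose mphi N := (2 ^ N)%:R^-1 * \sum_(k < 2 ^ N) phi (circle_pt N k) * circle_pt N k.
have mphi0 : flim \oo mphi 0.
  move=> e e0; have e4 : 0 < 4 * e by rewrite mulr_gt0.
  have [N0 _ hN] := circle_sum_cvg0 e4; exists N0.+1 => // N /= NN.
  have /= := hN N (ltnW NN); rewrite !subr0.
  have -> : circle_sum N = (root2 R N - 1) * \sum_(k < 2 ^ N) phi (circle_pt N k) * circle_pt N k.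
    rewrite /circle_sum /riemann_sum mulr_sumr; apply: eq_bigr => k _.
    by rewrite /circle_pt exprS; ring.
  rewrite /mphi !cabsM cabsV cabs_natr; set S := cabs (\sum_(_ < _) _) => h.
  have q0 : 0 < (2 ^ N)%:R :> R by rewrite ltr0n expn_gt0.
  rewrite ler_pdivrMl // -(ler_pM2l (_ : 0 < 4)) //.
  apply: le_trans (_ : (2 ^ N)%:R * cabs (root2 R N - 1) * S <= _).
    by rewrite ler_wpM2r ?cabs_ge0 // root2_sub1_ge // (leq_ltn_trans _ NN).
  by rewrite -mulrA [leRHS]mulrCA ler_pM2l.
suff -> : (fun N => (2 ^ N)%:R^-1 *
    \sum_(k < 2 ^ N) g (circle_pt N k) * (1 - t0 / circle_pt N k)^-1) =
    (fun N => mphi N + g t0 * (1 - u ^+ (2 ^ N))^-1).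
  have hl : flim \oo (fun N => mphi N + g t0 * (1 - u ^+ (2 ^ N))^-1) (0 + g t0 * (1 - 0)^-1).
    apply: flimD => //; apply: flimM; first exact: flim_cst.
    apply: flimV; first by rewrite subr0 oner_neq0.
    apply: flimD; first exact: flim_cst.
    by apply: flimN; exact: flim_expn.
  by move: hl; rewrite subr0 invr1 mulr1 add0r.
apply/funext => N; rewrite -(mean_root2 (un N)) /mphi mulrCA -mulrDr; congr (_ * _).
rewrite mulr_sumr -big_split; apply: eq_bigr => k _ /=.
have -> : u / root2 R N ^+ k = t0 / circle_pt N k.
  by rewrite /u /circle_pt; field; rewrite rC0 expf_neq0.
have zt : circle_pt N k - t0 != 0 by rewrite /circle_pt root2X circle_neq.
have -> : 1 - t0 / circle_pt N k = (circle_pt N k - t0) / circle_pt N k by field.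
by rewrite /phi; field; rewrite zt z0.
Qed.

End CauchyFormula.

(** * Power series in polydiscs *)

Section MultiCauchy.
Variable R : realType.
Notation C := R[i].

(** The limit is the supremum of the levels that [u] reaches on a set of [U]. *)
Lemma ultra_lim_real (U : set_system nat) (FU : UltraFilter U) (u : nat -> R) (M : R) :
  (forall n, `|u n| <= M) ->
  exists s, forall e, 0 < e -> U [set n | `|u n - s| <= e].
Proof.
move=> uM; pose S := [set x | U [set n | x <= u n]].
have bd n : - M <= u n <= M by rewrite -ler_norml.
have hS : has_sup S.
  split; first by exists (- M); apply: filterE => n; have /andP[] := bd n.
  exists M => x /= Ux; have [n /= h] := filter_ex Ux.
  by apply: le_trans h _; have /andP[] := bd n.
exists (sup S) => e e0.
have [x Sx hx] := sup_adherent e0 hS.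
have [h|h] := in_ultra_setVsetC [set n | sup S + e <= u n] FU.
  by have := ub_le_sup hS.2 h; rewrite gerDl leNgt e0.
have {}Sx : U [set n | x <= u n] := Sx.
apply: filterS2 Sx h => n /= h1 /negP; rewrite -ltNge => h2.
by rewrite ler_norml; apply/andP; split; lra.
Qed.

Lemma ultra_lim (U : set_system nat) (FU : UltraFilter U) (u : nat -> C) (M : R) :
  (forall n, cabs (u n) <= M) -> exists l, flim U u l.
Proof.
move=> uM.
have [s hs] := ultra_lim_real FU (fun n => le_trans (cabs_Re _) (uM n)).
have [t ht] := ultra_lim_real FU (fun n => le_trans (cabs_Im _) (uM n)).
exists (s +i* t) => e e0; have e2 : 0 < e / 2 by rewrite divr_gt0.
apply: filterS2 (hs _ e2) (ht _ e2) => n /= h1 h2.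
apply: le_trans (cabs_ReIm _) _; rewrite [e]splitr.
by case: (u n) h1 h2 => a b /= h1 h2; rewrite lerD.
Qed.

Variable I : finType.
Implicit Types (x y : I -> C) (a b : {ffun I -> nat}).

Definition monom x a : C := \prod_i x i ^+ a i.

Definition upd x i (t : C) : I -> C := fun j => if j == i then t else x j.

Lemma upd_id x i : upd x i (x i) = x.
Proof. by apply/funext => j; rewrite /upd; case: eqP => // ->. Qed.

Lemma upd_eq x i t : upd x i t i = t.
Proof. by rewrite /upd eqxx. Qed.

Lemma upd_upd x i t t' : upd (upd x i t) i t' = upd x i t'.
Proof. by apply/funext => j; rewrite /upd; case: eqP. Qed.

Definition in_polydisc (r : R) x := forall i, cabs (x i) < r.

(** Cauchy's estimates with a fixed [M] are part of the notion, which makes it stable under means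
    and pointwise limits. *)
Definition pseries (r M : R) (F : (I -> C) -> C) := exists b : {ffun I -> nat} -> C,
  (forall a, cabs (b a) <= M * \prod_i r^-1 ^+ a i) /\
  forall x, in_polydisc r x -> has_sum (fun a => b a * monom x a) (F x).

Lemma bsum_geom (r : R) (x : I -> C) (M : R) : 0 <= M -> 0 < r -> in_polydisc r x ->
  bsum (fun a => M * \prod_i (cabs (x i) / r) ^+ a i).
Proof.
move=> M0 r0 xr; apply: bsumZ => //.
have h i : cabs ((cabs (x i) / r)%:C : C) < 1.
  by rewrite cabsR ger0_norm ?divr_ge0 ?cabs_ge0 ?(ltW r0) // ltr_pdivrMr // mul1r.
have [B hB] := has_sum_asum (has_sum_prod_geom h).
exists B => A; apply: le_trans (hB A); apply: ler_sum => a _.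
rewrite cabs_prod; apply: ler_prod => i _; rewrite cabsX cabsR.
have h0 : 0 <= cabs (x i) / r by rewrite divr_ge0 ?cabs_ge0 // ltW.
by rewrite (ger0_norm h0) lexx exprn_ge0.
Qed.

Lemma monom_le (r M : R) (x : I -> C) (b : C) a : 0 < r -> cabs b <= M * \prod_i r^-1 ^+ a i ->
  cabs (b * monom x a) <= M * \prod_i (cabs (x i) / r) ^+ a i.
Proof.
move=> r0 hb; rewrite cabsM cabs_prod.
have -> : M * \prod_i (cabs (x i) / r) ^+ a i =
    M * (\prod_i r^-1 ^+ a i) * \prod_i cabs (x i) ^+ a i.
  by rewrite -mulrA -big_split; congr (_ * _); apply: eq_bigr => i _; rewrite exprMn mulrC.
apply: ler_pM; rewrite ?cabs_ge0 //.
  by apply: prodr_ge0 => i _; exact: cabs_ge0.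
by under eq_bigr do rewrite cabsX.
Qed.

(** Along an ultrafilter finer than [\oo] all the bounded coefficient sequences converge. The
    estimates pass to the limit and dominate the series, so the limit coefficients sum to the
    pointwise limit. *)
Lemma pseries_lim (r M : R) (G : nat -> (I -> C) -> C) F : 0 <= M -> 0 < r ->
  (forall N, pseries r M (G N)) ->
  (forall x, in_polydisc r x -> flim \oo (G ^~ x) (F x)) -> pseries r M F.
Proof.
move=> M0 r0 /choice[b hb] GF.
have [U [FU oU]] := ultraFilterLemma (@eventually_filter).
have /choice[c hc] a : exists l, flim U (b ^~ a) l.
  by apply: (ultra_lim FU) => N; exact: (hb N).1.
have cM a : cabs (c a) <= M * \prod_i r^-1 ^+ a i.
  apply/ler_addgt0Pr => e e0; have [N /= hN] := filter_ex (hc a _ e0).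
  rewrite -[c a](subKr (b N a)); apply: le_trans (cabsB _ _) _.
  by rewrite lerD // (hb N).1.
exists c; split=> // x xr.
have hD := bsum_geom M0 r0 xr.
have [l hl] : exists l, has_sum (fun a => c a * monom x a) l.
  by apply: asum_has_sum; apply: bsum_le hD => a; exact: monom_le.
suff <- : l = F x by [].
have Ul : flim U (G ^~ x) l.
  apply: (@has_sum_dominated _ _ _ _ _ (fun N a => b N a * monom x a) _ _ _ _ hD _ _ _ hl).
  - by apply: filterE => N a; apply: monom_le => //; exact: (hb N).1.
  - by move=> a; apply: flimM; [exact: hc|exact: flim_cst].
  - by apply: filterE => N; exact: (hb N).2.
apply: flim_unique Ul _ => e e0; apply: oU; exact: GF.
Qed.

Lemma pseries_mean (r M : R) n (G : nat -> (I -> C) -> C) : (0 < n)%N ->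
  (forall k, pseries r M (G k)) ->
  pseries r M (fun x => n%:R^-1 * \sum_(k < n) G k x).
Proof.
move=> n0 /choice[b hb]; exists (fun a => n%:R^-1 * \sum_(k < n) b k a); split=> [a|x xr].
  rewrite cabsM cabsV cabs_natr ler_pdivrMl ?ltr0n //.
  apply: le_trans (cabs_sum _ _ _) _.
  apply: le_trans (ler_sum _ (fun (k : 'I_n) _ => (hb k).1 a)) _.
  by rewrite sumr_const card_ord mulr_natl.
have := has_sumZ (c := n%:R^-1) (has_sum_sum (r := index_enum 'I_n) (fun k : 'I_n => (hb k).2 x xr)).
by apply: eq_has_sum => a; rewrite -mulrA mulr_suml.
Qed.

Definition sep_holo (r : R) (F : (I -> C) -> C) := forall x, (forall i, cabs (x i) <= r) ->
  forall i, exists l, cderiv (fun t => F (upd x i t)) (x i) l.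

(* Cauchy's formula in one coordinate at a time: the coordinates outside of the
   list s still run over the torus and come with their Cauchy kernel. *)
Lemma cauchy_pseries_seq (r M : R) F (s : seq I) y : 0 < r -> 0 <= M ->
  sep_holo r F -> (forall x, (forall i, cabs (x i) <= r) -> cabs (F x) <= M) ->
  uniq s -> (forall i, cabs (y i) = r) ->
  pseries r M (fun x => F (fun i => if i \in s then x i else y i) *
    \prod_(i | i \notin s) (1 - x i / y i)^-1).
Proof.
move=> r0 M0 hF FM; elim: s y => [|i s IH] y /=.
  move=> _ hy; exists (fun a => F y * \prod_i (y i)^-1 ^+ a i); split=> [a|x xr].
    rewrite cabsM cabs_prod; apply: ler_pM; rewrite ?cabs_ge0 //.
    - by apply: prodr_ge0 => i _; exact: cabs_ge0.
    - by apply: FM => i; rewrite hy.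
    - by apply: ler_prod => i _; rewrite cabsX cabsV hy lexx exprn_ge0 // invr_ge0 ltW.
  have h i : cabs (x i / y i) < 1 by rewrite cabsM cabsV hy ltr_pdivrMr // mul1r.
  have := has_sumZ (c := F y) (has_sum_prod_geom h).
  apply: eq_has_sum => a; rewrite /monom -mulrA -big_split /=; congr (_ * _).
  by apply: eq_bigr => j _; rewrite exprMn mulrC.
case/andP=> si us hy.
pose K x := \prod_(j | j \notin i :: s) (1 - x j / y j)^-1.
(* [G N] averages functions covered by the induction hypothesis, with [y i] moved around its circle;
   its limit is given by [discrete_cauchy] in coordinate [i]. *)
pose G N x := (2 ^ N)%:R^-1 * \sum_(k < 2 ^ N)
  F (fun j => if j \in s then x j else upd y i (circle_pt r N k) j) *
  \prod_(j | j \notin s) (1 - x j / upd y i (circle_pt r N k) j)^-1.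
apply: (@pseries_lim r M G) => // [N|x xr].
  apply: (@pseries_mean r M (2 ^ N) (fun k x =>
    F (fun j => if j \in s then x j else upd y i (circle_pt r N k) j) *
    \prod_(j | j \notin s) (1 - x j / upd y i (circle_pt r N k) j)^-1)); first by rewrite expn_gt0.
  move=> k; apply: IH => // j; rewrite /upd; case: eqP => // _.
  by rewrite /circle_pt cabsM cabsX cabs_root2 expr1n mulr1 cabsR gtr0_norm.
pose m := fun j => if j \in s then x j else y j.
have mr t : cabs t <= r -> forall j, cabs (upd m i t j) <= r.
  move=> tr j; rewrite /upd /m; case: eqP => // _; case: ifP => _; last by rewrite hy.
  exact: ltW.
have g_der z : cabs z <= r -> exists l, cderiv (fun t => F (upd m i t)) z l.
  move=> zr; have [l] := hF _ (mr z zr) i; rewrite upd_eq => hl.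
  by exists l; move: hl; under eq_fun do rewrite upd_upd.
have h : flim \oo (fun N => (2 ^ N)%:R^-1 * (\sum_(k < 2 ^ N)
    F (upd m i (circle_pt r N k)) * (1 - x i / circle_pt r N k)^-1) * K x)
    (F (upd m i (x i)) * K x).
  by apply: flimM; [exact: (discrete_cauchy (xr i) g_der)|exact: flim_cst].
have -> : (fun j => if j \in i :: s then x j else y j) = upd m i (x i).
  by apply/funext => j; rewrite /upd /m inE; case: eqP => [->|].
apply: flim_ext h; near=> N; rewrite /G -mulrA; congr (_ * _).
rewrite mulr_suml; apply: eq_bigr => k _; rewrite -mulrA; congr (F _ * _).
  by apply/funext => j; rewrite /upd /m; case: eqP => [->|//]; rewrite (negPf si).
rewrite [RHS](bigD1 i) //= upd_eq; congr (_ * _); apply: eq_big => j.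
  by rewrite inE negb_or andbC.
by rewrite inE negb_or /upd => /andP[/negPf -> _].
Unshelve. all: by end_near.
Qed.

Lemma cauchy_pseries (r M : R) F : 0 < r -> 0 <= M -> sep_holo r F ->
  (forall x, (forall i, cabs (x i) <= r) -> cabs (F x) <= M) -> pseries r M F.
Proof.
move=> r0 M0 hF FM.
have hr (i : I) : cabs (r%:C : C) = r by rewrite cabsR gtr0_norm.
have [b [bM hb]] := @cauchy_pseries_seq r M F (enum I) (fun=> r%:C) r0 M0 hF FM (enum_uniq _) hr.
exists b; split; first exact: bM.
move=> x xr; have := hb x xr.
rewrite big_pred0 ?mulr1 => [|i]; last by rewrite mem_enum.
by congr (has_sum _ (F _)); apply/funext => i; rewrite mem_enum.
Qed.

End MultiCauchy.

(** * Termwise differentiation and uniqueness of coefficients *)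

Section TermwiseDerivative.
Variable R : realType.
Notation C := R[i].
Variable I : finType.
Implicit Types (x y : I -> C) (a : {ffun I -> nat}) (b : {ffun I -> nat} -> C)
  (F : (I -> C) -> C).

(** Against divided monomials a partial derivative is a pure shift of the coefficients by [incr],
    free of integer factors. *)
Definition divmon x a : C := \prod_i (x i ^+ a i / (a i)`!%:R).
Definition incr (i : I) a : {ffun I -> nat} := [ffun j => (a j + (j == i))%N].
Definition decr (i : I) a : {ffun I -> nat} := [ffun j => (a j - (j == i))%N].
Definition psum_on (r : R) b F :=
  forall x, in_polydisc r x -> has_sum (fun a => b a * divmon x a) (F x).

Lemma incrK i : cancel (incr i) (decr i).
Proof. by move=> a; apply/ffunP => j; rewrite !ffunE addnK. Qed.

Lemma decrK i a : (0 < a i)%N -> incr i (decr i a) = a.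
Proof.
move=> ai; apply/ffunP => j; rewrite !ffunE subnK //.
by case: eqP => // ->.
Qed.

Lemma incrC i j a : incr i (incr j a) = incr j (incr i a).
Proof. by apply/ffunP => k; rewrite !ffunE addnAC. Qed.

Lemma fact_neq0 k : k`!%:R != 0 :> C.
Proof. by rewrite pnatr_eq0 -lt0n fact_gt0. Qed.

Lemma divmon_bigD1 x i a :
  divmon x a = x i ^+ a i / (a i)`!%:R * \prod_(j | j != i) (x j ^+ a j / (a j)`!%:R).
Proof. by rewrite /divmon (bigD1 i). Qed.

Lemma pseries_psum_on (r M : R) F : pseries r M F -> exists b,
  (forall a, cabs (b a) <= M * \prod_i ((a i)`!%:R * r^-1 ^+ a i)) /\ psum_on r b F.
Proof.
move=> [b [bM hb]]; exists (fun a => b a * \prod_i (a i)`!%:R); split=> [a|x xr].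
  rewrite cabsM cabs_prod big_split /= mulrCA mulrC.
  rewrite (eq_bigr (fun i => (a i)`!%:R)) => [|i _]; last by rewrite cabs_natr.
  by apply: ler_wpM2l (bM a); apply: prodr_ge0.
have := hb x xr; apply: eq_has_sum => a; rewrite -mulrA /divmon -big_split /=.
by congr (_ * _); apply: eq_bigr => i _; rewrite mulrC divfK // fact_neq0.
Qed.

Lemma polydisc_radius (r : R) x : 0 < r -> in_polydisc r x ->
  exists q, 0 <= q < r /\ forall i, cabs (x i) <= q.
Proof.
move=> r0 xr; exists (\big[Num.max/0]_i cabs (x i)); split; last first.
  by move=> i; apply: (@le_bigmax _ _ _ 0 (fun i => cabs (x i))).
apply/andP; split; last by apply/bigmax_ltP.
exact: bigmax_ge_id.
Qed.

(** The difference quotient of the [n]-th power as a polynomial in [s] and [h], hence meaningful at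
    [h = 0]. *)
Definition dquot n (s h : C) := \sum_(k < n) (s + h) ^+ (n.-1 - k) * s ^+ k.

Lemma dquotE n s h : (s + h) ^+ n - s ^+ n = h * dquot n s h.
Proof. by rewrite subrXX addrAC subrr add0r. Qed.

(** Termwise comparison with [(p ^+ n - q ^+ n) / (p - q)]: the factor [n] of the derivative is
    traded for a slightly larger radius. *)
Lemma dquot_le n (s h : C) (q p : R) : cabs s <= q -> cabs (s + h) <= q -> 0 <= q -> q < p ->
  cabs (dquot n s h) <= p ^+ n / (p - q).
Proof.
move=> sq shq q0 qp; have pq : 0 < p - q by rewrite subr_gt0.
rewrite ler_pdivlMr //; apply: le_trans (_ : p ^+ n - q ^+ n <= _); last first.
  by rewrite gerBl exprn_ge0.
rewrite subrXX [leRHS]mulrC ler_wpM2r ?(ltW pq) //.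
apply: le_trans (cabs_sum _ _ _) _; apply: ler_sum => k _; rewrite cabsM !cabsX.
apply: ler_pM; rewrite ?exprn_ge0 ?cabs_ge0 //; last by rewrite lerXn2r ?nnegrE ?cabs_ge0.
rewrite lerXn2r ?nnegrE ?cabs_ge0 //; first by rewrite (le_trans q0) // ltW.
by apply: le_trans shq _; exact: ltW.
Qed.

Lemma flim_exp T (G : set_system T) {FG : Filter G} (u : T -> C) l n :
  flim G u l -> flim G (fun t => u t ^+ n) (l ^+ n).
Proof.
move=> h; elim: n => [|n IH]; first by rewrite expr0; exact: flim_cst.
by rewrite exprS; under eq_fun do rewrite exprS; exact: flimM.
Qed.

Lemma flim_sum T (G : set_system T) {FG : Filter G} (J : Type) (s : seq J) (u : J -> T -> C) l :
  (forall j, flim G (u j) (l j)) ->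
  flim G (fun t => \sum_(j <- s) u j t) (\sum_(j <- s) l j).
Proof.
move=> h; elim: s => [|j s IH].
  by rewrite big_nil; under eq_fun do rewrite big_nil; exact: flim_cst.
by rewrite big_cons; under eq_fun do rewrite big_cons; exact: flimD.
Qed.

Lemma dquot_lim n s : flim small (dquot n s) (n%:R * s ^+ n.-1).
Proof.
have -> : n%:R * s ^+ n.-1 = \sum_(k < n) (s + 0) ^+ (n.-1 - k) * s ^+ k.
  rewrite (eq_bigr (fun=> s ^+ n.-1)) => [|k _].
    by rewrite sumr_const card_ord mulr_natl.
  by rewrite addr0 -exprD subnK //; case: n k => [[]//|n] k; rewrite -ltnS ltn_ord.
apply: flim_sum => k; apply: flimM; last exact: flim_cst.
apply: flim_exp; apply: flimD; [exact: flim_cst|exact: flim_id0].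
Qed.

Lemma psum_on_asum (r q : R) b F : psum_on r b F -> 0 <= q -> q < r ->
  bsum (fun a => cabs (b a) * \prod_i (q ^+ a i / (a i)`!%:R)).
Proof.
move=> hF q0 qr; have qp : in_polydisc r (fun _ : I => q%:C : C).
  by move=> i; rewrite cabsR ger0_norm.
apply: bsum_le (has_sum_asum (hF _ qp)) => a; rewrite cabsM cabs_prod.
apply: ler_wpM2l; first exact: cabs_ge0.
apply: ler_prod => i _; rewrite cabsM cabsV cabs_natr cabsX cabsR ger0_norm // lexx andbT.
by rewrite divr_ge0 // exprn_ge0.
Qed.

Lemma psum_on_deriv (r : R) b F i : 0 < r -> psum_on r b F ->
  exists F', psum_on r (fun a => b (incr i a)) F' /\
    forall x, in_polydisc r x -> cderiv (fun t => F (upd x i t)) (x i) (F' x).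
Proof.
move=> r0 hF.
suff key x : in_polydisc r x -> exists l,
    has_sum (fun a => b (incr i a) * divmon x a) l /\
    cderiv (fun t => F (upd x i t)) (x i) l.
  have /choice[F' hF'] x : exists l, in_polydisc r x ->
    has_sum (fun a => b (incr i a) * divmon x a) l /\ cderiv (fun t => F (upd x i t)) (x i) l.
    by have [/key[l hl]|n] := pselect (in_polydisc r x); [exists l|exists 0].
  by exists F'; split=> x xr; have [] := hF' x xr.
move=> xr; have [q0 [/andP[q00 q0r] xq0]] := polydisc_radius r0 xr.
(* Room is used twice: increments lead from [q0] up to [q], and [dquot_le] passes from [q] to [p],
   still below [r]. *)
pose q := (q0 + r) / 2; pose p := (q + r) / 2.
have [q0q qp pr] : [/\ q0 < q, q < p & p < r] by rewrite /p /q; split; lra.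
have qge0 : 0 <= q := le_trans q00 (ltW q0q).
have pge0 : 0 <= p := le_trans qge0 (ltW qp).
pose Q a := \prod_(j | j != i) (x j ^+ a j / (a j)`!%:R).
pose D a := cabs (b a) * (\prod_j (p ^+ a j / (a j)`!%:R)) / (p - q).
have hD : bsum D.
  have /(bsumZ (_ : 0 <= (p - q)^-1)) := psum_on_asum hF pge0 pr.
  rewrite invr_ge0 subr_ge0 => /(_ (ltW qp)).
  by apply: bsum_le => a; rewrite /D [leRHS]mulrC.
pose term h a := b a * (dquot (a i) (x i) h / (a i)`!%:R * Q a).
have term_le h a : cabs h <= q - q0 -> cabs (term h a) <= D a.
  move=> hq; rewrite /term /D cabsM -[leRHS]mulrA ler_wpM2l ?cabs_ge0 //.
  rewrite (bigD1 i) //= [leRHS]mulrAC cabsM; apply: ler_pM; rewrite ?cabs_ge0 //.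
    rewrite cabsM cabsV cabs_natr [leRHS]mulrAC ler_wpM2r ?invr_ge0 //.
    apply: dquot_le => //; first by apply: le_trans (xq0 i) (ltW q0q).
    by apply: le_trans (cabsD _ _) _; have := xq0 i; lra.
  rewrite cabs_prod; apply: ler_prod => j _; rewrite cabs_ge0 cabsM cabsV cabs_natr /=.
  rewrite ler_wpM2r ?invr_ge0 // cabsX lerXn2r ?nnegrE ?cabs_ge0 //.
  by apply: le_trans (xq0 j) _; lra.
have q0q' : 0 < q - q0 by rewrite subr_gt0.
have /choice[g hg] h : exists l, cabs h <= q - q0 -> has_sum (term h) l.
  have [hq|n] := pselect (cabs h <= q - q0); last by exists 0.
  have [l hl] : exists l, has_sum (term h) l.
    by apply: asum_has_sum; apply: bsum_le hD => a; exact: term_le.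
  by exists l => _; exact: hl.
pose lim_term a := b a * ((a i)%:R * x i ^+ (a i).-1 / (a i)`!%:R * Q a).
have term_lim a : flim small (term ^~ a) (lim_term a).
  apply: flimM; first exact: flim_cst.
  apply: flimM; last exact: flim_cst.
  by apply: flimM; [exact: dquot_lim|exact: flim_cst].
have [l hl] : exists l, has_sum lim_term l.
  apply: asum_has_sum; apply: bsum_le hD => a.
  apply/ler_addgt0Pr => e e0.
  near (@small R) => h; rewrite -[lim_term a](subKr (term h a)).
  apply: le_trans (cabsB _ _) _; apply: lerD.
    by apply: term_le; apply: ltW; near: h; exact: small_lt.
  by near: h; exact: term_lim.
exists l; split.
  (* Exponents with [a i = 0] drop out of the derivative; the others are reindexed by [incr i]. *)
  have z0 a : (forall a', a <> incr i a') -> lim_term a = 0.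
    move=> na; rewrite /lim_term; have [ai|ai] := posnP (a i).
      by rewrite ai !mul0r mulr0.
    by case: (na (decr i a)); rewrite decrK.
  have := has_sum_reindex (incrK i) z0 hl; apply: eq_has_sum => a /=.
  rewrite /lim_term (divmon_bigD1 _ i) !ffunE eqxx addn1 /=; congr (_ * (_ * _)).
    by rewrite factS natrM invfM mulrACA mulfV ?pnatr_eq0 // mul1r.
  by apply: eq_bigr => j /negPf ji; rewrite !ffunE ji addn0.
apply/cderivP; exists g; split.
  near=> h; have hq : cabs h <= q - q0 by apply: ltW; near: h; exact: small_lt.
  have ur : in_polydisc r (upd x i (x i + h)).
    move=> j; rewrite /upd; case: eqP => // _; apply: le_lt_trans (cabsD _ _) _.
    by have := xq0 i; rewrite /q in hq *; lra.
  rewrite upd_id; apply: has_sum_unique (hF _ ur) _.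
  have := has_sumD (hF _ xr) (has_sumZ (c := h) (hg h hq)); apply: eq_has_sum => a.
  have -> : divmon (upd x i (x i + h)) a = (x i + h) ^+ a i / (a i)`!%:R * Q a.
    rewrite (divmon_bigD1 _ i) upd_eq; congr (_ * _); apply: eq_bigr => j /negPf ji.
    by rewrite /upd ji.
  have -> : (x i + h) ^+ a i = x i ^+ a i + h * dquot (a i) (x i) h.
    by rewrite -dquotE [RHS]addrC subrK.
  by rewrite /term (divmon_bigD1 _ i) -/(Q a); ring.
apply: (@has_sum_dominated _ _ _ _ _ term _ _ _ _ hD _ term_lim _ hl).
  near=> h => a; apply: term_le; apply: ltW; near: h; exact: small_lt.
by near=> h; apply: hg; apply: ltW; near: h; exact: small_lt.
Unshelve. all: by end_near.
Qed.

Lemma near_upd (r : R) x i : in_polydisc r x ->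
  \forall h \near small, in_polydisc r (upd x i (x i + h)).
Proof.
move=> xr; have d0 : 0 < r - cabs (x i) by rewrite subr_gt0.
apply: filterS (small_lt d0) => h hd j; rewrite /upd; case: eqP => // _.
by apply: le_lt_trans (cabsD _ _) _; move: hd; lra.
Qed.

Lemma divmon0 x a : (forall i, x i = 0) -> divmon x a = (a == [ffun=> 0%N])%:R.
Proof.
move=> x0; case: eqP => [->|/eqP na].
  by rewrite /divmon big1 // => i _; rewrite ffunE expr0 divr1.
have [i ai] : exists i, a i != 0%N.
  apply/existsP; apply: contraNT na => /existsPn h; apply/eqP/ffunP => i.
  by rewrite ffunE; apply/eqP; have := h i; rewrite negbK.
by rewrite (divmon_bigD1 _ i) x0 expr0n (negPf ai) mul0r mul0r.
Qed.

Lemma psum_on_at0 (r : R) b F : 0 < r -> psum_on r b F -> F (fun=> 0) = b [ffun=> 0%N].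
Proof.
move=> r0 hF; have p0 : in_polydisc r (fun _ : I => 0 : C) by move=> i; rewrite cabs0.
apply: has_sum_unique (hF _ p0) _.
have -> : b [ffun=> 0%N] = \sum_(a <- [fset [ffun=> 0%N]]%fset) b a * divmon (fun=> 0) a.
  by rewrite big_seq_fset1 divmon0 // eqxx mulr1.
apply: has_sum_finite => a; rewrite inE => /negPf na.
by rewrite divmon0 // na mulr0.
Qed.

(** Differentiation reduces the coefficient at [a] to one of smaller total degree, and the constant
    coefficient is the value at the origin. *)
Lemma psum_on_unique (r : R) b b' F F' : 0 < r -> psum_on r b F -> psum_on r b' F' ->
  (forall x, in_polydisc r x -> F x = F' x) -> b =1 b'.
Proof.
move=> r0 + + + a; have [n] := ubnP (\sum_i a i); elim: n => // n IH in a b b' F F' *.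
move=> an hF hF' FF.
have [[i ai]|na] := pselect (exists i, a i != 0%N); last first.
  have p0 : in_polydisc r (fun _ : I => 0 : C) by move=> i; rewrite cabs0.
  have -> : a = [ffun=> 0%N].
    by apply/ffunP => i; rewrite ffunE; apply/eqP/negPn/negP => ai; apply: na; exists i.
  by rewrite -(psum_on_at0 r0 hF) -(psum_on_at0 r0 hF') FF.
have ai0 : (0 < a i)%N by rewrite lt0n.
have [G [hG dG]] := psum_on_deriv i r0 hF; have [G' [hG' dG']] := psum_on_deriv i r0 hF'.
rewrite -(decrK ai0); apply: (IH _ (fun a => b (incr i a)) (fun a => b' (incr i a)) G G') => //.
  rewrite -ltnS; apply: leq_trans an; rewrite ltnS [X in (_ < X)%N](bigD1 i) //=.
  rewrite (bigD1 i) //= ffunE eqxx subn1 -[X in (_ < X + _)%N](prednK ai0) addSn ltnS leq_add2l.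
  by apply: leq_sum => j _; rewrite ffunE leq_subr.
move=> x xr; apply: cderiv_unique (dG x xr) _; apply: cderiv_ext (dG' x xr).
by apply: filterS (near_upd i xr) => h hr; rewrite FF.
Qed.

End TermwiseDerivative.

(** * The exponential series *)

Section ExpSeries.
Variable R : realType.
Notation C := R[i].

Lemma cabs_expC (z : C) : cabs (expC z) = expR (complex.Re z).
Proof.
rewrite /expC cabsM cabsR ger0_norm ?expR_ge0 // -/(cis (complex.Im z)).
by rewrite cabs_cis mulr1.
Qed.

Lemma has_sum_unit (b : {ffun unit -> nat} -> C) (z l : C) :
  has_sum (fun a => b a * divmon (fun=> z) a) l ->
  has_sum (fun n => b [ffun=> n] * (z ^+ n / n`!%:R)) l.
Proof.
have cK : cancel (fun n : nat => [ffun _ : unit => n]) (fun a => a tt) by move=> n; rewrite ffunE.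
move=> h; have z0 (a : {ffun unit -> nat}) : (forall n, a <> [ffun=> n]) -> b a * divmon (fun=> z) a = 0.
  by move=> /(_ (a tt)) []; apply/ffunP => -[]; rewrite ffunE.
have := has_sum_reindex cK z0 h; apply: eq_has_sum => n /=.
by rewrite /divmon (big_pred1 tt) ?ffunE // => -[].
Qed.

(** The exponential has some power series on each disc. Since it is its own derivative, all its
    divided coefficients equal the first one, its value at 0. *)
Lemma has_sum_expC (z : C) : has_sum (fun n => z ^+ n / n`!%:R) (expC z).
Proof.
pose F (x : unit -> C) := expC (x tt); pose r := cabs z + 1.
have r0 : 0 < r by rewrite ltr_wpDl ?cabs_ge0.
have zr : in_polydisc r (fun _ : unit => z) by move=> i; rewrite /r ltrDl.
have Fd x i : cderiv (fun t => F (upd x i t)) (x i) (F x).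
  by rewrite /F; case: i; under eq_fun do rewrite upd_eq; exact: cderiv_expC.
have /pseries_psum_on[b [_ hb]] : pseries r (expR r) F.
  apply: cauchy_pseries => //.
    by move=> x _ i; exists (F x); exact: Fd.
  move=> x xr; rewrite cabs_expC ler_expR; apply: le_trans (ler_norm _) _.
  by apply: le_trans (cabs_Re _) (xr tt).
have b0 : b [ffun=> 0%N] = 1 by rewrite -(psum_on_at0 r0 hb) /F expC0.
have bS a : b (incr tt a) = b a.
  have [F' [hF' dF']] := psum_on_deriv tt r0 hb.
  apply: (psum_on_unique r0 hF' hb) => x xr.
  exact: cderiv_unique (dF' x xr) (Fd x tt).
have b1 n : b [ffun=> n] = 1.
  elim: n => [//|n IH]; rewrite -IH -(bS [ffun=> n]); congr b; apply/ffunP => -[].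
  by rewrite !ffunE addn1.
have := has_sum_unit (hb _ zr); apply: eq_has_sum => n.
by rewrite b1 mul1r.
Qed.

End ExpSeries.

(** * The generating function and the basis *)

Section GeneratingFunction.
Variable R : realType.
Notation C := R[i].
Variable n : nat.
Implicit Types (s : multi n) (Z U : 'rV[C]_n) (W : 'M[C]_n).

(* Monomials in the overcomplete coordinates x_(j,k), for all ordered pairs
   (j, k), and x_j: they stand for W_(jk) = x_(j,k) + x_(k,j) and a multiple of
   z_j, so that the exponent of the generating function becomes the sum of the
   x_(j,k) U_j U_k and the x_j U_j. *)
Definition coord_index : finType := ('I_n * 'I_n + 'I_n)%type.
Implicit Types (x : coord_index -> C) (a : {ffun coord_index -> nat}).

(** The exponent of [U_j] in the monomial attached to the coordinate [i]: of degree two for a pair,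
    one for a single index. *)
Definition wtf (i : coord_index) (j : 'I_n) : nat :=
  match i with inl jk => (jk.1 == j) + (jk.2 == j) | inr k => k == j end.

Definition wt a : multi n := [ffun j => (\sum_i a i * wtf i j)%N].

Lemma wtf_gt0 i : exists j, (0 < wtf i j)%N.
Proof. by case: i => [[j k]|j]; exists j; rewrite /= eqxx. Qed.

Lemma leq_mdeg_wt a i : (a i <= mdeg (wt a))%N.
Proof.
have [j ij] := wtf_gt0 i; rewrite /mdeg (bigD1 j) //= ffunE (bigD1 i) //= -addnA.
by apply: leq_trans (leq_addr _ _); rewrite leq_pmulr.
Qed.

Lemma wt_fiber s : exists A : {fset {ffun coord_index -> nat}}, forall a, (a \in A) = (wt a == s).
Proof.
pose conv (a : {ffun coord_index -> 'I_(mdeg s).+1}) : {ffun coord_index -> nat} := [ffun i => val (a i)].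
exists (seq_fset tt [seq a <- [seq conv c | c <- enum {: {ffun coord_index -> 'I_(mdeg s).+1}}] | wt a == s]) => a.
rewrite seq_fsetE mem_filter andb_idr // => /eqP ws; apply/mapP.
have h i : (a i < (mdeg s).+1)%N by rewrite -ws ltnS leq_mdeg_wt.
exists [ffun i => Ordinal (h i)]; first by rewrite mem_enum.
by apply/ffunP => i; rewrite !ffunE.
Qed.

Definition fib s : {fset {ffun coord_index -> nat}} := projT1 (cid (wt_fiber s)).

Lemma mem_fib a s : (a \in fib s) = (wt a == s).
Proof. by rewrite /fib; case: (cid _) => A /= ->. Qed.

(** The coefficient of [U ^ s] in the product of the exponentials of all coordinates, that is
    [P_s / s!] in these coordinates. *)
Definition genp s x : C := \sum_(a <- fib s) divmon x a.

Lemma psum_on_genp (r : R) s : psum_on r (fun a => (wt a == s)%:R) (genp s).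
Proof.
move=> x _; have -> : genp s x = \sum_(a <- fib s) (wt a == s)%:R * divmon x a.
  by rewrite /genp !big_seq; apply: eq_bigr => a; rewrite mem_fib => ->; rewrite mul1r.
by apply: has_sum_finite => a; rewrite mem_fib => /negPf ->; rewrite mul0r.
Qed.

Lemma genp_conj s x : genp s (fun i => Num.conj (x i)) = Num.conj (genp s x).
Proof.
rewrite /genp rmorph_sum; apply: eq_bigr => a _; rewrite /divmon rmorph_prod.
by apply: eq_bigr => i _; rewrite rmorphM rmorphXn fmorphV rmorph_nat.
Qed.

Lemma expC_sum (I : Type) (r : seq I) (F : I -> C) :
  expC (\sum_(i <- r) F i) = \prod_(i <- r) expC (F i).
Proof. by elim/big_rec2: _ => [|i y z _ h]; rewrite ?expC0 // expCD h. Qed.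

Definition quad U x : C := \sum_i x i * \prod_j U 0 j ^+ wtf i j.

Lemma mpow_wt U a : mpow U (wt a) = \prod_i (\prod_j U 0 j ^+ wtf i j) ^+ a i.
Proof.
rewrite /mpow; under eq_bigr do rewrite ffunE expr_sum.
rewrite exchange_big; apply: eq_bigr => i _ /=; rewrite -prodrXl.
by apply: eq_bigr => j _; rewrite mulnC exprM.
Qed.

Lemma genp_generating U x : has_sum (fun s => mpow U s * genp s x) (expC (quad U x)).
Proof.
rewrite /quad expC_sum.
have h1 := @has_sum_prod _ _ (fun i k => (x i * \prod_j U 0 j ^+ wtf i j) ^+ k / k`!%:R)
  (fun i => expC (x i * \prod_j U 0 j ^+ wtf i j)) (fun i => @has_sum_expC _ _).
have := has_sum_group (fun a s => mem_fib a s) h1; apply: eq_has_sum => s.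
rewrite /genp mulr_sumr !big_seq; apply: eq_bigr => a; rewrite mem_fib => /eqP <-.
rewrite mpow_wt /divmon -big_split /=; apply: eq_bigr => i _.
by rewrite exprMn mulrCA mulrA.
Qed.

(** Halving shares [W j k] between the two ordered pairs and yields the factor one half of the
    quadratic term. *)
Definition zcoord Z W : coord_index -> C :=
  fun i => match i with inl jk => W jk.1 jk.2 / 2 | inr j => Z 0 j end.

Lemma quad_zcoord U Z W :
  quad U (zcoord Z W) = (U *m Z^T) 0 0 + 2^-1 * (U *m W *m U^T) 0 0.
Proof.
have dl (j : 'I_n) (P : 'I_n -> nat) : \prod_k U 0 k ^+ (j == k) = U 0 j.
  rewrite (bigD1 j) //= eqxx expr1 big1 ?mulr1 // => k /negPf kj.
  by rewrite eq_sym kj expr0.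
rewrite /quad big_sumType /= addrC; congr (_ + _).
  by rewrite mxE; apply: eq_bigr => j _; rewrite dl // mxE mulrC.
rewrite [in RHS]mxE mulr_sumr -(pair_bigA _ (fun j k => W j k / 2 * \prod_i U 0 i ^+ ((j == i) + (k == i)))) /=.
rewrite exchange_big; apply: eq_bigr => k _ /=; rewrite !mxE mulr_suml mulr_sumr.
apply: eq_bigr => j _; under eq_bigr do rewrite exprD; rewrite big_split /= !dl //.
by ring.
Qed.

Lemma mpow_divmon U s : mpow U s / (mfact s)%:R = divmon (fun i => U 0 i) s.
Proof.
rewrite /mpow /mfact /divmon natr_prod -prodfV -big_split; exact: eq_bigr.
Qed.

Lemma coef_unique (c c' : multi n -> C) (F : 'rV[C]_n -> C) :
  (forall U, has_sum (fun s => c s * divmon (fun i => U 0 i) s) (F U)) ->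
  (forall U, has_sum (fun s => c' s * divmon (fun i => U 0 i) s) (F U)) -> c = c'.
Proof.
move=> h h'; apply/funext.
have k (d : multi n -> C) : (forall U, has_sum (fun s => d s * divmon (fun i => U 0 i) s) (F U)) ->
    psum_on 1 d (fun y => F (\row_i y i)).
  move=> hd y _; have := hd (\row_i y i); apply: eq_has_sum => s.
  by congr (_ * divmon _ _); apply/funext => i; rewrite mxE.
exact: (psum_on_unique ltr01 (k _ h) (k _ h') (fun _ _ => erefl)).
Qed.

Lemma Pcoef_eq Z W (c : multi n -> C) :
  (forall U, has_sum (fun s => mpow U s / (mfact s)%:R * c s) (Pgen Z W U)) ->
  Pcoef Z W = c.
Proof.
have cv (d : multi n -> C) :
    (forall U, has_sum (fun s => mpow U s / (mfact s)%:R * d s) (Pgen Z W U)) ->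
    forall U, has_sum (fun s => d s * divmon (fun i => U 0 i) s) (Pgen Z W U).
  by move=> h U; have := h U; apply: eq_has_sum => s; rewrite mpow_divmon mulrC.
move=> hc; apply: (@coef_unique _ _ (Pgen Z W)); apply: cv => //.
rewrite /Pcoef; case: xgetP => [d _ //|]; by move=> /(_ c) [].
Qed.

Lemma mfact_neq0 s : (mfact s)%:R != 0 :> C.
Proof. by rewrite pnatr_eq0 -lt0n prodn_gt0 // => i; rewrite fact_gt0. Qed.

Lemma Ppoly_genp s Z W : Ppoly s Z W = (mfact s)%:R * genp s (zcoord Z W).
Proof.
rewrite /Ppoly (@Pcoef_eq _ _ (fun s => (mfact s)%:R * genp s (zcoord Z W))) // => U.
rewrite /Pgen -quad_zcoord; have := @genp_generating U (zcoord Z W).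
apply: eq_has_sum => t.
by rewrite mulrA divfK // mfact_neq0.
Qed.

Lemma genp_W0 s Z : genp s (zcoord Z 0) = divmon (fun i => Z 0 i) s.
Proof.
apply: (mulfI (mfact_neq0 s)); rewrite -Ppoly_genp.
rewrite /Ppoly (@Pcoef_eq _ _ (fun s => (mfact s)%:R * divmon (fun i => Z 0 i) s)) // => U.
rewrite /Pgen mulmx0 mul0mx [X in _ * X]mxE mulr0 addr0 mxE expC_sum.
have := @has_sum_prod _ _ (fun i k => (U 0 i * Z^T i 0) ^+ k / k`!%:R)
  (fun i => expC (U 0 i * Z^T i 0)) (fun i => @has_sum_expC _ _).
apply: eq_has_sum => t; rewrite mulrA divfK ?mfact_neq0 // /mpow /divmon -big_split /=.
by apply: eq_bigr => i _; rewrite mxE exprMn mulrA.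
Qed.

Section Basis.
Variable m : R.
Hypothesis m_gt0 : 0 < m.

(** The factor that scales [z]; its square is the constant [8 * pi * m] of the differential
    equations. *)
Definition kappa : R := 2 * Num.sqrt (2 * pi * m).

Lemma kappaE : kappa = Num.sqrt (8 * pi * m).
Proof.
have -> : 8 * pi * m = 2 ^+ 2 * (2 * pi * m) by ring.
by rewrite sqrtrM ?exprn_ge0 // sqrtr_sqr ger0_norm.
Qed.

Lemma kappa2 : kappa ^+ 2 = 8 * pi * m.
Proof. by rewrite kappaE sqr_sqrtr // !mulr_ge0 // ?pi_ge0 // ltW. Qed.

Lemma kappa_gt0 : 0 < kappa.
Proof. by rewrite mulr_gt0 // sqrtr_gt0 !mulr_gt0 // pi_gt0. Qed.

Definition sjcoord (p : sjpoint R n) : coord_index -> C := zcoord (kappa%:C *: p.2) p.1.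

Lemma sqrt_mfact_neq0 s : sqrt_mfact R s != 0.
Proof.
rewrite /sqrt_mfact -cabs_gt0 cabsR normr_gt0 gt_eqF // sqrtr_gt0 ltr0n.
by rewrite prodn_gt0 // => i; rewrite fact_gt0.
Qed.

Lemma fsE s p : fs m s p = sqrt_mfact R s * genp s (sjcoord p).
Proof.
rewrite /fs Ppoly_genp mulrA; congr (_ * _).
apply: (mulfI (sqrt_mfact_neq0 s)); rewrite mulrA mulfV ?sqrt_mfact_neq0 // mul1r.
by rewrite /sqrt_mfact -rmorphM /= -expr2 sqr_sqrtr // rmorph_nat.
Qed.

Lemma generating_function U W z :
  has_sum (fun s => mpow U s / sqrt_mfact R s * fs m s (W, z))
    (expC ((Num.sqrt (8 * pi * m))%:C * (U *m z^T) 0 0 + 2^-1 * (U *m W *m U^T) 0 0)).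
Proof.
have := @genp_generating U (sjcoord (W, z)); rewrite quad_zcoord /= -kappaE.
rewrite linearZ /= -scalemxAr [X in expC (X + _)]mxE.
by apply: eq_has_sum => s; rewrite fsE mulrA divfK // sqrt_mfact_neq0.
Qed.

Lemma fs_W0 s z : fs m s (0, z) = sqrt_mfact R s * kappa%:C ^+ mdeg s * divmon (fun i => z 0 i) s.
Proof.
rewrite fsE /sjcoord /= genp_W0 -mulrA; congr (_ * _).
rewrite /divmon /mdeg expr_sum -big_split /=; apply: eq_bigr => i _.
by rewrite mxE exprMn mulrA.
Qed.

(** On the slice [W = 0] each [fs s] is a nonzero multiple of a monomial, so uniqueness is that of
    power series in [z]. *)
Lemma fs_coef_unique (c c' : multi n -> C) (f : 'rV[C]_n -> C) :
  (forall z, has_sum (fun s => c s * fs m s (0, z)) (f z)) ->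
  (forall z, has_sum (fun s => c' s * fs m s (0, z)) (f z)) -> c = c'.
Proof.
move=> h h'; pose w s := sqrt_mfact R s * kappa%:C ^+ mdeg s.
have w0 s : w s != 0.
  rewrite mulf_neq0 ?sqrt_mfact_neq0 // expf_neq0 // -cabs_gt0 cabsR normr_gt0.
  by rewrite gt_eqF // kappa_gt0.
have : (fun s => c s * w s) = (fun s => c' s * w s).
  apply: (@coef_unique _ _ f) => z; [have := h z|have := h' z];
  by apply: eq_has_sum => s; rewrite fs_W0 mulrA.
by move=> e; apply/funext => s; apply: (mulIf (w0 s)); exact: (congr1 (@^~ s) e).
Qed.

End Basis.
End GeneratingFunction.

(** * The Siegel disk as a set of strict contractions *)

Section SiegelTopology.
Variable R : realType.
Notation C := R[i].
Variable n : nat.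
Implicit Types (x u v : 'rV[C]_n) (W A : 'M[C]_n) (p q : sjpoint R n).

Lemma conj_realC (r : R) : Num.conj (r%:C : C) = r%:C.
Proof. by apply: conj_Creal; apply/complex_realP; exists r. Qed.

Definition nsq x : R := \sum_i cabs (x 0 i) ^+ 2.

Lemma nsq_ge0 x : 0 <= nsq x.
Proof. by apply: sumr_ge0 => i _; rewrite exprn_ge0 ?cabs_ge0. Qed.

Lemma nsq_gt0 x : x != 0 -> 0 < nsq x.
Proof.
move=> x0; rewrite lt_def nsq_ge0 andbT; apply: contra x0.
rewrite psumr_eq0 => [/allP h|i _]; last by rewrite exprn_ge0 ?cabs_ge0.
apply/eqP/rowP => i; rewrite mxE; apply/eqP; rewrite -cabs_eq0 -[_ == _]/(_ == _).
by have := h i (mem_index_enum i); rewrite /= expf_eq0.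
Qed.

Lemma nsqE x : (x *m (conjmat x)^T) 0 0 = (nsq x)%:C.
Proof.
rewrite mxE rmorph_sum; apply: eq_bigr => i _.
by rewrite /conjmat !mxE -normCK normE -rmorphXn.
Qed.

Lemma nsqZ (c : C) x : nsq (c *: x) = cabs c ^+ 2 * nsq x.
Proof. by rewrite /nsq mulr_sumr; apply: eq_bigr => i _; rewrite mxE cabsM exprMn. Qed.

Lemma cabs_le_nsq x i : cabs (x 0 i) ^+ 2 <= nsq x.
Proof.
rewrite /nsq (bigD1 i) //= lerDl; apply: sumr_ge0 => j _.
by rewrite exprn_ge0 ?cabs_ge0.
Qed.

Lemma nsq_mulmx_le x A : nsq (x *m A) <= (\sum_j (\sum_i cabs (A i j)) ^+ 2) * nsq x.
Proof.
rewrite /nsq mulr_suml; apply: ler_sum => j _; rewrite mxE.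
have h0 : 0 <= \sum_i cabs (A i j) by apply: sumr_ge0 => i _; exact: cabs_ge0.
apply: (@le_trans _ _ ((Num.sqrt (nsq x) * \sum_i cabs (A i j)) ^+ 2)).
  rewrite lerXn2r ?nnegrE ?cabs_ge0 ?mulr_ge0 ?sqrtr_ge0 //.
  apply: le_trans (cabs_sum _ _ _) _; rewrite mulr_sumr; apply: ler_sum => i _.
  rewrite cabsM ler_wpM2r ?cabs_ge0 // -[leLHS]ger0_norm ?cabs_ge0 // -sqrtr_sqr.
  by rewrite ler_wsqrtr // cabs_le_nsq.
by rewrite exprMn sqr_sqrtr ?nsq_ge0 // mulrC.
Qed.

(** From [2 a b <= e a^2 + b^2 / e]; the coefficient of [nsq u] can be kept close to 1, as a
    perturbation argument requires. *)
Lemma nsqD_le (e : R) u v : 0 < e -> nsq (u + v) <= (1 + e) * nsq u + (1 + e^-1) * nsq v.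
Proof.
move=> e0; rewrite /nsq !mulr_sumr -big_split /=; apply: ler_sum => i _; rewrite mxE.
have a0 := cabs_ge0 (u 0 i); have b0 := cabs_ge0 (v 0 i).
have := cabsD (u 0 i) (v 0 i); have := cabs_ge0 (u 0 i + v 0 i).
move: (cabs _) (cabs (u 0 i)) (cabs (v 0 i)) a0 b0 => c a b a0 b0 c0 cab.
apply: (@le_trans _ _ ((a + b) ^+ 2)).
  by rewrite lerXn2r ?nnegrE // addr_ge0.
rewrite -subr_ge0; have -> : (1 + e) * a ^+ 2 + (1 + e^-1) * b ^+ 2 - (a + b) ^+ 2 = (e * a - b) ^+ 2 / e.
  by field; rewrite gt_eqF.
by rewrite divr_ge0 ?sqr_ge0 // ltW.
Qed.

Lemma conjmatM a b c (M : 'M[C]_(a, b)) (N : 'M[C]_(b, c)) :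
  conjmat (M *m N) = conjmat M *m conjmat N.
Proof. exact: map_mxM. Qed.

Lemma conjmat_tr a b (M : 'M[C]_(a, b)) : conjmat M^T = (conjmat M)^T.
Proof. by apply/matrixP => i j; rewrite !mxE. Qed.

Lemma conjmatK a b (M : 'M[C]_(a, b)) : conjmat (conjmat M) = M.
Proof. by apply/matrixP => i j; rewrite !mxE conjCK. Qed.

Lemma siegel_form x W : W^T = W ->
  (x *m (1%:M - W *m conjmat W) *m (conjmat x)^T) 0 0 = (nsq x - nsq (x *m W))%:C.
Proof.
move=> Ws; rewrite rmorphB /= -!nsqE mulmxBr mulmx1 mulmxBl [LHS]mxE [X in _ + X = _]mxE.
congr (_ - _); rewrite conjmatM trmx_mul.
have -> : (conjmat W)^T = conjmat W by rewrite -conjmat_tr Ws.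
by rewrite !mulmxA.
Qed.

Lemma form_expand x y (x' y' : 'cV[C]_n) (M : 'M[C]_n) (t : C) :
  ((x - t *: y) *m M *m (x' - t *: y')) 0 0 = (x *m M *m x') 0 0
    - t * (x *m M *m y') 0 0 - t * (y *m M *m x') 0 0 + t ^+ 2 * (y *m M *m y') 0 0.
Proof.
have E (P Q : 'M[C]_1) : (P - Q) 0 0 = P 0 0 - Q 0 0 by rewrite !mxE.
have F (P : 'M[C]_1) (s : C) : (s *: P) 0 0 = s * P 0 0 by rewrite mxE.
rewrite !mulmxBl !mulmxBr; do !rewrite -?scalemxAl -?scalemxAr; rewrite !(E, F); ring.
Qed.

Lemma siegelP W : siegel_disk W <-> W^T = W /\ forall x, x != 0 -> nsq (x *m W) < nsq x.
Proof.
split=> -[Ws h]; split=> // x /h; first by rewrite siegel_form // ltcR subr_gt0.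
by rewrite siegel_form // ltcR subr_gt0.
Qed.

Lemma siegel_le W x : siegel_disk W -> nsq (x *m W) <= nsq x.
Proof.
move=> /siegelP[_ h]; have [->|/h/ltW//] := eqVneq x 0.
by rewrite mul0mx.
Qed.

Lemma siegel_unit W : siegel_disk W -> 1%:M - W *m conjmat W \in unitmx.
Proof.
move=> [Ws h]; rewrite -row_free_unit -kermx_eq0; apply/negPn/negP => /rowV0Pn[v /sub_kermxP vM v0].
by have := h v v0; rewrite vM mul0mx mxE ltxx.
Qed.

(* Cauchy-Schwarz for the form of M = 1 - W conj W, applied to x and x M^-1. *)
Lemma siegel_bound W : siegel_disk W ->
  exists q : R, [/\ 0 <= q, q < 1 & forall x, nsq (x *m W) <= q * nsq x].
Proof.
move=> DW; have [Ws _] := DW; set M := 1%:M - W *m conjmat W.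
have uM := siegel_unit DW; rewrite -/M in uM.
pose c := 1 + \sum_j (\sum_i cabs (invmx M i j)) ^+ 2.
have c1 : 1 <= c.
  rewrite lerDl; apply: sumr_ge0 => j _; rewrite exprn_ge0 //.
  by apply: sumr_ge0 => i _; exact: cabs_ge0.
have c0 : 0 < c := lt_le_trans ltr01 c1.
have form_conj u v : (v *m M *m (conjmat u)^T) 0 0 = Num.conj ((u *m M *m (conjmat v)^T) 0 0).
  have MH : (conjmat M)^T = M.
    rewrite -conjmat_tr /M linearB /= trmx1 trmx_mul -conjmat_tr Ws.
    by rewrite /conjmat map_mxB map_mx1 map_mxM -!/(conjmat _) conjmatK.
  transitivity ((conjmat (u *m M *m (conjmat v)^T))^T 0 0); last by rewrite !mxE.
  by rewrite !conjmatM !trmx_mul MH conjmat_tr conjmatK trmxK mulmxA.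
exists (1 - c^-1); split; first by rewrite subr_ge0 invf_le1.
  by rewrite gtrBl invr_gt0.
move=> x; pose y := x *m invmx M.
have yM : y *m M = x by rewrite /y mulmxKV.
pose t : C := (c^-1)%:C.
have hy : nsq y - nsq (y *m W) <= c * nsq x.
  apply: le_trans (_ : nsq y <= _); first by rewrite gerBl nsq_ge0.
  by apply: le_trans (nsq_mulmx_le _ _) _; rewrite ler_wpM2r ?nsq_ge0 // lerDr.
have hxy : nsq (x - t *: y) - nsq ((x - t *: y) *m W) =
    nsq x - nsq (x *m W) - 2 * c^-1 * nsq x + c^-1 ^+ 2 * (nsq y - nsq (y *m W)).
  have E0 (X Y z : R) : (X - 2 * c^-1 * z + c^-1 ^+ 2 * Y)%:C = X%:C - 2 * t * z%:C + t ^+ 2 * Y%:C.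
    by rewrite !expr2 rmorphD rmorphB !rmorphM /= rmorph_nat.
  apply: (@complexI R); rewrite E0 -!siegel_form // -/M -nsqE.
  have -> : (conjmat (x - t *: y))^T = (conjmat x)^T - t *: (conjmat y)^T.
    rewrite /conjmat map_mxB map_mxZ linearB linearZ /=; congr (_ - _ *: _).
    exact: conj_realC.
  have xMy : (x *m M *m (conjmat y)^T) 0 0 = (x *m (conjmat x)^T) 0 0.
    by rewrite form_conj yM nsqE conj_realC.
  by rewrite form_expand yM xMy; ring.
have h0 : 0 <= nsq (x - t *: y) - nsq ((x - t *: y) *m W) by rewrite subr_ge0 siegel_le.
have h1 : c^-1 ^+ 2 * (nsq y - nsq (y *m W)) <= c^-1 * nsq x.
  rewrite expr2 -mulrA ler_pM2l ?invr_gt0 // ler_pdivrMl //.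
move: h0; rewrite hxy mulrBl mul1r; lra.
Qed.

Lemma siegel_open W : siegel_disk W -> exists2 d : R, 0 < d & forall V, V^T = V ->
  (forall i j, cabs (V i j - W i j) <= d) -> siegel_disk V.
Proof.
move=> /siegel_bound[q [q0 q1 hq]].
(* Half of the gap [1 - q] is spent on the factor [1 + e] in front of [q], the other half bounds
   [K * d ^+ 2]. *)
pose e := (1 - q) / 2; have e0 : 0 < e by rewrite divr_gt0 // subr_gt0.
pose K : R := (1 + e^-1) * (n%:R * (n%:R) ^+ 2).
have K0 : 0 <= K by rewrite !mulr_ge0 // addr_ge0 // invr_ge0 ltW.
pose d := Num.min 1 (e / (K + 1)) / 2.
have m0 : 0 < Num.min 1 (e / (K + 1)) by rewrite lt_min ltr01 divr_gt0 // ltr_wpDl.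
have d0 : 0 < d by rewrite divr_gt0.
have dm : d < Num.min 1 (e / (K + 1)) by rewrite gtr_pMr // invf_lt1 // ltr1n.
move: dm; rewrite lt_min => /andP[d1 d2].
have Kd : K * d ^+ 2 < e.
  apply: le_lt_trans (_ : (K + 1) * d < e); last by rewrite mulrC -ltr_pdivlMr // ltr_wpDl.
  rewrite expr2 mulrA ler_wpM2r ?(ltW d0) //; apply: le_trans (_ : K <= _); last by rewrite lerDl.
  by rewrite ler_piMr // ltW.
exists d => // V Vs VW; apply/siegelP; split=> // x x0.
have -> : x *m V = x *m W + x *m (V - W) by rewrite mulmxBr addrC subrK.
apply: le_lt_trans (nsqD_le _ _ e0) _.
have hV : nsq (x *m (V - W)) <= n%:R * (n%:R * d) ^+ 2 * nsq x.
  apply: le_trans (nsq_mulmx_le _ _) _; rewrite ler_wpM2r ?nsq_ge0 //.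
  rewrite [leRHS](_ : _ = \sum_(j < n) (n%:R * d) ^+ 2); last by rewrite sumr_const card_ord mulr_natl.
  apply: ler_sum => j _; rewrite lerXn2r ?nnegrE //.
  - by apply: sumr_ge0 => i _; exact: cabs_ge0.
  - by rewrite mulr_ge0 // ltW.
  rewrite [leRHS](_ : _ = \sum_(i < n) d); last by rewrite sumr_const card_ord mulr_natl.
  by apply: ler_sum => i _; rewrite !mxE.
have e1 : 0 < 1 + e by rewrite addr_gt0.
have e2 : 0 < 1 + e^-1 by rewrite addr_gt0 ?invr_gt0.
apply: le_lt_trans (lerD (ler_wpM2l (ltW e1) (hq x)) (ler_wpM2l (ltW e2) hV)) _.
have nx := nsq_gt0 x0.
rewrite exprMn mulrA [X in _ + X](_ : _ = K * d ^+ 2 * nsq x); last by rewrite /K; ring.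
rewrite mulrA -mulrDl gtr_pMl //.
have : q * e <= e by rewrite ler_piMl // ltW.
by rewrite mulrDl mul1r (mulrC e) /e in Kd *; lra.
Qed.

Lemma siegel0 : siegel_disk (0 : 'M[C]_n).
Proof.
apply/siegelP; split; first exact: trmx0.
move=> x x0; rewrite mulmx0; apply: le_lt_trans (nsq_gt0 x0).
by rewrite /nsq big1 // => i _; rewrite mxE cabs0 expr0n.
Qed.

Lemma siegel_scale (t : C) W : cabs t <= 1 -> siegel_disk W -> siegel_disk (t *: W).
Proof.
move=> t1 DW; have [Ws h] := (siegelP W).1 DW; apply/siegelP; split=> [|x /h].
  by rewrite linearZ /= Ws.
rewrite -scalemxAr nsqZ; apply: le_lt_trans.
by rewrite ler_piMl ?nsq_ge0 // exprn_ile1 // cabs_ge0.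
Qed.

Lemma sj_nbhsP p (B : set (sjpoint R n)) : nbhs p B -> exists2 d : R, 0 < d &
  forall q, (forall i j, cabs (q.1 i j - p.1 i j) <= d) ->
    (forall j, cabs (q.2 0 j - p.2 0 j) <= d) -> B q.
Proof.
move=> /nbhs_ballP[e /= e0 he].
have ee : e = (complex.Re e)%:C by rewrite RRe_real ?gtr0_real.
have e0' : 0 < complex.Re e by rewrite -ltcR -ee.
exists (complex.Re e / 2); first by rewrite divr_gt0.
move=> q h1 h2; apply: he.
have lt (z w : C) : cabs (w - z) <= complex.Re e / 2 -> `|z - w| < e.
  move=> h; rewrite ee cabs_lt cabs_distC; apply: le_lt_trans h _.
  by rewrite gtr_pMr // invf_lt1 // ltr1n.
split; split=> // i j; first exact: lt.
by rewrite /ball /= ord1; exact: lt.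
Qed.

Lemma sj_nbhs_close p (d : R) : 0 < d -> nbhs p [set q : sjpoint R n |
  (forall i j, cabs (q.1 i j - p.1 i j) <= d) /\ (forall j, cabs (q.2 0 j - p.2 0 j) <= d)].
Proof.
move=> d0; have d0' : (0 : C) < d%:C by rewrite ltcR.
have := nbhsx_ballx p _ d0'; apply: filterS => q [[_ h1] [_ h2]].
have lt (z w : C) : `|z - w| < d%:C -> cabs (w - z) <= d.
  by rewrite cabs_lt cabs_distC => /ltW.
by split=> [i j|j]; apply: lt; [exact: h1|exact: h2].
Qed.

Lemma symU_id W : W^T = W -> symU W = W.
Proof.
by move=> Ws; apply/matrixP => i j; rewrite mxE; case: ifP => // _; rewrite -{1}Ws mxE.
Qed.

Lemma symU_sym W : (symU W)^T = symU W.
Proof.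
apply/matrixP => i j; rewrite !mxE; case: (ltngtP i j) => // ij.
by have -> : i = j by apply: val_inj.
Qed.

Lemma in_coords_id (f : sjpoint R n -> C) p : p.1^T = p.1 -> in_coords f p = f p.
Proof. by case: p => W z /= Ws; rewrite /in_coords symU_id. Qed.

Lemma siegel_sym p : siegel_jacobi_disk p -> p.1^T = p.1.
Proof. by move=> [[]]. Qed.

(** Neighborhoods are those of the full matrix space and contain non-symmetric matrices, which lie
    outside the disk; hence the restriction on [q]. *)
Lemma holo_near (f : sjpoint R n -> C) p : holomorphic f -> siegel_jacobi_disk p ->
  nbhs p [set q : sjpoint R n | q.1^T = q.1 -> siegel_jacobi_disk q /\ cabs (f q) <= cabs (f p) + 1].
Proof.
move=> hf Dp; have [d d0 hd] := siegel_open Dp.1.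
have /differentiable_continuous/cvgrPdist_le/(_ 1 ltr01) := hf p Dp.
rewrite in_coords_id ?siegel_sym // => near1.
apply: filterS2 near1 (sj_nbhs_close p d0) => q /= h1 [h2 _] qs.
split; first by split=> //; exact: hd.
move: h1; rewrite in_coords_id // normE -(rmorph1 (real_complex R)) lecR => h1.
rewrite -[f q](subKr (f p)); apply: le_trans (cabsB _ _) _.
by rewrite lerD2l.
Qed.

(** [W] has weight 2 and [z] weight 1, so that [fs s] is homogeneous of degree [mdeg s] along these
    curves. *)
Definition dil (t : C) p : sjpoint R n := (t ^+ 2 *: p.1, t *: p.2).

Lemma dil_sym t p : p.1^T = p.1 -> (dil t p).1^T = (dil t p).1.
Proof. by move=> ps; rewrite /= linearZ /= ps. Qed.

Lemma dil_disk t p : cabs t <= 1 -> siegel_jacobi_disk p -> siegel_jacobi_disk (dil t p).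
Proof.
move=> t1 [Dp _]; split; last exact: I.
by apply: (siegel_scale _ Dp); rewrite cabsX exprn_ile1 // cabs_ge0.
Qed.

Lemma dil_continuous (tp : C * sjpoint R n) :
  {for tp, continuous (fun tp : C * sjpoint R n => dil tp.1 tp.2)}.
Proof.
case: tp => t [W z]; apply: (@cvg_pair _ _ _ _ (nbhs (t ^+ 2 *: W)) (nbhs (t *: z))) => /=.
  apply: cvgZ; last by apply: cvg_comp; [exact: cvg_snd|exact: cvg_fst].
  by rewrite expr2; under eq_fun do rewrite expr2; apply: cvgM; exact: cvg_fst.
by apply: cvgZ; [exact: cvg_fst|apply: cvg_comp; [exact: cvg_snd|exact: cvg_snd]].
Qed.

End SiegelTopology.

(** * Dilations of compact sets and local coordinates *)

Section Charts.
Variable R : realType.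
Notation C := R[i].
Variable n : nat.
Implicit Types (p q : sjpoint R n) (f : sjpoint R n -> C).

Lemma near_real_close (a0 d : R) : 0 < d -> nbhs a0 [set a | `|a - a0| < d].
Proof.
move=> d0; apply: filterS (nbhsx_ballx a0 d d0) => a.
by rewrite /ball /= distrC.
Qed.

(** The margin beyond the unit circle is the source of a geometric rate at [t = 1]: on the disc of
    radius [1 + d], Cauchy's estimate bounds the part of degree [N] by a multiple of
    [(1 + d) ^- N]. *)
Lemma dil_bounded f (K : set (sjpoint R n)) : holomorphic f -> compact K ->
  K `<=` @siegel_jacobi_disk R n -> exists2 d : R, 0 < d & forall p t, K p -> cabs t <= 1 + d ->
    siegel_jacobi_disk (dil t p) /\ cabs (f (dil t p)) <= d^-1.
Proof.
move=> hf cK KD.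
pose P (d : R) (x : sjpoint R n * (R * R)) := x.1.1^T = x.1.1 ->
  forall t, cabs (t - (x.2.1 +i* x.2.2)) <= d -> cabs t <= 1 + d ->
  siegel_jacobi_disk (dil t x.1) /\ cabs (f (dil t x.1)) <= d^-1.
(* Base multipliers run over the compact square that contains the closed unit disc. *)
pose I1 : set R := `[-1, 1]%classic.
have cX : compact (K `*` (I1 `*` I1)).
  by apply: compact_setX => //; apply: compact_setX; exact: segment_compact.
have : \forall d \near (0 : R)^'+, (K `*` (I1 `*` I1)) `<=` P d.
  apply: (compact_near_coveringP _).1 => // -[p0 [a0 b0]] [/= Kp0 _].
  pose t0 : C := a0 +i* b0.
  have close (d : R) : 0 < d -> exists2 V, nbhs (p0, (a0, b0)) V & forall p a b, V (p, (a, b)) ->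
      cabs ((a +i* b) - t0) < d.
    move=> d0; have d2 : 0 < d / 2 by rewrite divr_gt0.
    exists [set x : sjpoint R n * (R * R) | `|x.2.1 - a0| < d / 2 /\ `|x.2.2 - b0| < d / 2].
      exists (setT, [set ab : R * R | `|ab.1 - a0| < d / 2 /\ `|ab.2 - b0| < d / 2]).
        split => /=; first exact: filterT.
        exists ([set a | `|a - a0| < d / 2], [set b | `|b - b0| < d / 2]).
          by split => /=; exact: near_real_close.
        by move=> [a b].
      by move=> [p [a b]] [].
    move=> p a b [/= h1 h2]; apply: le_lt_trans (cabs_ReIm _) _ => /=.
    by rewrite [d]splitr ltrD.
  (* Where the square exceeds the unit disc, the two conditions on [t] exclude each other for small
     [d], and the claim is void. *)
  have [t1|t1] := leP (cabs t0) 1; last first.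
    have d0 : 0 < (cabs t0 - 1) / 4 by rewrite divr_gt0 // subr_gt0.
    have [V nV hV] := close _ d0.
    exists (V, [set d | d < (cabs t0 - 1) / 4]).
      by split=> //=; exact: nbhs_right_lt.
    move=> [[p [a b]] d] [/= /hV h1 h2] _ t h3 h4; exfalso.
    have := cabs_triang (a +i* b) t0 0; have := cabs_triang t (a +i* b) 0.
    rewrite !subr0 (cabs_distC (a +i* b)) => h5 h6.
    have := cabs_triang (a +i* b) t0 0; rewrite !subr0 (cabs_distC t0) => h7.
    have := cabs_triang t (a +i* b) 0; rewrite !subr0 (cabs_distC (a +i* b) t) => h8.
    lra.
  have Dq := dil_disk t1 (KD _ Kp0).
  have := @dil_continuous R n (t0, p0) _ (holo_near hf Dq).
  case=> -[A B] [/= nA nB] AB.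
  have [e /= e0 he] := (nbhs_ballP _ _).1 nA.
  have ee : e = (complex.Re e)%:C by rewrite RRe_real ?gtr0_real.
  have e0' : 0 < complex.Re e / 2 by rewrite divr_gt0 // -ltcR -ee.
  have [V nV hV] := close _ e0'.
  pose M := cabs (f (dil t0 p0)) + 1; have M0 : 0 < M by rewrite ltr_wpDl ?cabs_ge0.
  exists (V `&` [set x | B x.1], [set d | 0 < d /\ d < Num.min (complex.Re e / 2) M^-1]).
    split=> /=; first apply: filterI => //.
      exists (B, setT); first by split=> //=; exact: filterT.
      by move=> [p ab] [].
    apply: filterI; first exact: nbhs_right_gt.
    by apply: nbhs_right_lt; rewrite lt_min e0' invr_gt0.
  move=> [[p [a b]] d] [/= [/hV h1 Bp] [d0]]; rewrite lt_min => /andP[h2 h3] ps t h4 h5.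
  have At : A t.
    apply: he; rewrite /ball /= /ball_ /= ee cabs_lt cabs_distC.
    apply: le_lt_trans (cabs_triang (a +i* b) _ _) _; lra.
  have [Dt ft] := AB (t, p) (conj At Bp) (dil_sym t ps).
  split=> //; apply: le_trans ft _; rewrite -/M -[M]invrK lef_pV2 ?posrE ?invr_gt0 //.
  exact: ltW.
move=> hP; have [d [hd d0]] : exists d : R, (K `*` (I1 `*` I1)) `<=` P d /\ 0 < d.
  near (0 : R)^'+ => d; exists d; split; first by near: d.
  by near: d; exact: nbhs_right_gt.
exists d => // p t Kp t1.
have d1 : 0 < 1 + d by rewrite addr_gt0.
(* A base point in the unit disc at distance at most [d] from [t]. *)
pose s : C := t / (1 + d)%:C.
have s1 : cabs s <= 1 by rewrite cabsM cabsV cabsR gtr0_norm // ler_pdivrMr // mul1r.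
have inI (r : R) : `|r| <= cabs s -> I1 r.
  by move=> h; rewrite /I1 /= in_itv /= -ler_norml (le_trans h).
apply: (hd (p, (complex.Re s, complex.Im s))) => //.
- by split=> //; split; apply: inI; [exact: cabs_Re|exact: cabs_Im].
- exact: siegel_sym (KD _ Kp).
rewrite /= (_ : _ +i* _ = s); last by case: s {s1 inI}.
have -> : t - s = s * d%:C.
  rewrite /s rmorphD rmorph1; field.
  by rewrite -[1]/((1 : R)%:C) -rmorphD -cabs_gt0 cabsR normr_gt0 gt_eqF.
by rewrite cabsM cabsR gtr0_norm // ler_piMl // ltW.
Unshelve. all: by end_near.
Qed.

Variable m : R.
Hypothesis m_gt0 : 0 < m.
Let k : C := (kappa m)%:C.
Implicit Types (x : coord_index n -> C).

Lemma kC_neq0 : k != 0.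
Proof. by rewrite -cabs_gt0 cabsR normr_gt0 gt_eqF // kappa_gt0. Qed.

(** Both variables of an unordered pair are added to both entries, so symmetric matrices are never
    left; with center 0 and [z] divided by [k], the chart undoes [sjcoord]. *)
Definition chart p x : sjpoint R n :=
  (\matrix_(i, j) (p.1 i j + x (inl (i, j)) + x (inl (j, i))),
   \row_j (p.2 0 j + x (inr j) / k)).

Definition dir (i : coord_index n) : sjpoint R n :=
  match i with inl jk => (delta_mx jk.1 jk.2 + delta_mx jk.2 jk.1, 0)
             | inr j => (0, k^-1 *: delta_mx 0 j) end.

Lemma chart_sym p x : p.1^T = p.1 -> (chart p x).1^T = (chart p x).1.
Proof.
move=> ps; apply/matrixP => i j; rewrite !mxE addrAC.
by have /matrixP/(_ i j) := ps; rewrite mxE => ->.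
Qed.

Lemma chart_upd p x i h : chart p (upd x i (x i + h)) = chart p x + h *: dir i.
Proof.
have U c : upd x i (x i + h) c = x c + h * (c == i)%:R.
  by rewrite /upd; case: eqP => [->|_]; rewrite ?mulr1 // mulr0 addr0.
rewrite /chart; congr (_, _); last first.
  apply/rowP => c; rewrite !mxE U; case: i {U} => [ij|j] /=.
    by rewrite mulr0 addr0 !mxE mulr0 addr0.
  rewrite !mxE eqxx /= (inj_eq (@inr_inj _ _)).
  by case: eqP => _; rewrite ?mulr1 ?mulr0 ?addr0 // mulrDl addrA.
apply/matrixP => a b; rewrite !mxE !U; case: i {U} => [[c d]|j] /=; last first.
  by rewrite !mxE !mulr0 !addr0.
rewrite !mxE !(inj_eq (@inl_inj _ _)) !xpair_eqE.
rewrite mulrDr !addrA; congr (_ + _); first by ring.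
by rewrite andbC.
Qed.

Lemma chart0 p : chart p (fun=> 0) = p.
Proof.
case: p => W z; congr (_, _); first by apply/matrixP => i j; rewrite !mxE !addr0.
by apply/rowP => j; rewrite !mxE mul0r addr0.
Qed.

Lemma chart_sjcoord p : p.1^T = p.1 -> chart 0 (sjcoord m p) = p.
Proof.
case: p => W z /= Ws; congr (_, _); last first.
  by apply/rowP => j; rewrite !mxE /sjcoord /= !mxE add0r mulrC mulKf // kC_neq0.
apply/matrixP => i j; rewrite !mxE /sjcoord /= add0r.
have -> : W j i = W i j by have /matrixP/(_ i j) := Ws; rewrite mxE.
by field.
Qed.

Definition loc f p x : C := f (chart p x).

Lemma loc_cderiv f p x i : holomorphic f -> siegel_jacobi_disk (chart p x) ->
  p.1^T = p.1 -> cderiv (fun t => loc f p (upd x i t)) (x i) ('D_(dir i) (in_coords f) (chart p x)).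
Proof.
move=> hf D ps; have h := derivable_cderiv (@diff_derivable _ _ _ _ _ (dir i) (hf _ D)).
have e0 : (fun t => loc f p (upd x i (t + x i))) = (fun h => in_coords f (chart p x + h *: dir i)).
  apply/funext => t; rewrite addrC -chart_upd in_coords_id //; exact: chart_sym.
move: h; rewrite -e0 => h.
by have := (cderiv_shift (fun t => loc f p (upd x i t)) 0 _ (x i)).2 h; rewrite add0r.
Qed.

Lemma chart_polydisc p : siegel_jacobi_disk p -> exists2 r : R, 0 < r &
  forall x, (forall i, cabs (x i) <= r) -> siegel_jacobi_disk (chart p x).
Proof.
move=> Dp; have [d d0 hd] := siegel_open Dp.1; exists (d / 2); first by rewrite divr_gt0.
move=> x xr; split; last exact: I.
apply: hd; first exact: chart_sym (siegel_sym Dp).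
move=> i j; rewrite !mxE.
have -> : p.1 i j + x (inl (i, j)) + x (inl (j, i)) - p.1 i j = x (inl (i, j)) + x (inl (j, i)) by ring.
by apply: le_trans (cabsD _ _) _; rewrite [d]splitr lerD.
Qed.

Lemma chartE p x : chart p x = p + \sum_i x i *: dir i.
Proof.
suff h (s : seq (coord_index n)) : uniq s ->
    chart p (fun i => if i \in s then x i else 0) = p + \sum_(i <- s) x i *: dir i.
  have := h _ (enum_uniq (coord_index n)); rewrite big_enum /= => <-.
  by congr chart; apply/funext => i; rewrite mem_enum.
elim: s => [_|i s IH /=].
  by rewrite big_nil addr0 -[RHS]chart0; congr chart.
move=> /andP[is_ us]; rewrite big_cons addrCA -(IH us) addrC.
rewrite -[x i in RHS]add0r.
have -> : 0 = (fun i => if i \in s then x i else 0) i by rewrite (negPf is_).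
rewrite [X in _ + X *: _](_ : _ = x i); last by rewrite (negPf is_) add0r.
rewrite -chart_upd; congr chart; apply/funext => j; rewrite /upd inE.
by case: eqP => [->|]; rewrite // (negPf is_) add0r.
Qed.

(** Squares stand in for discs: their compactness is that of a product of real segments. *)
Definition box (r : R) : set C := [set z | `|complex.Re z| <= r /\ `|complex.Im z| <= r].

Lemma box_compact r : compact (box r).
Proof.
have -> : box r = (fun ab : R * R => ab.1%:C + 'i%C * ab.2%:C) @` (`[-r, r] `*` `[-r, r]).
  apply/seteqP; split=> [[a b] /= [h1 h2]|_ [[a b] [/= h1 h2] <-]].
    by exists (a, b); rewrite /= ?in_itv /= -?ler_norml // [RHS]complexE.
  by move: h1 h2; rewrite /box !in_itv /= -!ler_norml !(mul0r, mulr0, mul1r, add0r, addr0, subr0, oppr0).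
apply: continuous_compact; last by apply: compact_setX; exact: segment_compact.
apply: continuous_subspaceT => -[a b].
have cC (x : R) : {for x, continuous (real_complex R : R -> C)}.
  apply/cvgrPdist_le => e e0.
  have ee : e = (complex.Re e)%:C by rewrite RRe_real ?gtr0_real.
  have e0' : 0 < complex.Re e by rewrite -ltcR -ee.
  apply: filterS (nbhsx_ballx x _ e0') => y; rewrite /ball /= => h.
  by rewrite -rmorphB normE cabsR ee lecR ltW.
apply: cvgD; first by apply: cvg_comp; [exact: cvg_fst|exact: cC].
apply: cvgM; first exact: cvg_cst.
by apply: cvg_comp; [exact: cvg_snd|exact: cC].
Qed.

Lemma chart_box_compact p r : 0 <= r -> compact [set chart p x | x in [set x | forall i, box r (x i)]].
Proof.
move=> r0; pose Ks (s : seq (coord_index n)) :=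
  [set q | exists x : coord_index n -> C, (forall i, box r (x i)) /\ q = p + \sum_(i <- s) x i *: dir i].
suff h s : uniq s -> compact (Ks s).
  have := h _ (enum_uniq (coord_index n)); congr compact; apply/seteqP; split.
    by move=> _ [x [xr ->]]; exists x => //; rewrite chartE big_enum.
  by move=> _ [x xr <-]; exists x; rewrite chartE big_enum.
elim: s => [_|i s IH /= /andP[is_ us]].
  have -> : Ks [::] = [set p]; last exact: compact_set1.
  apply/seteqP; split=> [_ [x [_ ->]]|_ ->]; first by rewrite big_nil addr0.
  by exists (fun=> 0); rewrite big_nil addr0; split=> // j; split; rewrite /= normr0.
have -> : Ks (i :: s) = (fun tq : C * sjpoint R n => tq.1 *: dir i + tq.2) @` (box r `*` Ks s).
  apply/seteqP; split=> [_ [x [xr ->]]|_ [[t q] [/= tr [x [xr ->]]] <-]].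
    exists (x i, p + \sum_(j <- s) x j *: dir j); first by split; [exact: xr|exists x].
    by rewrite /= big_cons addrCA.
  exists (upd x i t); split.
    by move=> j; rewrite /upd; case: eqP.
  rewrite big_cons upd_eq addrCA; congr (_ + (_ + _)); rewrite !big_seq; apply: eq_bigr => j js.
  by rewrite /upd; case: eqP => // ji; move: is_; rewrite -ji js.
apply: continuous_compact; last by apply: compact_setX; [exact: box_compact|exact: IH].
apply: continuous_subspaceT => -[t q].
apply: (@cvgD _ (sjpoint R n)); last exact: cvg_snd.
by apply: (@cvgZ _ (sjpoint R n)); [exact: cvg_fst|exact: cvg_cst].
Qed.

End Charts.

(** * The differential equations in terms of Taylor coefficients *)

Section LocalExpansion.
Variable R : realType.
Notation C := R[i].
Variable n : nat.
Variable m : R.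
Hypothesis m_gt0 : 0 < m.
Let k : C := (kappa m)%:C.
Implicit Types (p q : sjpoint R n) (f : sjpoint R n -> C) (x : coord_index n -> C).

Let k_neq0 : k != 0. Proof. exact: kC_neq0. Qed.

Lemma kappaC2 : k ^+ 2 = (8 * pi * m)%:C.
Proof. by rewrite /k -rmorphXn /= kappa2. Qed.

Lemma cderiv_line (V : normedModType C) (g : V -> C) (q v : V) (c l : C) :
  cderiv (fun h => g (q + h *: v)) 0 l -> cderiv (fun h => g (q + h *: (c *: v))) 0 (c * l).
Proof.
move=> hg; have hc : cderiv (fun h : C => h * c) 0 c.
  by have := cderivM (cderiv_id 0) (cderiv_cst c 0); rewrite mul1r mulr0 addr0.
have hg' : cderiv (fun h => g (q + h *: v)) ((fun h : C => h * c) 0) l by rewrite mul0r.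
have := cderiv_comp hc hg'; rewrite mulrC.
by apply: cderiv_ext; near=> h; rewrite /= scalerA add0r.
Unshelve. all: by end_near.
Qed.

Lemma in_coords_eq f q q' : symU q.1 = symU q'.1 -> q.2 = q'.2 ->
  in_coords f q = in_coords f q'.
Proof. by rewrite /in_coords => -> ->. Qed.

Definition ddir f i q := 'D_(dir m i) (in_coords f) q.

Lemma ddir_inr f j q : holomorphic f -> siegel_jacobi_disk q ->
  ddir f (inr j) q = k^-1 * dz j f q.
Proof.
move=> hf Dq; have h v := derivable_cderiv (@diff_derivable _ _ _ _ _ v (hf _ Dq)).
apply: cderiv_unique (h _) _; rewrite [dir _ _](_ : _ = k^-1 *: (0, delta_mx 0 j)).
  by apply: cderiv_line; exact: h.
by congr (_, _); rewrite /= scaler0.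
Qed.

(** Off the diagonal [symU] discards the lower entry and sees only [delta_mx j l]; on the diagonal
    the two summands of [dir] coincide. This is the origin of [1 + delta_jk]. *)
Lemma ddir_inl f (j l : 'I_n) q : holomorphic f -> siegel_jacobi_disk q -> (j <= l)%N ->
  ddir f (inl (j, l)) q = (1 + (j == l)%:R) * dW j l f q.
Proof.
move=> hf Dq jl; have h v := derivable_cderiv (@diff_derivable _ _ _ _ _ v (hf _ Dq)).
have [jl0|jl0] := eqVneq j l.
  rewrite -jl0; apply: cderiv_unique (h _) _.
  rewrite [dir _ _](_ : _ = 2 *: (delta_mx j j, 0)); last first.
    by congr (_, _); rewrite /= ?scaler0 // scaler_nat mulr2n.
  by rewrite -[1 + _]/(2%:R : C); apply: cderiv_line; exact: h.
rewrite addr0 mul1r; apply: cderiv_unique (h _) _.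
have := h ((delta_mx j l, 0) : sjpoint R n).
rewrite -/(dW j l f q); apply: cderiv_ext; near=> t.
rewrite add0r.
suff: symU (q + t *: ((delta_mx j l, 0) : sjpoint R n)).1 = symU (q + t *: dir m (inl (j, l))).1.
  by move=> e1; apply: in_coords_eq e1 _.
have jl' : (j < l)%N by rewrite ltn_neqAle jl andbT -(inj_eq val_inj) in jl0 *.
apply/matrixP => a b; rewrite /= !mxE; case: ifP => ab.
  congr (_ + t * _); rewrite [_ + _](_ : _ = (delta_mx j l : 'M[C]_n) a b); first by rewrite mxE.
  rewrite mxE [X in _ + X](_ : _ = 0) ?addr0 //.
  by case: andP => // -[/eqP al /eqP bj]; move: ab; rewrite al bj leqNgt jl'.
congr (_ + t * _); rewrite [RHS](_ : _ = (delta_mx j l : 'M[C]_n) b a + delta_mx l j b a); last by rewrite !mxE.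
rewrite !mxE [X in _ + X](_ : _ = 0) ?addr0 //.
case: andP => // -[/eqP bl /eqP aj]; move: ab; rewrite bl aj => /negP; case.
exact: ltnW.
Unshelve. all: by end_near.
Qed.

Lemma loc_psum_ddir f p (r : R) b i : holomorphic f -> p.1^T = p.1 -> 0 < r ->
  (forall x, (forall i, cabs (x i) <= r) -> siegel_jacobi_disk (chart m p x)) ->
  psum_on r b (loc m f p) ->
  psum_on r (fun a => b (incr i a)) (fun x => ddir f i (chart m p x)).
Proof.
move=> hf ps r0 hD hb; have [F' [hF' dF']] := psum_on_deriv i r0 hb.
move=> x xr; have := hF' x xr; congr has_sum.
apply: cderiv_unique (dF' x xr) _; apply: loc_cderiv => //.
by apply: hD => j; exact: ltW.
Qed.

Lemma loc_psum_dz2 f p (r : R) b j l : holomorphic f -> p.1^T = p.1 -> 0 < r ->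
  (forall x, (forall i, cabs (x i) <= r) -> siegel_jacobi_disk (chart m p x)) ->
  psum_on r b (loc m f p) ->
  psum_on r (fun a => b (incr (inr l) (incr (inr j) a)))
    (fun x => k ^- 2 * dz j (dz l f) (chart m p x)).
Proof.
move=> hf ps r0 hD hb; have [F' [hF' dF']] := psum_on_deriv (inr j) r0 (loc_psum_ddir (i := inr l) hf ps r0 hD hb).
move=> x xr; have := hF' x xr; congr has_sum.
have Dx y : in_polydisc r y -> siegel_jacobi_disk (chart m p y).
  by move=> yr; apply: hD => i; exact: ltW.
set q := chart m p x.
have e0 : cderiv (fun h => in_coords (dz l f) (q + h *: dir m (inr j))) 0 (k * F' x).
  have h1 := cderivZ k (dF' x xr).
  have h2 := (cderiv_shift (fun t => k * ddir f (inr l) (chart m p (upd x (inr j) t))) 0 (k * F' x) (x (inr j))).1.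
  rewrite add0r in h2; have {h1 h2} := h2 h1; apply: cderiv_ext.
  apply: filterS (near_upd (inr j) xr) => h hr; rewrite add0r [h + _]addrC ddir_inr //; last exact: Dx.
  rewrite mulrA mulfV // mul1r chart_upd -in_coords_id -?chart_upd //.
  exact: chart_sym.
have := cderiv_line k e0.
have -> : k *: dir m (inr j) = (0, delta_mx 0 j).
  by congr (_, _); rewrite /= ?scaler0 // scalerA mulfV // scale1r.
move=> /cderiv_is_derive[_]; rewrite -/(dz j (dz l f) q) => ->.
by rewrite mulrA -expr2 mulrA mulVf ?mul1r // expf_neq0.
Qed.

(** The scaling of [z] absorbs [8 * pi * m] and the doubled diagonal direction absorbs
    [1 + delta_jl]; an equality of shifted coefficients remains. *)
Lemma loc_pde_coef f p (r : R) b (j l : 'I_n) : holomorphic f -> p.1^T = p.1 -> 0 < r ->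
  (forall x, (forall i, cabs (x i) <= r) -> siegel_jacobi_disk (chart m p x)) ->
  psum_on r b (loc m f p) -> (j <= l)%N ->
  (forall q, siegel_jacobi_disk q ->
     dz j (dz l f) q = (8 * pi * m)%:C * (1 + (j == l)%:R) * dW j l f q) ->
  forall a, b (incr (inr l) (incr (inr j) a)) = b (incr (inl (j, l)) a).
Proof.
move=> hf ps r0 hD hb jl pde.
apply: (psum_on_unique r0 (loc_psum_dz2 (j := j) (l := l) hf ps r0 hD hb) (loc_psum_ddir (i := inl (j, l)) hf ps r0 hD hb)).
move=> x xr; have Dx : siegel_jacobi_disk (chart m p x) by apply: hD => i; exact: ltW.
by rewrite pde // ddir_inl // -kappaC2 -[k ^+ 2 * _ * _]mulrA mulKf // expf_neq0.
Qed.

(** The defect of the equation at one point is a difference of two coefficients, a quantity that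
    Cauchy's estimates control under uniform limits. *)
Lemma loc_pde0 f p (r : R) b (j l : 'I_n) : holomorphic f -> siegel_jacobi_disk p -> 0 < r ->
  (forall x, (forall i, cabs (x i) <= r) -> siegel_jacobi_disk (chart m p x)) ->
  psum_on r b (loc m f p) -> (j <= l)%N ->
  let a0 := [ffun=> 0%N] in
  dz j (dz l f) p - (8 * pi * m)%:C * (1 + (j == l)%:R) * dW j l f p =
    k ^+ 2 * (b (incr (inr l) (incr (inr j) a0)) - b (incr (inl (j, l)) a0)).
Proof.
move=> hf Dp r0 hD hb jl a0; have ps := siegel_sym Dp.
rewrite -(psum_on_at0 r0 (loc_psum_dz2 (j := j) (l := l) hf ps r0 hD hb)).
rewrite -(psum_on_at0 r0 (loc_psum_ddir (i := inl (j, l)) hf ps r0 hD hb)) chart0.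
rewrite (ddir_inl hf Dp jl) -kappaC2; move: (dz _ _ _) (dW _ _ _ _) => X Y.
have k2 : k ^+ 2 != 0 by rewrite expf_neq0.
by rewrite mulrBr mulVKf // mulrA.
Qed.

Lemma ddir_swap f (j l : 'I_n) q : ddir f (inl (j, l)) q = ddir f (inl (l, j)) q.
Proof. by rewrite /ddir /= addrC. Qed.

(** The coordinates are overcomplete, but the generating function sees them only through [quad]. *)
Lemma genp_quad (s : multi n) x y : (forall U, quad U x = quad U y) -> genp s x = genp s y.
Proof.
move=> xy; have h (w : coord_index n -> C) (U : 'rV[C]_n) :
    has_sum (fun s => (mfact s)%:R * genp s w * divmon (fun i => U 0 i) s) (expC (quad U w)).
  have := @genp_generating R n U w; apply: eq_has_sum => t.
  by rewrite -mpow_divmon [RHS]mulrC [RHS]mulrA divfK // mfact_neq0.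
apply: (mulfI (mfact_neq0 R s)).
have h' (U : 'rV[C]_n) : has_sum (fun s => (mfact s)%:R * genp s y * divmon (fun i => U 0 i) s) (expC (quad U x)).
  by rewrite xy; exact: h.
exact: (congr1 (@^~ s) (coef_unique (h x) h')).
Qed.

(** Going through [chart] replaces a shift [x_(j,k)] by its mean with [x_(k,j)], which leaves [quad]
    unchanged. *)
Lemma genp_chart (s : multi n) p x :
  genp s (sjcoord m (chart m p x)) = genp s (fun i => sjcoord m p i + x i).
Proof.
apply: genp_quad => U; rewrite /quad !big_sumType /=; congr (_ + _); last first.
  by apply: eq_bigr => j _; rewrite /sjcoord /= !mxE mulrDr [k * (_ / _)]mulrC divfK.
pose S (g : 'I_n * 'I_n -> C) := \sum_(jl : 'I_n * 'I_n) g jl * \prod_i U 0 i ^+ wtf (inl jl) i.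
have sw (g : 'I_n * 'I_n -> C) : S g = S (fun jl => g (jl.2, jl.1)).
  rewrite /S (reindex (fun jl : 'I_n * 'I_n => (jl.2, jl.1))) /=; last first.
    by exists (fun jl => (jl.2, jl.1)) => -[].
  by apply: eq_bigr => -[a b] _; congr (_ * _); apply: eq_bigr => i _; rewrite /= addnC.
have SD (g h : 'I_n * 'I_n -> C) : S (fun jl => g jl + h jl) = S g + S h.
  by rewrite /S -big_split; apply: eq_bigr => jl _; rewrite mulrDl.
have SZ (c : C) (g : 'I_n * 'I_n -> C) : S (fun jl => c * g jl) = c * S g.
  by rewrite /S mulr_sumr; apply: eq_bigr => jl _; rewrite mulrA.
pose g0 (jl : 'I_n * 'I_n) := p.1 jl.1 jl.2 / 2.
pose g1 (jl : 'I_n * 'I_n) := x (inl jl).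
have -> : \sum_(i : 'I_n * 'I_n) sjcoord m (chart m p x) (inl i) * \prod_j U 0 j ^+ ((i.1 == j) + (i.2 == j))
   = S (fun jl => g0 jl + 2^-1 * (g1 jl + g1 (jl.2, jl.1))).
  apply: eq_bigr => -[a b] _; congr (_ * _); rewrite /sjcoord /= mxE /g0 /g1 /=; by field.
rewrite [RHS](_ : _ = S (fun jl => g0 jl + g1 jl)); last by apply: eq_bigr => -[a b].
rewrite !SD SZ SD -sw; congr (_ + _); by field.
Qed.

End LocalExpansion.

(** * Solutions expand in the basis *)

Section SolutionsExpand.
Variable R : realType.
Notation C := R[i].
Variable n : nat.
Variable m : R.
Hypothesis m_gt0 : 0 < m.
Implicit Types (p q : sjpoint R n) (f : sjpoint R n -> C) (s : multi n)
  (a : {ffun coord_index n -> nat}).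

Lemma uniform_cvgP (K : set (sjpoint R n)) (F : nat -> sjpoint R n -> C) f :
  {uniform K, F @ \oo --> f} <-> forall e : R, 0 < e ->
    \forall M \near \oo, forall p, K p -> cabs (F M p - f p) <= e.
Proof.
split=> [h e e0|h].
  apply: (h [set g : {uniform` K -> C} | forall p, K p -> cabs (g p - f p) <= e]).
  apply/uniform_nbhs; exists [set xy : C * C | ball xy.1 e%:C xy.2].
  split; first by rewrite -entourage_ballE; exists e%:C => //=; rewrite ltcR.
  by move=> g /= hg p Kp; have := hg p Kp; rewrite /ball /= cabs_lt cabs_distC => /ltW.
move=> P /uniform_nbhs[E [+ EP]]; rewrite -entourage_ballE => -[e /= e0 eE].
have ee : e = (complex.Re e)%:C by rewrite RRe_real ?gtr0_real.
have e0' : 0 < complex.Re e / 2 by rewrite divr_gt0 // -ltcR -ee.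
apply: filterS (h _ e0') => M hM; apply: EP => p Kp /=; apply: eE.
rewrite /= /ball /= ee cabs_lt cabs_distC; apply: le_lt_trans (hM p Kp) _.
by move: e0'; lra.
Qed.

Lemma degree_fiber (N : nat) : exists A : {fset multi n}, forall s, (s \in A) = (mdeg s == N).
Proof.
pose conv (a : {ffun 'I_n -> 'I_N.+1}) : multi n := [ffun i => val (a i)].
exists (seq_fset tt [seq s <- [seq conv c | c <- enum {: {ffun 'I_n -> 'I_N.+1}}] | mdeg s == N]) => s.
rewrite seq_fsetE mem_filter andb_idr // => /eqP sN; apply/mapP.
have h i : (s i < N.+1)%N by rewrite -sN ltnS /mdeg (bigD1 i) //= leq_addr.
exists [ffun i => Ordinal (h i)]; first by rewrite mem_enum.
by apply/ffunP => i; rewrite !ffunE.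
Qed.

Definition degs N : {fset multi n} := projT1 (cid (degree_fiber N)).

Lemma mem_degs N s : (s \in degs N) = (mdeg s == N).
Proof. by rewrite /degs; case: (cid _) => A /= ->. Qed.

Lemma fsbig_degs N (F : multi n -> C) :
  \sum_(s \in [set s : multi n | mdeg s = N]) F s = \sum_(s <- degs N) F s.
Proof.
rewrite (fsbigE (degs N)) ?fset_uniq //.
- rewrite big_mkcond /= !big_seq; apply: eq_bigr => s; rewrite mem_degs => /eqP sN.
  by rewrite mem_set.
- by move=> s /=; rewrite mem_degs => /eqP.
- by move=> s /= sN; rewrite mem_degs sN eqxx.
Qed.

Definition hpart (c : multi n -> C) N p : C := \sum_(s <- degs N) c s * fs m s p.
Definition psumH (c : multi n -> C) M p : C := \sum_(N < M) hpart c N p.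

Lemma H0P f : H0 m f <-> holomorphic f /\ exists c, forall K, compact K ->
  K `<=` @siegel_jacobi_disk R n -> forall e : R, 0 < e ->
    \forall M \near \oo, forall p, K p -> cabs (psumH c M p - f p) <= e.
Proof.
have E c M p : \sum_(N < M) \sum_(s \in [set s : multi n | mdeg s = N]) c s * fs m s p = psumH c M p.
  by apply: eq_bigr => N _; rewrite fsbig_degs.
split=> -[hf [c hc]]; split=> //; exists c => K cK KD.
  by have /uniform_cvgP := hc K cK KD; under [X in X -> _]eq_forall do under eq_near do under eq_forall do rewrite E.
apply/uniform_cvgP => e e0; apply: filterS (hc K cK KD e e0) => M hM p Kp.
by rewrite E; exact: hM.
Qed.

Lemma holo_bounded f (K : set (sjpoint R n)) : holomorphic f -> compact K ->
  K `<=` @siegel_jacobi_disk R n -> exists M : R, 0 < M /\ forall p, K p -> cabs (f p) <= M.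
Proof.
move=> hf cK KD; have [d d0 hd] := dil_bounded hf cK KD.
exists d^-1; split=> [|p Kp]; first by rewrite invr_gt0.
have c1 : cabs (1 : C) <= 1 + d by rewrite cabs1 lerDl ltW.
have [_] := hd p 1 Kp c1.
have -> // : dil 1 p = p.
by case: p {Kp} => W z; rewrite /dil expr1n !scale1r.
Qed.

Lemma chart_box p : siegel_jacobi_disk p -> exists r : R, exists K : set (sjpoint R n),
  [/\ 0 < r, compact K, K `<=` @siegel_jacobi_disk R n,
    (forall x, (forall i, cabs (x i) <= r) -> K (chart m p x))
    & (forall x, (forall i, cabs (x i) <= r) -> siegel_jacobi_disk (chart m p x))].
Proof.
move=> Dp; have [r r0 hr] := chart_polydisc m Dp.
have r2 : 0 < r / 2 by rewrite divr_gt0.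
exists (r / 2), [set chart m p x | x in [set x | forall i, box (r / 2) (x i)]].
split.
- exact: r2.
- by apply: chart_box_compact; exact: ltW.
- move=> _ [x xr <-]; apply: hr => i; have [h1 h2] := xr i.
  by apply: le_trans (cabs_ReIm _) _; rewrite [r]splitr lerD.
- move=> x xr; exists x => // i; split.
    by apply: le_trans (cabs_Re _) (xr i).
  by apply: le_trans (cabs_Im _) (xr i).
- by move=> x xr; apply: hr => i; apply: le_trans (xr i) _; rewrite ler_pdivrMr // ler_peMr ?ler1n // ltW.
Qed.

Lemma loc_sep_holo f p (r : R) : holomorphic f -> p.1^T = p.1 ->
  (forall x, (forall i, cabs (x i) <= r) -> siegel_jacobi_disk (chart m p x)) ->
  sep_holo r (loc m f p).
Proof.
move=> hf ps hD x xr i; eexists; apply: loc_cderiv => //; exact: hD.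
Qed.

Lemma loc_exists f p : holomorphic f -> siegel_jacobi_disk p -> exists (r : R) b,
  [/\ 0 < r, (forall x, (forall i, cabs (x i) <= r) -> siegel_jacobi_disk (chart m p x)) &
   psum_on r b (loc m f p)].
Proof.
move=> hf Dp; have [r [K [r0 cK KD hK hD]]] := chart_box Dp.
have [M [M0 hM]] := holo_bounded hf cK KD.
have /pseries_psum_on[b [_ hb]] : pseries r M (loc m f p).
  apply: cauchy_pseries => //; first exact: ltW.
    by apply: loc_sep_holo => //; exact: siegel_sym.
  by move=> x /hK; exact: hM.
by exists r, b.
Qed.

(** The exponent of weight [s] without pair coordinates: the representative to which [pde_coef_wt]
    reduces all others. *)
Definition emb s : {ffun coord_index n -> nat} :=
  [ffun i => match i with inl _ => 0%N | inr j => s j end].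

Lemma wt_incr (i : coord_index n) a : wt (incr i a) = [ffun j => (wt a j + wtf i j)%N].
Proof.
apply/ffunP => j; rewrite !ffunE (bigD1 i) //= [in RHS](bigD1 i) //= ffunE eqxx.
rewrite mulnDl mul1n -!addnA; congr (_ + _)%N; rewrite addnC; congr (_ + _)%N.
by apply: eq_bigr => l /negPf li; rewrite ffunE li addn0.
Qed.

Lemma wt_pair (j l : 'I_n) a : wt (incr (inr l) (incr (inr j) a)) = wt (incr (inl (j, l)) a).
Proof.
by apply/ffunP => i; rewrite !wt_incr !ffunE /= -addnA.
Qed.

Lemma wt_emb_inr a : (forall jl, a (inl jl) = 0%N) -> emb (wt a) = a.
Proof.
move=> a0; apply/ffunP => -[jl|j]; rewrite !ffunE ?a0 //.
rewrite big_sumType /= big1 ?add0n => [|jl _]; last by rewrite a0.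
rewrite (bigD1 j) //= eqxx muln1 big1 ?addn0 // => l /negPf lj.
by rewrite lj muln0.
Qed.

(** Replacing a factor [x_(j,l)] by [x_j x_l] keeps the weight and the coefficient, and lowers the
    number of pair factors. *)
Lemma pde_coef_wt (b : {ffun coord_index n -> nat} -> C) :
  (forall j l a, b (incr (inr l) (incr (inr j) a)) = b (incr (inl (j, l)) a)) ->
  forall a, b a = b (emb (wt a)).
Proof.
move=> hb a; have [N] := ubnP (\sum_jl a (inl jl)); elim: N a => // N IH a aN.
have [[[j l] ajl]|na] := pselect (exists jl, (0 < a (inl jl))%N); last first.
  rewrite wt_emb_inr // => jl; apply/eqP; rewrite -leqn0 leqNgt; apply/negP => h.
  by apply: na; exists jl.
rewrite -(decrK ajl) -hb -wt_pair; apply: IH.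
rewrite -ltnS; apply: leq_trans aN; rewrite ltnS (bigD1 (j, l)) //= [X in (_ < X)%N](bigD1 (j, l)) //=.
rewrite !ffunE /= eqxx !addn0 subn1 -[X in (_ < X + _)%N](prednK ajl) addSn ltnS leq_add2l.
by apply: leq_sum => jl _; rewrite !ffunE /= !addn0 leq_subr.
Qed.

Lemma genp_dil s (t : C) p : genp s (sjcoord m (dil t p)) = t ^+ mdeg s * genp s (sjcoord m p).
Proof.
rewrite /genp mulr_sumr !big_seq; apply: eq_bigr => a; rewrite mem_fib => /eqP ws.
pose w (i : coord_index n) := match i with inl _ => 2%N | inr _ => 1%N end.
have sc i : sjcoord m (dil t p) i = t ^+ w i * sjcoord m p i.
  case: i => [jl|j]; rewrite /sjcoord /zcoord /w /=; first by rewrite mxE mulrA.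
  by rewrite !mxE expr1 mulrCA.
have -> : mdeg s = (\sum_i w i * a i)%N.
  rewrite -ws /mdeg; under eq_bigr do rewrite ffunE.
  rewrite exchange_big; apply: eq_bigr => i _ /=; rewrite -big_distrr /= mulnC; congr (_ * _)%N.
  have s1 (j : 'I_n) : (\sum_l (j == l) = 1)%N.
    by rewrite (bigD1 j) //= eqxx big1 // => l /negPf lj; rewrite eq_sym lj.
  by case: i => [[j l]|j] /=; rewrite ?big_split /= !s1.
rewrite expr_sum -big_split; apply: eq_bigr => i _ /=.
by rewrite sc exprMn -exprM mulrA.
Qed.

Lemma fs_dil s (t : C) p : fs m s (dil t p) = t ^+ mdeg s * fs m s p.
Proof. by rewrite !fsE // genp_dil mulrCA. Qed.

Lemma dil_curve_cderiv f p t : holomorphic f -> p.1^T = p.1 -> siegel_jacobi_disk (dil t p) ->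
  exists l, cderiv (fun t => f (dil t p)) t l.
Proof.
move=> hf ps D.
have dd : differentiable (fun t : C => dil t p) (t : C).
  apply: differentiable_pair; apply: differentiableZl; last exact: ex_diff.
  have -> : (fun t : C => t ^+ 2) = (id : C -> C) ^+ 2 by apply/funext => u; rewrite !expr2.
  by apply: differentiableX; exact: ex_diff.
have := derivable_cderiv (@diff_derivable _ _ _ _ _ (1 : C) (differentiable_comp dd (hf _ D))).
move: (derive _ _ _) => l h; exists l.
have := (cderiv_shift (fun u => in_coords f (dil u p)) 0 l t).2; rewrite add0r.
have e0 : (fun x => in_coords f (dil (x + t) p)) = (fun h : C => (in_coords f \o (fun u => dil u p)) (t + h *: (1 : C))).
  by apply/funext => u; rewrite /= -[u *: _]/(u * 1) mulr1 addrC.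
rewrite e0 => /(_ h); apply: cderiv_ext; near=> u.
by rewrite in_coords_id //; exact: dil_sym.
Unshelve. all: by end_near.
Qed.

Lemma pde_expand f : holomorphic f ->
  (forall j l : 'I_n, (j <= l)%N -> forall p, siegel_jacobi_disk p ->
    dz j (dz l f) p = (8 * pi * m)%:C * (1 + (j == l)%:R) * dW j l f p) ->
  H0 m f.
Proof.
move=> hf pde; apply/H0P; split=> //.
have D0 : siegel_jacobi_disk (0 : sjpoint R n) by split; [exact: siegel0|exact: I].
have s0 : (0 : sjpoint R n).1^T = (0 : sjpoint R n).1 by exact: siegel_sym D0.
have [r [b [r0 hD hb]]] := loc_exists hf D0.
have bjl j l a : b (incr (inr l) (incr (inr j) a)) = b (incr (inl (j, l)) a).
  have [jl|/ltnW lj] := leqP j l.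
    by apply: (loc_pde_coef m_gt0 hf s0 r0 hD hb jl) => q Dq; exact: pde.
  (* For [l < j] the equation is that of the pair [(l, j)], and the directions of the two ordered
     pairs coincide. *)
  rewrite incrC (loc_pde_coef m_gt0 hf s0 r0 hD hb lj); last by move=> q Dq; exact: pde.
  apply: (psum_on_unique r0 (loc_psum_ddir (i := inl (l, j)) hf s0 r0 hD hb)
    (loc_psum_ddir (i := inl (j, l)) hf s0 r0 hD hb)).
  by move=> x _; exact: ddir_swap.
have bwt := pde_coef_wt bjl.
pose c s := b (emb s) / sqrt_mfact R s; exists c.
(* Near the origin the Taylor series of [f], regrouped by weight and then by degree, is already the
   expansion. *)
have small_exp p : p.1^T = p.1 -> (forall i, cabs (sjcoord m p i) < r) -> has_sum (fun N => hpart c N p) (f p).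
  move=> ps pr; have := has_sum_group (fun a s => mem_fib a s) (hb _ pr).
  rewrite /loc chart_sjcoord // => h1; have := has_sum_group (fun s N => mem_degs N s) h1.
  apply: eq_has_sum => N; apply: eq_bigr => s _.
  rewrite /c fsE // mulrA divfK ?sqrt_mfact_neq0 // /genp mulr_sumr !big_seq.
  by apply: eq_bigr => a; rewrite mem_fib => /eqP <-; rewrite -bwt.
move=> K cK KD e e0; have [d d0 hd] := dil_bounded hf cK KD.
have d1 : 0 < 1 + d by rewrite addr_gt0.
(* Cauchy's bound for the part of degree [N], from the disc of radius [1 + d]; it is the same for
   all points of [K]. *)
pose D (N : nat) := d^-1 * (1 + d)^-1 ^+ N.
have D0' N : 0 <= D N by rewrite mulr_ge0 // ?exprn_ge0 // invr_ge0 ltW.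
have bD : bsum D.
  apply: bsumZ; first by rewrite invr_ge0 ltW.
  have h1 : cabs (((1 + d)^-1)%:C : C) < 1.
    by rewrite cabsR gtr0_norm ?invr_gt0 // invf_lt1 // ltrDl.
  have [B hB] := has_sum_asum (has_sum_geom h1).
  exists B => A; apply: le_trans (hB A); apply: ler_sum => N _.
  by rewrite cabsX cabsR gtr0_norm // invr_gt0.
have [A hA] := bsum_tail D0' bD e0.
exists (\max_(N <- A) N).+1 => // M /= hM p Kp.
have Dp := KD p Kp; have ps := siegel_sym Dp.
have /pseries_psum_on[b' [b'M hb']] : pseries (1 + d) d^-1 (fun x : unit -> C => f (dil (x tt) p)).
  apply: cauchy_pseries => //; first by rewrite invr_ge0 ltW.
    move=> x xr [].
    have [l hl] := dil_curve_cderiv hf ps (hd p (x tt) Kp (xr tt)).1.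
    by exists l; under eq_fun do rewrite upd_eq; exact: hl.
  by move=> x xr; exact: (hd p (x tt) Kp (xr tt)).2.
(* For [cabs t < r1] the curve stays where [small_exp] applies. This identifies the coefficients of
   the series in [t], which is then evaluated at [t = 1]. *)
have [r1 r10 hr1] : exists2 r1 : R, 0 < r1 < 1 + d & forall t, cabs t < r1 -> forall i, cabs (sjcoord m (dil t p) i) < r.
  pose B := 1 + \sum_i cabs (sjcoord m p i).
  have B1 : 1 <= B by rewrite lerDl; apply: sumr_ge0 => i _; exact: cabs_ge0.
  have B0 : 0 < B := lt_le_trans ltr01 B1.
  exists (Num.min 1 (r / B)).
    by rewrite lt_min ltr01 divr_gt0 // gt_min ltrDl d0.
  move=> t; rewrite lt_min => /andP[t1 t2] i.
  have le1 : cabs (sjcoord m (dil t p) i) <= cabs t * cabs (sjcoord m p i).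
    case: i => [jl|j]; rewrite /sjcoord /zcoord /=; last by rewrite !mxE -cabsM mulrCA.
    rewrite mxE -mulrA cabsM cabsX ler_wpM2r ?cabs_ge0 // expr2 ler_piMr ?cabs_ge0 //.
    exact: ltW.
  apply: le_lt_trans le1 _; apply: (@le_lt_trans _ _ (cabs t * B)); last by rewrite -ltr_pdivlMr.
  rewrite ler_wpM2l ?cabs_ge0 //; apply: (@le_trans _ _ (\sum_i cabs (sjcoord m p i))); last by rewrite lerDr.
  by rewrite (bigD1 i) //= lerDl; apply: sumr_ge0 => j _; exact: cabs_ge0.
have [r1_gt0 r1d] := andP r10.
pose A' (N : nat) := N`!%:R * hpart c N p.
have hA' : psum_on r1 (fun a : {ffun unit -> nat} => A' (a tt)) (fun x => f (dil (x tt) p)).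
  move=> x xr; have := small_exp _ (dil_sym (x tt) ps) (hr1 _ (xr tt)) => h.
  have cK' : cancel (fun a : {ffun unit -> nat} => a tt) (fun N => [ffun=> N]).
    by move=> a; apply/ffunP => -[]; rewrite ffunE.
  have z0 N : (forall a : {ffun unit -> nat}, N <> a tt) -> hpart c N (dil (x tt) p) = 0.
    by move=> /(_ [ffun=> N]); rewrite ffunE.
  have := has_sum_reindex cK' z0 h; apply: eq_has_sum => a /=.
  rewrite /A' /hpart mulr_sumr mulr_suml !big_seq; apply: eq_bigr => s; rewrite mem_degs => /eqP sN.
  rewrite fs_dil sN /divmon (big_pred1 tt) => [|[]//].
  have := fact_neq0 R (a tt); move: (_`!%:R) (x tt ^+ _) (fs _ _ _) (c s) => F X Y c0 F0.
  by field.
have hb1 : psum_on r1 b' (fun x => f (dil (x tt) p)).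
  by move=> x xr; apply: hb' => i; apply: lt_trans (xr i) r1d.
have b'E := psum_on_unique r1_gt0 hb1 hA' (fun _ _ => erefl).
have one : in_polydisc (1 + d) (fun _ : unit => 1 : C) by move=> i; rewrite cabs1 ltrDl.
have h1 := has_sum_unit (hb' _ one).
have hN N : b' [ffun=> N] * (1 ^+ N / N`!%:R) = hpart c N p.
  by rewrite b'E ffunE /A' expr1n mul1r mulrAC mulfV ?mul1r // fact_neq0.
have {h1}h1 : has_sum (fun N => hpart c N p) (f p).
  have <- : dil 1 p = p by case: (p) => W z; rewrite /dil expr1n !scale1r.
  by move: h1; apply: eq_has_sum => N; rewrite hN; case: (p) => W z; rewrite /dil expr1n !scale1r.
rewrite cabs_distC /psumH.
have -> : \sum_(N < M) hpart c N p = \sum_(N <- seq_fset tt (iota 0 M)) hpart c N p.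
  by rewrite big_seq_fset ?iota_uniq // -[M in iota _ M]subn0 -/(index_iota 0 M) big_mkord.
apply: has_sum_tail h1 _ => B AB.
apply: le_trans (_ : \sum_(N <- B) D N <= _).
  apply: ler_sum => N _; rewrite -hN expr1n mul1r cabsM cabsV cabs_natr.
  rewrite ler_pdivrMr ?ltr0n ?fact_gt0 //; apply: le_trans (b'M _) _.
  rewrite (big_pred1 tt) => [|[]//]; by rewrite ffunE /D mulrA mulrAC.
apply: hA; apply/fdisjointP => N NA; apply/negP => NB.
have : N \notin seq_fset tt (iota 0 M).
  by apply/negP => NM; move/fdisjointP: AB => /(_ N NM); rewrite NB.
rewrite seq_fsetE mem_iota /= add0n => /negP; apply.
by apply: leq_trans hM; rewrite ltnS; apply: leq_bigmax_seq.
Qed.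

End SolutionsExpand.

(** * Taylor series at a shifted center *)

Section ShiftedSeries.
Variable R : realType.
Notation C := R[i].
Variable I : finType.
Implicit Types (x y : I -> C) (b B : {ffun I -> nat} -> C) (F : (I -> C) -> C).

Lemma shift_cderiv y x i F l : cderiv (fun t => F (upd (fun j => y j + x j) i t)) (y i + x i) l ->
  cderiv (fun t => F (fun j => y j + upd x i t j)) (x i) l.
Proof.
rewrite addrC => /cderiv_shift; congr (cderiv _ _ _); apply/funext => t; congr F.
by apply/funext => j; rewrite /upd; case: eqP => // ->; rewrite addrC.
Qed.

(** The series at both centers represent one function, so differentiating it shifts the coefficients
    of both. *)
Lemma psum_shift_deriv (r rho : R) b B F y i : 0 < r -> 0 < rho ->
  (forall x, in_polydisc r x -> in_polydisc rho (fun j => y j + x j)) ->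
  psum_on rho b F -> psum_on r B (fun x => F (fun j => y j + x j)) ->
  exists F', psum_on rho (fun a => b (incr i a)) F' /\
    psum_on r (fun a => B (incr i a)) (fun x => F' (fun j => y j + x j)).
Proof.
move=> r0 rho0 hy hb hB; have [F' [hF' dF']] := psum_on_deriv i rho0 hb.
have [G' [hG' dG']] := psum_on_deriv i r0 hB.
exists F'; split; first exact: hF'.
move=> x xr; have := hG' x xr; congr has_sum.
apply: cderiv_unique (dG' x xr) _.
by apply: shift_cderiv; apply: dF'; exact: hy.
Qed.

End ShiftedSeries.

(** * Series in the basis solve the equations *)

Section ExpansionsSolve.
Variable R : realType.
Notation C := R[i].
Variable n : nat.
Implicit Types (s : multi n) (x y : coord_index n -> C).

Lemma genp_cderiv s y x i : exists l, cderiv (fun t => genp s (fun j => y j + upd x i t j)) (x i) l.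
Proof.
pose rho : R := 1 + \sum_j cabs (y j + x j).
have rho0 : 0 < rho by rewrite ltr_pwDl // sumr_ge0 // => j _; exact: cabs_ge0.
have [F' [_ dF']] := psum_on_deriv i rho0 (@psum_on_genp R n rho s).
exists (F' (fun j => y j + x j)); apply: shift_cderiv; apply: (dF' (fun j => y j + x j)) => j.
rewrite /rho (bigD1 j) //= addrCA ltrDl ltr_pwDl // sumr_ge0 // => l _.
exact: cabs_ge0.
Qed.

(** At the origin the coefficients of [genp s] depend on the weight alone, so its derivatives along
    [x_j, x_l] and along [x_(j,l)] are one function; its value at [y] gives the relation there. *)
Lemma genp_shift_psum (r : R) s y : 0 < r -> exists B,
  psum_on r B (fun x => genp s (fun j => y j + x j)) /\
  forall j l, let a0 := [ffun=> 0%N] in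
    B (incr (inr l) (incr (inr j) a0)) = B (incr (inl (j, l)) a0).
Proof.
move=> r0; pose rho : R := r + \sum_j cabs (y j).
have rr : r <= rho by rewrite lerDl sumr_ge0 // => j _; exact: cabs_ge0.
have rho0 : 0 < rho := lt_le_trans r0 rr.
have yj j : cabs (y j) <= \sum_j cabs (y j).
  by rewrite (bigD1 j) //= lerDl sumr_ge0 // => l _; exact: cabs_ge0.
have shift x : in_polydisc r x -> in_polydisc rho (fun j => y j + x j).
  move=> xr j; apply: le_lt_trans (cabsD _ _) _; rewrite addrC.
  exact: ltr_leD (xr j) (yj j).
pose M : R := \sum_(a <- fib s) \prod_i (rho ^+ a i / (a i)`!%:R).
have /pseries_psum_on[B [_ hB]] : pseries r M (fun x => genp s (fun j => y j + x j)).
  apply: cauchy_pseries => //.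
  - apply: sumr_ge0 => a _; apply: prodr_ge0 => i _.
    by rewrite divr_ge0 // exprn_ge0 // ltW.
  - by move=> x _ i; exact: genp_cderiv.
  move=> x xr; apply: le_trans (cabs_sum _ _ _) _; apply: ler_sum => a _.
  rewrite cabs_prod; apply: ler_prod => i _; rewrite cabs_ge0 cabsM cabsV cabs_natr cabsX /=.
  rewrite ler_wpM2r ?invr_ge0 // lerXn2r ?nnegrE ?cabs_ge0 ?(ltW rho0) //.
  by apply: le_trans (cabsD _ _) _; rewrite addrC; apply: lerD.
exists B; split; first exact: hB.
move=> j l a0.
have hg := @psum_on_genp R n rho s.
have [F1 [hF1 hB1]] := psum_shift_deriv (inr l) r0 rho0 shift hg hB.
have [F2 [hF2 hB2]] := psum_shift_deriv (inr j) r0 rho0 shift hF1 hB1.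
have [F3 [hF3 hB3]] := psum_shift_deriv (inl (j, l)) r0 rho0 shift hg hB.
have y0 : in_polydisc rho (fun j => y j + 0).
  by apply: shift => i; rewrite cabs0.
rewrite -(psum_on_at0 r0 hB2) -(psum_on_at0 r0 hB3).
apply: has_sum_unique (hF2 _ y0) _; have := hF3 _ y0; apply: eq_has_sum => a.
by rewrite wt_pair.
Qed.

Variable m : R.
Hypothesis m_gt0 : 0 < m.

(** Partial sums satisfy the coefficient relation exactly. Cauchy's estimates turn their uniform
    closeness to [f] on a compact polydisc image into closeness of the two coefficients in
    [loc_pde0]. *)
Lemma expand_pde f : H0 m f -> forall j l : 'I_n, (j <= l)%N ->
  forall p, siegel_jacobi_disk p ->
  dz j (dz l f) p = (8 * pi * m)%:C * (1 + (j == l)%:R) * dW j l f p.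
Proof.
move=> /H0P[hf [c hc]] j l jl p Dp; have ps := siegel_sym Dp.
have [r [K [r0 cK KD hK hD]]] := chart_box m Dp.
have [M0 [M00 hM0]] := holo_bounded hf cK KD.
have /pseries_psum_on[b [_ hb]] : pseries r M0 (loc m f p).
  apply: cauchy_pseries => //; first exact: ltW.
    exact: loc_sep_holo.
  by move=> x /hK; exact: hM0.
have /choice[B hB] s := genp_shift_psum s (sjcoord m p) r0.
pose a0 : {ffun coord_index n -> nat} := [ffun=> 0%N].
pose al := incr (inr l) (incr (inr j) a0); pose be := incr (inl (j, l)) a0.
pose G (a : {ffun coord_index n -> nat}) : R := \prod_i ((a i)`!%:R * r^-1 ^+ a i).
have G0 a : 0 <= G a.
  by apply: prodr_ge0 => i _; rewrite mulr_ge0 // exprn_ge0 // invr_ge0 ltW.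
suff bb : b al = b be.
  by apply/eqP; rewrite -subr_eq0 (loc_pde0 m_gt0 hf Dp r0 hD hb jl) -/a0 -/al -/be bb subrr mulr0.
apply/eqP; rewrite -subr_eq0; apply/eqP/cabs_le0P => e e0.
have GG : 0 < G al + G be + 1 by rewrite ltr_wpDl // addr_ge0.
(* [G al] and [G be] are the factors in Cauchy's estimates for the two coefficients. *)
pose e1 := e / (G al + G be + 1); have e10 : 0 < e1 by rewrite divr_gt0.
have [M _ hM] := hc K cK KD e1 e10; have {}hM := hM M (leqnn M).
pose S x := \sum_(N < M) \sum_(s <- degs n N) c s * sqrt_mfact R s * genp s (fun i => sjcoord m p i + x i).
have SE x : psumH m c M (chart m p x) = S x.
  apply: eq_bigr => N _; apply: eq_bigr => s _.
  by rewrite fsE // genp_chart // mulrA.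
pose bS a := \sum_(N < M) \sum_(s <- degs n N) c s * sqrt_mfact R s * B s a.
have hS : psum_on r bS S.
  move=> x xr; have h1 (N : 'I_M) : has_sum (fun a => \sum_(s <- degs n N) c s * sqrt_mfact R s * (B s a * divmon x a))
      (\sum_(s <- degs n N) c s * sqrt_mfact R s * genp s (fun i => sjcoord m p i + x i)).
    by apply: has_sum_sum => s; apply: has_sumZ; exact: (hB s).1.
  have := has_sum_sum (r := index_enum 'I_M) h1; apply: eq_has_sum => a.
  rewrite /bS mulr_suml; apply: eq_bigr => N _; rewrite mulr_suml.
  by apply: eq_bigr => s _; rewrite mulrA.
have /pseries_psum_on[bh [bhM hbh]] : pseries r e1 (fun x => S x - loc m f p x).
  apply: cauchy_pseries => //; first exact: ltW.
    move=> x xr i; have [l1 hl1] := loc_sep_holo hf ps hD xr i.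
    have /choice[l2 hl2] s : exists l2, cderiv (fun t => c s * sqrt_mfact R s *
        genp s (fun i0 => sjcoord m p i0 + upd x i t i0)) (x i) l2.
      have [l2 hl2] := genp_cderiv s (sjcoord m p) x i.
      by eexists; apply: cderivZ hl2.
    eexists; apply: cderivB hl1.
    by apply: cderiv_sum => N; apply: cderiv_sum => s; exact: hl2.
  by move=> x xr; rewrite -SE; apply: hM; exact: hK.
have bE : bh =1 (fun a => bS a - b a).
  apply: (psum_on_unique r0 hbh) (fun _ _ => erefl) => x xr.
  have := has_sumB (hS x xr) (hb x xr); apply: eq_has_sum => a.
  by rewrite mulrBl.
have bSab : bS al = bS be.
  by apply: eq_bigr => N _; apply: eq_bigr => s _; rewrite (hB s).2.
have -> : b al - b be = bh be - bh al by rewrite !bE bSab; ring.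
apply: le_trans (cabsB _ _) _; apply: le_trans (lerD (bhM be) (bhM al)) _.
rewrite -/(G be) -/(G al) -mulrDr addrC /e1 mulrAC ler_pdivrMr // ler_pM2l //.
by rewrite addrC lerDl ler01.
Qed.

Lemma H0_pde f : holomorphic f ->
  (forall j l : 'I_n, (j <= l)%N -> forall p, siegel_jacobi_disk p ->
    dz j (dz l f) p = (8 * pi * m)%:C * (1 + (j == l)%:R) * dW j l f p) <-> H0 m f.
Proof. by move=> hf; split; [exact: pde_expand|exact: expand_pde]. Qed.

End ExpansionsSolve.

(** * Continuous square roots and leading minors *)

Section SquareRoot.
Variable R : realType.
Notation C := R[i].

Lemma flim_real T (F : set_system T) {FF : Filter F} (u : T -> R) (l : R) (g : R -> R) :
  {for l, continuous g} -> flim F (fun t => (u t)%:C) l%:C ->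
  flim F (fun t => (g (u t))%:C) (g l)%:C.
Proof.
move=> /cvgrPdist_le gc ul e e0; have [d /= d0 hd] := gc _ e0.
have d2 : 0 < d / 2 by rewrite divr_gt0.
apply: filterS (ul _ d2) => t /=; rewrite -!rmorphB !cabsR => h.
rewrite distrC; apply: hd; rewrite /= distrC; apply: le_lt_trans h _.
by rewrite gtr_pMr // invf_lt1 // ltr1n.
Qed.

Lemma flim_cabs T (F : set_system T) {FF : Filter F} (u : T -> C) l :
  flim F u l -> flim F (fun t => (cabs (u t))%:C) (cabs l)%:C.
Proof.
move=> h e e0; apply: filterS (h _ e0) => t /= ut; rewrite -rmorphB cabsR ler_norml.
have := cabs_triang (u t) l 0; have := cabs_triang l (u t) 0.
by rewrite !subr0 (cabs_distC l) => h1 h2; apply/andP; split; lra.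
Qed.

Lemma flim_Re T (F : set_system T) {FF : Filter F} (u : T -> C) l :
  flim F u l -> flim F (fun t => (complex.Re (u t))%:C) (complex.Re l)%:C.
Proof.
move=> h e e0; apply: filterS (h _ e0) => t /= ut; rewrite -rmorphB cabsR.
have re (a b : C) : complex.Re a - complex.Re b = complex.Re (a - b) by case: a b => ? ? [? ?].
by rewrite re; apply: le_trans (cabs_Re _) ut.
Qed.

Lemma flim_conj T (F : set_system T) {FF : Filter F} (u : T -> C) l :
  flim F u l -> flim F (fun t => Num.conj (u t)) (Num.conj l).
Proof. by move=> h e /h; apply: filterS => t /=; rewrite -rmorphB cabsJ. Qed.

Lemma realC2 : (2 : R)%:C = 2 :> C.
Proof. by rewrite -[LHS]/(real_complex R 2%:R) rmorph_nat. Qed.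

Lemma realC_2D (x y : R) : (2 * (x + y))%:C = 2 * (x%:C + y%:C) :> C.
Proof. by rewrite -realC2 -(rmorphD (real_complex R)) -(rmorphM (real_complex R)). Qed.

(* The principal square root, in closed form, away from the negative real axis. *)
Definition psqrt (a : C) : C :=
  (a + (cabs a)%:C) / (Num.sqrt (2 * (cabs a + complex.Re a)))%:C.

Lemma psqrt_den (a : C) : 0 < complex.Re a -> 0 < 2 * (cabs a + complex.Re a).
Proof. by move=> a0; rewrite mulr_gt0 // ltr_wpDl ?cabs_ge0. Qed.

Lemma psqrt_denC (a : C) : 0 < complex.Re a ->
  (Num.sqrt (2 * (cabs a + complex.Re a)))%:C != 0 :> C.
Proof.
by move=> a0; rewrite -cabs_gt0 cabsR normr_gt0 gt_eqF // sqrtr_gt0 psqrt_den.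
Qed.

Lemma psqrt_sqr (a : C) : 0 < complex.Re a -> psqrt a ^+ 2 = a.
Proof.
move=> a0; rewrite /psqrt expr_div_n -rmorphXn /= sqr_sqrtr ?ltW ?psqrt_den //.
apply: (canLR (mulfK _)).
  by rewrite -cabs_gt0 cabsR normr_gt0 gt_eqF // psqrt_den.
have h1 : (cabs a)%:C ^+ 2 = a * a^* by rewrite -normE -normCK.
have h2 : 2 * (complex.Re a)%:C = a + a^*.
  rewrite complexRe ReE; by rewrite mulrC divfK // pnatr_eq0.
have -> : (2 * (cabs a + complex.Re a))%:C = 2 * (cabs a)%:C + (a + a^*) :> C.
  by rewrite -h2 realC_2D mulrDr.
by rewrite sqrrD h1; ring.
Qed.

Lemma flim_psqrt T (F : set_system T) {FF : Filter F} (u : T -> C) l :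
  0 < complex.Re l -> flim F u l -> flim F (fun t => psqrt (u t)) (psqrt l).
Proof.
move=> l0 h; have hc := flim_cabs h; have hr := flim_Re h.
apply: flimM; first by apply: flimD => //; exact: flim_cabs.
apply: flimV; first exact: psqrt_denC.
apply: (@flim_real _ _ _ (fun t => 2 * (cabs (u t) + complex.Re (u t))) _ Num.sqrt).
  exact: sqrt_continuous.
have -> : (2 * (cabs l + complex.Re l))%:C = 2 * ((cabs l)%:C + (complex.Re l)%:C) :> C.
  exact: realC_2D.
apply: (@flim_ext _ _ _ _ (fun t => 2 * ((cabs (u t))%:C + (complex.Re (u t))%:C))).
  by apply: filterE => t; rewrite realC_2D.
by apply: flimZ; apply: flimD; [exact: flim_cabs|exact: flim_Re].
Qed.

Lemma psqrt1 : psqrt 1 = 1.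
Proof.
rewrite /psqrt cabs1 /= -[2 * (1 + 1)]/(2 * 2%:R) -expr2 sqrtr_sqr ger0_norm // rmorph_nat.
by rewrite rmorph1 -[1 + 1]/(2%:R) mulfV // pnatr_eq0.
Qed.

(** Since [psqrt (1 + h) ^+ 2 = 1 + h], the difference quotient at 1 is
    [1 / (1 + psqrt (1 + h))]. *)
Lemma psqrt_cderiv1 : cderiv psqrt 1 (2^-1).
Proof.
have psq : flim small (fun h : C => psqrt (1 + h)) 1.
  rewrite -[X in flim _ _ X]psqrt1; apply: flim_psqrt => /=; first exact: ltr01.
  have h : flim small (fun h : C => 1 + h) (1 + 0) by apply: flimD; [exact: flim_cst|exact: flim_id0].
  by rewrite addr0 in h.
apply/cderivP; exists (fun h => (1 + psqrt (1 + h))^-1); split; last first.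
  have -> : 2^-1 = (1 + 1)^-1 :> C by [].
  apply: flimV; first by rewrite -[1 + 1]/(2%:R) pnatr_eq0.
  by apply: flimD => //; exact: flim_cst.
have n0 : \forall h \near small, 1 + psqrt (1 + h) != 0 :> C.
  apply: (@flim_neq0 _ _ _ _ _ (1 + 1)); first by rewrite -[1 + 1]/(2%:R) pnatr_eq0.
  by apply: flimD => //; exact: flim_cst.
apply: filterS2 n0 (small_lt (@ltr01 R)) => h h0 h1; rewrite psqrt1.
have := @psqrt_sqr (1 + h).
have re : 0 < complex.Re (1 + h).
  have := cabs_Re h; rewrite ler_norml; case: h {h0} h1 => a b /= h1 /andP[h2 _]; lra.
move=> /(_ re); move: (psqrt _) h0 => S h0 hs.
by apply: (mulfI h0); rewrite mulrDr mulr1 mulrCA mulfV // mulr1 mulrDl mul1r -expr2 hs; ring.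
Qed.

Lemma flim_det T (F : set_system T) {FF : Filter F} k (M : T -> 'M[C]_k) (L : 'M[C]_k) :
  (forall i j, flim F (fun t => M t i j) (L i j)) ->
  flim F (fun t => \det (M t)) (\det L).
Proof.
move=> h; apply: flim_sum => s; apply: flimM; first exact: flim_cst.
by apply: flim_prod => i; exact: h.
Qed.

Lemma flim_mulmx T (F : set_system T) {FF : Filter F} a b c (M : T -> 'M[C]_(a, b))
    (N : T -> 'M[C]_(b, c)) (L : 'M[C]_(a, b)) (K : 'M[C]_(b, c)) :
  (forall i j, flim F (fun t => M t i j) (L i j)) ->
  (forall i j, flim F (fun t => N t i j) (K i j)) ->
  forall i j, flim F (fun t => (M t *m N t) i j) ((L *m K) i j).
Proof.
move=> hM hN i j; rewrite mxE; under eq_fun do rewrite mxE.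
by apply: flim_sum => l; exact: flimM.
Qed.

Lemma invmxE k (M : 'M[C]_k) i j : M \in unitmx ->
  invmx M i j = (\det M)^-1 * cofactor M j i.
Proof. by move=> uM; rewrite /invmx uM !mxE. Qed.

Lemma flim_invmx T (F : set_system T) {FF : Filter F} k (M : T -> 'M[C]_k) (L : 'M[C]_k) :
  L \in unitmx -> (forall i j, flim F (fun t => M t i j) (L i j)) ->
  forall i j, flim F (fun t => invmx (M t) i j) (invmx L i j).
Proof.
move=> uL h i j; have hd : flim F (fun t => \det (M t)) (\det L) by exact: flim_det.
have dL : \det L != 0 by rewrite -unitfE -unitmxE.
have dM : \forall t \near F, \det (M t) != 0 by exact: flim_neq0 dL hd.
apply: (@flim_ext _ _ _ _ (fun t => (\det (M t))^-1 * cofactor (M t) j i)).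
  by apply: filterS dM => t dt; rewrite invmxE // unitmxE unitfE.
rewrite invmxE //; apply: flimM; first exact: flimV.
apply: flimM; first exact: flim_cst.
by apply: flim_det => a b; rewrite !mxE; under eq_fun do rewrite !mxE; exact: h.
Qed.

(** Entries are indexed by natural numbers, with value 0 out of range, so that leading blocks of all
    sizes are typed without casts. *)
Definition ncoef n (M : 'M[C]_n) (a b : nat) : C :=
  match (insub a : option 'I_n), (insub b : option 'I_n) with
  | Some i, Some j => M i j | _, _ => 0 end.
Definition lminor_mx n (M : 'M[C]_n) k : 'M[C]_k := \matrix_(i, j) ncoef M i j.
Definition lminor n (M : 'M[C]_n) k : C := \det (lminor_mx M k).

(** Positivity of the real part replaces positive definiteness: [1%:M - V *m conjmat W] is in
    general not Hermitian when [V] and [W] differ. *)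
Definition accretive k (M : 'M[C]_k) := forall x : 'rV[C]_k, x != 0 ->
  0 < complex.Re ((x *m M *m (conjmat x)^T) 0 0).

Lemma ncoef_ord n (M : 'M[C]_n) (i j : 'I_n) : ncoef M i j = M i j.
Proof. by rewrite /ncoef !valK. Qed.

Lemma lminor_full n (M : 'M[C]_n) : lminor M n = \det M.
Proof. by congr (\det _); apply/matrixP => i j; rewrite mxE ncoef_ord. Qed.

Lemma lminor0 n (M : 'M[C]_n) : lminor M 0 = 1.
Proof. exact: det_mx00. Qed.

Lemma accretive_unit k (M : 'M[C]_k) : accretive M -> M \in unitmx.
Proof.
move=> h; rewrite -row_free_unit -kermx_eq0; apply/negPn/negP => /rowV0Pn[v /sub_kermxP vM v0].
by have := h v v0; rewrite vM mul0mx mxE /= ltxx.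
Qed.

(** The form of a leading block is that of [M] on vectors extended by 0. *)
Lemma accretive_lminor n (M : 'M[C]_n) k : (k <= n)%N -> accretive M -> accretive (lminor_mx M k).
Proof.
move=> kn hM x x0; pose w := widen_ord kn.
pose X : 'rV[C]_n := x *m \matrix_(i, j) (w i == j)%:R.
have X0 : X != 0.
  apply: contra x0 => /eqP X0; apply/eqP/rowP => i; have /rowP/(_ (w i)) := X0.
  rewrite !mxE (bigD1 i) //= mxE eqxx mulr1 big1 ?addr0 // => j ji.
  by rewrite mxE (_ : (w j == w i) = false) ?mulr0 //; apply/negbTE; apply: contra ji => /eqP/(congr1 val)/= h; apply/eqP/val_inj.
have := hM X X0; rewrite (_ : X *m M *m _ = x *m lminor_mx M k *m (conjmat x)^T) //.
pose P : 'M[C]_(k, n) := \matrix_(i, j) (w i == j)%:R.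
have Pr : conjmat P = P by apply/matrixP => i j; rewrite !mxE rmorph_nat.
have -> : lminor_mx M k = P *m M *m P^T.
  apply/matrixP => i j; rewrite [RHS]mxE (bigD1 (w j)) //= big1 ?addr0 => [|l /negPf li].
    rewrite [P^T _ _]mxE [P _ _]mxE eqxx mulr1 [RHS]mxE (bigD1 (w i)) //= big1 ?addr0 => [|l /negPf li].
      by rewrite [P _ _]mxE eqxx mul1r mxE -ncoef_ord.
    by rewrite [P _ _]mxE eq_sym li mul0r.
  by rewrite [P^T _ _]mxE [P _ _]mxE eq_sym li mulr0.
by rewrite /X -/P conjmatM Pr trmx_mul !mulmxA.
Qed.

(* The quotient of consecutive leading minors is a diagonal entry of an inverse. *)
Lemma lminor_ratio n (M : 'M[C]_n) k : (k < n)%N -> accretive M ->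
  0 < complex.Re (lminor M k / lminor M k.+1).
Proof.
move=> kn hM; set N := lminor_mx M k.+1.
have hN : accretive N by exact: accretive_lminor.
have uN := accretive_unit hN.
have -> : lminor M k / lminor M k.+1 = invmx N ord_max ord_max.
  rewrite invmxE // mulrC; congr (_ * _); rewrite /cofactor -signr_odd oddD addbb expr0 mul1r.
  rewrite /lminor; have -> : lminor_mx M k = row' ord_max (col' ord_max N) :> 'M[C]_k; last by [].
  by apply/matrixP => i j; rewrite [LHS]mxE 3!mxE !lift_max.
pose y : 'rV[C]_k.+1 := delta_mx 0 ord_max *m invmx N.
have yN : y *m N = delta_mx 0 ord_max by rewrite /y mulmxKV.
have y0 : y != 0.
  apply/eqP => y0; move: yN; rewrite y0 mul0mx => /rowP/(_ ord_max); rewrite !mxE !eqxx /= => /eqP.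
  by rewrite eq_sym oner_eq0.
have := hN y y0; rewrite yN.
have -> : ((delta_mx 0 ord_max : 'rV[C]_k.+1) *m (conjmat y)^T) 0 0 = Num.conj (y 0 ord_max).
  by rewrite -rowE [LHS]mxE [LHS]mxE [LHS]mxE.
have -> : invmx N ord_max ord_max = y 0 ord_max by rewrite /y -rowE mxE.
by case: (y 0 ord_max).
Qed.

End SquareRoot.

(** * The branch of the inverse square root of the determinant *)

Section Branch.
Variables (R : realType) (n : nat).
Notation C := R[i].
Implicit Types (W V : 'M[C]_n).

Lemma Re_conj_le (a b : C) : complex.Re (a * Num.conj b) <= (cabs a ^+ 2 + cabs b ^+ 2) / 2.
Proof.
have := cabs_Re (a * Num.conj b); rewrite cabsM cabsJ ler_norml => /andP[_ h].
apply: le_trans h _; have := sqr_ge0 (cabs a - cabs b); nra.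
Qed.

(** The subtracted term is the scalar product of [x V] and [x W], bounded by the mean of two squared
    norms that are both below that of [x]. *)
Lemma accretive_siegel V W : siegel_disk V -> siegel_disk W -> accretive (1%:M - V *m conjmat W).
Proof.
move=> DV DW x x0; have [Ws hW] := (siegelP W).1 DW; have [_ hV] := (siegelP V).1 DV.
have -> : (x *m (1%:M - V *m conjmat W) *m (conjmat x)^T) 0 0 =
    (nsq x)%:C - \sum_i (x *m V) 0 i * Num.conj ((x *m W) 0 i).
  have -> : \sum_i (x *m V) 0 i * Num.conj ((x *m W) 0 i) = ((x *m V) *m (conjmat (x *m W))^T) 0 0.
    by rewrite mxE; apply: eq_bigr => i _; congr (_ * _); rewrite [RHS]mxE [RHS]mxE.
  rewrite mulmxBr mulmx1 mulmxBl [LHS]mxE [X in _ + X = _]mxE nsqE; congr (_ - _).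
  by rewrite conjmatM trmx_mul -(conjmat_tr W) Ws !mulmxA.
have ReB (a : R) (b : C) : complex.Re (a%:C - b) = a - complex.Re b by case: b.
have Resum (I : finType) (F : I -> C) : complex.Re (\sum_i F i) = \sum_i complex.Re (F i).
  by elim/big_rec2: _ => // i y z _ <-; case: (F i) => ? ?; case: z.
rewrite ReB Resum subr_gt0; apply: (@le_lt_trans _ _ ((nsq (x *m V) + nsq (x *m W)) / 2)).
  rewrite /nsq -big_split mulr_suml; apply: ler_sum => i _; exact: Re_conj_le.
by have := hW x x0; have := hV x x0; lra.
Qed.

Lemma accretive_det k (M : 'M[C]_k) : accretive M -> \det M != 0.
Proof. by move/accretive_unit; rewrite unitmxE unitfE. Qed.

(* A continuous square root of the inverse determinant: the ratios of
   consecutive leading minors lie in the right half-plane. *)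
Definition det_root (M : 'M[C]_n) : C := \prod_(k < n) psqrt (lminor M k / lminor M k.+1).

(** The squared factors telescope from the minor of size 0, which is 1, to the determinant. *)
Lemma det_root_sqr (M : 'M[C]_n) : accretive M -> det_root M ^+ 2 = (\det M)^-1.
Proof.
move=> hM; rewrite /det_root -prodrXl.
under eq_bigr => k _ do rewrite psqrt_sqr ?lminor_ratio //.
rewrite -(big_mkord xpredT (fun k => lminor M k / lminor M k.+1)).
have l0 k : (k <= n)%N -> (lminor M k)^-1 != 0.
  by move=> kn; rewrite invr_eq0; apply: accretive_det; exact: accretive_lminor.
have tele N (f : nat -> C) : f 0%N = 1 -> (forall k, (k <= N)%N -> f k != 0) ->
    \prod_(0 <= k < N) (f k.+1 / f k) = f N.
  case: N => [|N] f0 hf; first by rewrite big_geq.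
  by rewrite telescope_prodf ?f0 ?divr1 // => k /andP[_ kN]; apply: hf; exact: ltnW.
rewrite -lminor_full -(tele n (fun k => (lminor M k)^-1)) ?lminor0 ?invr1 //.
by apply: eq_bigr => k _; rewrite invrK mulrC.
Qed.

Lemma det_root1 : det_root 1%:M = 1.
Proof.
rewrite /det_root big1 // => k _.
have h i : (i <= n)%N -> lminor (1%:M : 'M[C]_n) i = 1.
  move=> iN; rewrite /lminor (_ : lminor_mx _ _ = 1%:M) ?det1 //.
  apply/matrixP => a b; rewrite !mxE.
  by rewrite -[ncoef _ a b]/(ncoef _ (widen_ord iN a) (widen_ord iN b)) ncoef_ord mxE.
by rewrite !h ?divr1 ?psqrt1 // ltnW.
Qed.

Lemma flim_det_root T (F : set_system T) {FF : Filter F} (M : T -> 'M[C]_n) (L : 'M[C]_n) :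
  accretive L -> (forall i j, flim F (fun t => M t i j) (L i j)) ->
  flim F (fun t => det_root (M t)) (det_root L).
Proof.
move=> hL hM.
have hm k : flim F (fun t => lminor (M t) k) (lminor L k).
  apply: flim_det => i j; rewrite mxE; under eq_fun do rewrite mxE.
  rewrite /ncoef; case: insub => [a|]; last exact: flim_cst.
  by case: insub => [b|]; [exact: hM|exact: flim_cst].
apply: flim_prod => k; apply: flim_psqrt; first by apply: lminor_ratio.
apply: flimM; first exact: hm; apply: flimV; last exact: hm.
by apply: accretive_det; exact: accretive_lminor.
Qed.

Lemma flim_coord T (F : set_system T) {FF : Filter F} a b (u : T -> 'M[C]_(a, b)) (l : 'M[C]_(a, b)) i j :
  u @ F --> l -> flim F (fun t => u t i j) (l i j).
Proof.
move=> h; apply/flimP.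
exact: (@cvg_comp _ _ _ u (fun M : 'M[C]_(a, b) => M i j) F (nbhs l) (nbhs (l i j)) h (@coord_continuous _ _ _ i j l)).
Qed.

Lemma flim_oneB T (F : set_system T) {FF : Filter F} a b (u v : T -> 'M[C]_(a, b)) (l k : 'M[C]_(a, b)) :
  (forall i j, flim F (fun t => u t i j) (l i j)) -> (forall i j, flim F (fun t => v t i j) (k i j)) ->
  forall i j, flim F (fun t => (u t - v t) i j) ((l - k) i j).
Proof.
move=> hu hv i j; rewrite !mxE; under eq_fun do rewrite !mxE.
by apply: flimD => //; exact: flimN.
Qed.

Lemma flim_conjmx T (F : set_system T) {FF : Filter F} a b (u : T -> 'M[C]_(a, b)) (l : 'M[C]_(a, b)) :
  (forall i j, flim F (fun t => u t i j) (l i j)) ->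
  forall i j, flim F (fun t => conjmat (u t) i j) (conjmat l i j).
Proof. by move=> h i j; rewrite mxE; under eq_fun do rewrite mxE; exact: flim_conj. Qed.

Lemma flim_det_root_siegel T (F : set_system T) {FF : Filter F} (u v : T -> 'M[C]_n) V W :
  siegel_disk V -> siegel_disk W -> u @ F --> V -> v @ F --> W ->
  flim F (fun t => det_root (1%:M - u t *m conjmat (v t))) (det_root (1%:M - V *m conjmat W)).
Proof.
move=> DV DW uV vW; apply: flim_det_root; first exact: accretive_siegel.
apply: flim_oneB => [i j|]; first exact: flim_cst.
apply: flim_mulmx => [i j|]; first exact: flim_coord.
by apply: flim_conjmx => i j; exact: flim_coord.
Qed.

(** [xget] returns a function with the three properties as soon as one exists, and [det_root]
    provides it. Later arguments rely on these properties alone. *)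
Lemma det_invsqrtP :
  [/\ {within (@siegel_disk R n) `*` (@siegel_disk R n), continuous (@det_invsqrt R n)},
      forall V W, siegel_disk V -> siegel_disk W ->
        det_invsqrt (V, W) ^+ 2 = (\det (1%:M - V *m conjmat W))^-1
    & forall W, siegel_disk W -> det_invsqrt (0, W) = 1].
Proof.
rewrite /det_invsqrt; case: xgetP => [b _ //|] /(_ (fun t => det_root (1%:M - t.1 *m conjmat t.2)))[]; split=> /=.
- apply: continuous_in_subspaceT => -[V W]; rewrite inE => -[/= DV DW].
  have h := @flim_det_root_siegel _ (nbhs (V, W)) _ fst snd V W DV DW cvg_fst cvg_snd.
  have c := (@flimP _ _ (nbhs (V, W)) _ _ _).1 (h _ _ _); exact: c.
- by move=> V W DV DW; apply: det_root_sqr; exact: accretive_siegel.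
- by move=> W DW; rewrite mul0mx subr0 det_root1.
Qed.

End Branch.

(** * Differentiability of matrix expressions *)

Section Differentiable.
Variable R : realType.
Notation C := R[i].
Variable V : normedModType C.
Implicit Types (f g : V -> C) (p : V).

Lemma near_eq_differentiable f g p : {near p, f =1 g} -> differentiable f p -> differentiable g p.
Proof.
move=> fg df; have [cf ef] := (@diff_locallyP _ _ _ p f).1 df.
have fgp : f p = g p by have := nbhs_singleton fg.
have eg : g \o shift p = cst (g p) + 'd f p +o_ (0 : V) id.
  apply/eqaddoP => e e0; have := ef; move/eqaddoP/(_ e e0).
  have nh : \forall h \near (0 : V), f (h + p) = g (h + p).
    by have := fg; rewrite (near_shift 0) subr0.
  by apply: filterS2 nh => h; rewrite /= -fgp /shift !fctE /= => ->.
have du := diff_unique cf eg.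
by apply/diff_locallyP; rewrite du; split.
Qed.

Lemma cderiv_differentiable (f : C -> C) (t l : C) : cderiv f t l -> differentiable f t.
Proof.
move=> h; apply/derivable1_diffP.
have := @cderiv_is_derive R C f t 1 l.
have e : (fun h => f (t + h *: 1)) = (fun h => f (h + t)) by apply/funext => x; rewrite [_ *: _]mulr1 addrC.
rewrite e => k; have [] := k _ => //.
by apply/cderiv_shift; rewrite add0r.
Qed.

Lemma differentiable_prodf (I : Type) (s : seq I) (F : I -> V -> C) p :
  (forall i, differentiable (F i) p) -> differentiable (fun q => \prod_(i <- s) F i q) p.
Proof.
move=> h; elim: s => [|i s IH].
  by under eq_fun do rewrite big_nil; exact: differentiable_cst.
by under eq_fun do rewrite big_cons; exact: differentiableM.
Qed.

Lemma differentiable_sumf (I : Type) (s : seq I) (F : I -> V -> C) p :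
  (forall i, differentiable (F i) p) -> differentiable (fun q => \sum_(i <- s) F i q) p.
Proof.
move=> h; elim: s => [|i s IH].
  by under eq_fun do rewrite big_nil; exact: differentiable_cst.
by under eq_fun do rewrite big_cons; exact: differentiableD.
Qed.

Lemma differentiable_mx_mul a b c (M : V -> 'M[C]_(a, b)) (N : V -> 'M[C]_(b, c)) p :
  (forall i j, differentiable (fun q => M q i j) p) -> (forall i j, differentiable (fun q => N q i j) p) ->
  forall i j, differentiable (fun q => (M q *m N q) i j) p.
Proof.
move=> hM hN i j; under eq_fun do rewrite mxE.
by apply: differentiable_sumf => k; exact: differentiableM.
Qed.

Lemma differentiable_det k (M : V -> 'M[C]_k) p :
  (forall i j, differentiable (fun q => M q i j) p) -> differentiable (fun q => \det (M q)) p.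
Proof.
move=> hM; apply: differentiable_sumf => s; apply: differentiableM; first exact: differentiable_cst.
by apply: differentiable_prodf => i; exact: hM.
Qed.

Lemma differentiable_inv f p : f p != 0 -> differentiable f p -> differentiable (fun q => (f q)^-1) p.
Proof. by move=> f0 df; exact: differentiableV. Qed.

Lemma differentiable_invmx k (M : V -> 'M[C]_k) p : M p \in unitmx ->
  (forall i j, differentiable (fun q => M q i j) p) ->
  forall i j, differentiable (fun q => invmx (M q) i j) p.
Proof.
move=> uM hM i j.
have dM : differentiable (fun q => \det (M q)) p by exact: differentiable_det.
have d0 : \det (M p) != 0 by rewrite -unitfE -unitmxE.
have n0 : \forall q \near p, \det (M q) != 0.
  have fl := (@flimP R _ (nbhs p) _ (fun q => \det (M q)) (\det (M p))).2 (differentiable_continuous dM).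
  exact: flim_neq0 d0 (fl _).
apply: (@near_eq_differentiable (fun q => (\det (M q))^-1 * cofactor (M q) j i)).
  by apply: filterS n0 => q dq; rewrite invmxE // unitmxE unitfE.
apply: differentiableM; first exact: differentiable_inv.
apply: differentiableM; first exact: differentiable_cst.
apply: differentiable_det => a b; under eq_fun do rewrite !mxE; exact: hM.
Qed.

End Differentiable.

(** * Holomorphy of the kernel in its first argument *)

Section KernelHolomorphic.
Variables (R : realType) (n : nat).
Notation C := R[i].
Implicit Types (W V U : 'M[C]_n) (q : sjpoint R n).

(** The quotient [r] of the two sides has square 1 and tends to 1 at [V], so it is 1 nearby. The
    formula makes the branch differentiable at [V] through the derivative of [psqrt] at 1. *)
Lemma det_invsqrt_local V W : siegel_disk V -> siegel_disk W -> nbhs V [set U | U^T = U ->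
  siegel_disk U /\ det_invsqrt (U, W) = det_invsqrt (V, W) *
    psqrt (\det (1%:M - V *m conjmat W) / \det (1%:M - U *m conjmat W))].
Proof.
move=> DV DW; have [bc bs _] := det_invsqrtP R n.
set b0 := det_invsqrt (V, W); set D := fun U => \det (1%:M - U *m conjmat W).
have dD U : siegel_disk U -> D U != 0 by move=> DU; apply: accretive_det; exact: accretive_siegel.
pose F := within (@siegel_disk R n) (nbhs V).
have FF : Filter F by exact: within_filter.
have FV : (id : 'M[C]_n -> 'M[C]_n) @ F --> V by exact: cvg_within.
have fb : flim F (fun U => det_invsqrt (U, W)) b0.
  have bVW := (subspace_continuousP _ _).1 bc (V, W) (conj DV DW).
  move=> e e0; have /flimP/(_ e e0) := bVW => hb.
  rewrite /F /within /=; case: hb => -[A B] [/= hA hB] AB.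
  apply: filterS hA => U AU DU.
  exact: AB (U, W) (conj AU (nbhs_singleton hB)) (conj DU DW).
have fD : flim F D (D V).
  apply: flim_det; apply: flim_oneB => [i j|]; first exact: flim_cst.
  apply: flim_mulmx => i j; last exact: flim_cst.
  exact: (@flim_coord _ _ F _ _ _ id V).
have fr : flim F (fun U => D V / D U) 1.
  rewrite -(divff (dD _ DV)); apply: flimM; first exact: flim_cst.
  by apply: flimV => //; exact: dD.
have fp : flim F (fun U => psqrt (D V / D U)) 1.
  by rewrite -[X in flim _ _ X]psqrt1; apply: flim_psqrt => //=; exact: ltr01.
have b00 : b0 != 0.
  have := bs _ _ DV DW; rewrite -/b0 => hb; rewrite -sqrf_eq0 hb invr_eq0; exact: dD.
have fq : flim F (fun U => det_invsqrt (U, W) / b0 / psqrt (D V / D U)) 1.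
  have -> : 1 = b0 / b0 / 1 :> C by rewrite divr1 divff.
  apply: flimM; last by apply: flimV => //; exact: oner_neq0.
  by apply: flimM => //; exact: flim_cst.
have near_sym : nbhs V [set U | U^T = U -> siegel_disk U].
  have [d d0 hd] := siegel_open DV.
  have D0 : siegel_jacobi_disk (V, 0 : 'rV[C]_n) by exact: (conj DV I).
  have [[A B] [/= hA hB] AB] := sj_nbhs_close (V, 0 : 'rV[C]_n) d0.
  apply: filterS hA => U AU Us; apply: hd => // i j.
  by have [/(_ i j)] := AB (U, 0) (conj AU (nbhs_singleton hB)).
have h2 : 0 < (1 / 2 : R) by rewrite divr_gt0.
apply: filterS3 near_sym (fq _ ltr01) (fr _ h2) => U US rU qU Us.
have DU := US Us; split=> //; move: (rU DU) (qU DU) => /=.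
set r := _ / _ / _ => r1 q1.
have re : 0 < complex.Re (D V / D U).
  have := cabs_Re (D V / D U - 1); move: (D V / D U) q1 => x q1; case: x q1 => a b q1.
  by rewrite ler_norml /= => /andP[h _]; lra.
have ps := psqrt_sqr re.
have p0 : psqrt (D V / D U) != 0.
  by rewrite -sqrf_eq0 ps; apply: mulf_neq0; rewrite ?invr_eq0; exact: dD.
have r2 : r ^+ 2 = 1.
  rewrite /r; move: (psqrt _) ps p0 => P ps _; rewrite !expr_div_n ps bs // bs // -/(D V) -/(D U) invrK.
  have := dD _ DV; have := dD _ DU; move: (D U) (D V) => x y x0 y0.
  by field; rewrite x0 y0.
have : r = 1.
  apply/eqP; have /eqP := r2; rewrite sqrf_eq1 => /orP[//|/eqP rN].
  by move: r1; rewrite rN -opprD cabsN -[1 + 1]/(2%:R) -realC2 cabsR ger0_norm // => h; lra.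
by rewrite /r => /(canRL (mulfVK p0)); rewrite mul1r => /(canRL (mulfVK b00)) ->; rewrite mulrC.
Qed.

End KernelHolomorphic.

Section KernelDifferentiable.
Variables (R : realType) (n : nat).
Notation C := R[i].
Implicit Types (W V U : 'M[C]_n) (p q : sjpoint R n).

Lemma nbhs_symU (A : set (sjpoint R n)) q : q.1^T = q.1 -> nbhs q A ->
  nbhs q [set t : sjpoint R n | A (symU t.1, t.2)].
Proof.
move=> qs /sj_nbhsP[d d0 hd]; apply: filterS (sj_nbhs_close q d0) => t [h1 h2].
apply: hd => //= i j; rewrite mxE; case: ifP => _ //.
by rewrite -{1}qs mxE.
Qed.

Lemma nbhs_fst (A : set 'M[C]_n) q : nbhs q.1 A -> nbhs q [set t : sjpoint R n | A t.1].
Proof. by case: q => V z hA; exists (A, setT); [split=> //; exact: filterT|move=> t []]. Qed.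

Lemma differentiable_fst_coord i j q : differentiable (fun t : sjpoint R n => t.1 i j) q.
Proof.
have h : differentiable (fst : sjpoint R n -> 'M[C]_n) q.
  by apply: (@linear_differentiable _ _ _ (fst : {linear sjpoint R n -> 'M[C]_n}) q) => t; exact: cvg_fst.
exact: (differentiable_comp h (@differentiable_coord _ _ _ q.1 i j)).
Qed.

Lemma differentiable_snd_coord i j q : differentiable (fun t : sjpoint R n => t.2 i j) q.
Proof.
have h : differentiable (snd : sjpoint R n -> 'rV[C]_n) q.
  by apply: (@linear_differentiable _ _ _ (snd : {linear sjpoint R n -> 'rV[C]_n}) q) => t; exact: cvg_snd.
exact: (differentiable_comp h (@differentiable_coord _ _ _ q.2 i j)).
Qed.

Lemma differentiable_symU i j q : differentiable (fun t : sjpoint R n => symU t.1 i j) q.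
Proof.
under eq_fun do rewrite mxE.
by case: (i <= j)%N; exact: differentiable_fst_coord.
Qed.

Lemma differentiable_oneB W q : forall i j,
  differentiable (fun t : sjpoint R n => (1%:M - symU t.1 *m conjmat W) i j) q.
Proof.
move=> i j; under eq_fun do rewrite mxE [X in _ + X]mxE.
apply: (@differentiableB _ _ _ (fun=> _)); first exact: differentiable_cst.
apply: differentiable_mx_mul => a b; first exact: differentiable_symU.
exact: differentiable_cst.
Qed.

Lemma siegel_unit2 V W : siegel_disk V -> siegel_disk W -> 1%:M - V *m conjmat W \in unitmx.
Proof. by move=> DV DW; apply: accretive_unit; exact: accretive_siegel. Qed.

Lemma differentiable_Aform p q : siegel_jacobi_disk p -> siegel_jacobi_disk q ->
  differentiable (fun t : sjpoint R n => Aform (symU t.1, t.2) p) q.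
Proof.
case: p => W z Dp Dq; rewrite /Aform.
have dc a b (M : 'M[C]_(a, b)) i j : differentiable (fun t : sjpoint R n => M i j) q.
  exact: differentiable_cst.
have dQ : forall i j, differentiable (fun t : sjpoint R n => invmx (1%:M - symU t.1 *m conjmat W) i j) q.
  apply: differentiable_invmx; last exact: differentiable_oneB.
  rewrite symU_id; last exact: siegel_sym.
  exact: siegel_unit2 Dq.1 Dp.1.
have dtr : forall i j, differentiable (fun t : sjpoint R n => (t.2)^T i j) q.
  by move=> i j; under eq_fun do rewrite mxE; exact: differentiable_snd_coord.
apply: differentiableD.
  apply: differentiable_mx_mul dtr _ _; apply: differentiable_mx_mul dQ => i j.
  under eq_fun do rewrite mxE [X in _ + X]mxE.
  apply: (@differentiableD _ _ _ (fun=> _)); first exact: differentiable_cst.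
  apply: differentiableM; first exact: differentiable_cst.
  apply: differentiable_mx_mul => a b; first exact: differentiable_snd_coord.
  exact: differentiable_cst.
apply: differentiableM; first exact: differentiable_cst.
apply: differentiable_mx_mul (dc _ _ _) _ _.
apply: differentiable_mx_mul => a b; last exact: differentiable_symU.
exact: differentiable_mx_mul (dc _ _ _) dQ _ _.
Qed.

Variable m : R.

Lemma kernel_holomorphic p : siegel_jacobi_disk p -> holomorphic ((kernel_fun m)^~ p).
Proof.
move=> Dp q Dq; have qs := siegel_sym Dq.
pose D V := \det (1%:M - V *m conjmat p.1).
have dD : D q.1 != 0 by apply: accretive_det; apply: accretive_siegel; [exact: Dq.1|exact: Dp.1].
(* [symU] is kept because [f] must agree with [in_coords] of the kernel on a full neighborhood,
   non-symmetric matrices included. *)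
pose f (t : sjpoint R n) := det_invsqrt (q.1, p.1) * psqrt (D q.1 / D (symU t.1)) *
  expC ((8 * pi * m)%:C * Aform (symU t.1, t.2) p).
apply: (@near_eq_differentiable _ _ f).
  have h := nbhs_symU qs (nbhs_fst (det_invsqrt_local Dq.1 Dp.1)).
  apply: filterS h => t /= /(_ (symU_sym _))[_ h].
  by rewrite /f /in_coords /kernel_fun /= h.
have dexp (t : C) : differentiable (@expC R) t by exact: cderiv_differentiable (cderiv_expC t).
apply: differentiableM; last first.
  apply: (@differentiable_comp _ _ _ _ (fun t => (8 * pi * m)%:C * Aform (symU t.1, t.2) p) (@expC R)).
    by apply: differentiableM; [exact: differentiable_cst|exact: differentiable_Aform].
  exact: dexp.
apply: differentiableM; first exact: differentiable_cst.
apply: (@differentiable_comp _ _ _ _ (fun t : sjpoint R n => D q.1 / D (symU t.1)) (@psqrt R)).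
  apply: differentiableM; first exact: differentiable_cst.
  apply: differentiable_inv; first by rewrite symU_id.
  apply: differentiable_det; exact: differentiable_oneB.
rewrite (symU_id qs) (divff dD); exact: cderiv_differentiable (@psqrt_cderiv1 R).
Qed.

End KernelDifferentiable.

(** * Resolvent identities and the derivative of the determinant *)

Section KernelAlgebra.
Variables (R : realType) (n : nat).
Notation C := R[i].
Implicit Types (S V E : 'M[C]_n) (u x y : 'rV[C]_n).

Lemma cderiv_prod (I : eqType) (s : seq I) (f : I -> C -> C) (t : C) (l : I -> C) : uniq s ->
  (forall i, cderiv (f i) t (l i)) ->
  cderiv (fun h => \prod_(i <- s) f i h) t (\sum_(i <- s) l i * \prod_(j <- s | j != i) f j t).
Proof.
move=> us hf; elim: s us => [_|i s IH /= /andP[si us]].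
  by rewrite big_nil; under eq_fun do rewrite big_nil; exact: cderiv_cst.
under eq_fun do rewrite big_cons.
have := cderivM (hf i) (IH us); congr (cderiv _ _ _).
rewrite [RHS]big_cons big_cons eqxx /=; congr (_ * _ + _).
  rewrite big_seq [RHS]big_seq_cond; apply: eq_big => j; last by [].
  by case: eqVneq => [->|]; rewrite ?andbT // (negPf si).
rewrite mulr_sumr; under [RHS]eq_bigr => j _ do rewrite big_cons.
rewrite [LHS]big_seq [RHS]big_seq; apply: eq_bigr => j js.
rewrite ifT; first by rewrite mulrCA.
by apply: contra si => /eqP ->.
Qed.

(** Any permutation other than the identity moves at least two indices, and differentiation removes
    only one of the factors that vanish at 0. *)
Lemma cderiv_det1 (X : 'M[C]_n) : cderiv (fun h => \det (1%:M + h *: X)) 0 (\tr X).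
Proof.
have ent i j : cderiv (fun h => (1%:M + h *: X) i j) 0 (X i j).
  under eq_fun do rewrite !mxE.
  by have := cderivD (cderiv_cst (i == j)%:R 0) (cderivM (cderiv_id 0) (cderiv_cst (X i j) 0)); rewrite add0r mul1r mulr0 addr0.
have := cderiv_sum (index_enum {perm 'I_n}) (fun s : {perm 'I_n} => cderivZ ((-1) ^+ s)
  (@cderiv_prod _ (index_enum 'I_n) (fun i h => (1%:M + h *: X) i (s i)) 0 (fun i => X i (s i))
     (index_enum_uniq _) (fun i => ent i (s i)))).
congr (cderiv _ _ _); rewrite (bigD1 1%g) //= odd_perm1 expr0 mul1r [X in _ + X]big1 ?addr0.
  apply: eq_bigr => i _; rewrite perm1 big1 ?mulr1 // => j _.
  by rewrite perm1 !mxE mul0r addr0 eqxx.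
move=> s s1; rewrite big1 ?mulr0 // => i _.
have [j0 sj0] : exists j, s j != j.
  by apply/existsP; apply: contraR s1; rewrite negb_exists => /forallP h; apply/eqP/permP => j; rewrite perm1; apply/eqP/negPn/h.
have [j [ji sj]] : exists j, j != i /\ s j != j.
  have [e|ne] := eqVneq j0 i; last by exists j0.
  by exists (s j0); split; [rewrite -e|rewrite (inj_eq perm_inj)].
by rewrite (bigD1 j) //= !mxE eq_sym (negPf sj) mul0r addr0 mul0r mulr0.
Qed.

Definition resolvent S V : 'M[C]_n := invmx (1%:M - V *m S).

(** Transposition exchanges [V S] and [S V], and [(1 - S V)^-1 = 1 + S (1 - V S)^-1 V]. *)
Lemma resolvent_trE S V : S^T = S -> V^T = V -> 1%:M - V *m S \in unitmx ->
  (resolvent S V)^T = S *m resolvent S V *m V + 1%:M.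
Proof.
move=> Ss Vs uN; rewrite /resolvent trmx_inv.
have uNT : (1%:M - V *m S)^T \in unitmx by rewrite unitmx_tr.
rewrite -[LHS]mulmx1 -[RHS](mulKmx uNT); congr (_ *m _).
rewrite linearB /= trmx1 trmx_mul Ss Vs mulmxDr mulmx1.
rewrite mulmxBl mul1mx !mulmxA -(mulmxA (S *m V)) .
have -> : S *m V *m (S *m invmx (1%:M - V *m S)) = S *m invmx (1%:M - V *m S) - S.
  have VSQ : V *m S *m invmx (1%:M - V *m S) = invmx (1%:M - V *m S) - 1%:M.
    have := mulmxV uN; rewrite mulmxBl mul1mx; move: (invmx _) => Q <-.
    by rewrite opprB [RHS]addrC subrK.
  by rewrite -mulmxA (mulmxA V) VSQ mulmxBr mulmx1.
by rewrite mulmxBl; move: (S *m _) => T; rewrite opprB [X in _ = X + _]addrC subrK addrC subrK.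
Qed.

Lemma resolvent_sym S V : S^T = S -> V^T = V -> 1%:M - V *m S \in unitmx ->
  (S *m resolvent S V)^T = S *m resolvent S V.
Proof.
move=> Ss Vs uN; rewrite trmx_mul Ss resolvent_trE // mulmxDl mul1mx -!mulmxA.
rewrite -[X in _ + X]mulmx1 -mulmxDr; congr (_ *m _).
rewrite /resolvent -[X in _ + X](mulVmx uN) -mulmxDr.
by rewrite subrKC mulmx1.
Qed.

(** The second resolvent identity; being exact in [h], it gives the difference quotient along [E]
    without remainder. *)
Lemma resolvent_sub S V E (h : C) : 1%:M - V *m S \in unitmx -> 1%:M - (V + h *: E) *m S \in unitmx ->
  resolvent S (V + h *: E) - resolvent S V =
  h *: (resolvent S (V + h *: E) *m E *m (S *m resolvent S V)).
Proof.
move=> u0 u1; set P := resolvent _ (_ + _); set Q := resolvent S V.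
have -> : P - Q = P *m ((1%:M - V *m S) - (1%:M - (V + h *: E) *m S)) *m Q.
  by rewrite mulmxBr mulmxBl mulVmx // mul1mx -mulmxA mulmxV // mulmx1.
have -> : 1%:M - V *m S - (1%:M - (V + h *: E) *m S) = h *: (E *m S).
  by rewrite mulmxDl -scalemxAl opprB addrA subrKA addrAC subrr add0r.
by rewrite -scalemxAr -scalemxAl !mulmxA.
Qed.

End KernelAlgebra.

(** * Derivatives of the exponent of the kernel *)

Section KernelDerivatives.
Variables (R : realType) (n : nat).
Notation C := R[i].
Implicit Types (S V E : 'M[C]_n) (u x y : 'rV[C]_n).

Lemma near_line (T : normedModType C) (A : set T) (v e : T) : nbhs v A ->
  \forall h \near small, A (v + h *: e).
Proof.
move=> /nbhs_ballP[d /= d0 hd].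
have dd : d = (complex.Re d)%:C by rewrite RRe_real ?gtr0_real.
have ee : `|e| = (complex.Re `|e|)%:C by rewrite RRe_real ?ger0_real.
have e0 : 0 <= complex.Re `|e| by have := normr_ge0 e; rewrite ee lecR.
have e1 : 0 < complex.Re `|e| + 1 by rewrite ltr_wpDl.
exists (complex.Re d / (complex.Re `|e| + 1)) => [/=|h /= hh].
  by rewrite divr_gt0 // -ltcR -dd.
apply: hd; rewrite -ball_normE /= opprD addrA subrr sub0r normrN normrZ normE ee dd -rmorphM ltcR.
rewrite ltr_pdivlMr // in hh; apply: le_lt_trans hh.
by rewrite ler_wpM2l ?cabs_ge0 // lerDl.
Qed.

Lemma near_siegel_line V E : E^T = E -> siegel_disk V ->
  \forall h \near small, siegel_disk (V + h *: E).
Proof.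
move=> Es DV; have := near_line E (det_invsqrt_local DV DV); apply: filterS => h /= k.
by apply: (k _).1; rewrite linearD linearZ /= Es; have [-> _] := DV.
Qed.

Lemma flim_line a b (V E : 'M[C]_(a, b)) i j : flim small (fun h => (V + h *: E) i j) (V i j).
Proof.
under eq_fun do rewrite !mxE.
have h : flim small (fun h : C => V i j + h * E i j) (V i j + 0 * E i j).
  by apply: flimD; [exact: flim_cst|apply: flimM; [exact: flim_id0|exact: flim_cst]].
by rewrite mul0r addr0 in h.
Qed.

Variable p : sjpoint R n.
Hypothesis Dp : siegel_jacobi_disk p.
Implicit Types q : sjpoint R n.
Let S := conjmat p.1.
Let u0 := conjmat p.2.

Lemma conj_siegel_sym : S^T = S.
Proof. by rewrite /S -conjmat_tr (siegel_sym Dp). Qed.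
Let Ss := conj_siegel_sym.

Definition symres V := S *m resolvent S V.
(** The gradient of [Aform] in [z]; its derivatives in [W] turn out to be quadratic in the same
    vector. *)
Definition kernel_vec q : 'rV[C]_n := u0 *m resolvent S q.1 + q.2 *m symres q.1.

Lemma res_unit V : siegel_disk V -> 1%:M - V *m S \in unitmx.
Proof. by move=> DV; apply: siegel_unit2 DV Dp.1. Qed.

Lemma symres_sym V : siegel_disk V -> (symres V)^T = symres V.
Proof. by move=> DV; apply: resolvent_sym; [exact: Ss|have [] := DV|exact: res_unit]. Qed.

Lemma AformE V x : Aform (V, x) p = (u0 *m resolvent S V *m x^T) 0 0
  + 2^-1 * (x *m symres V *m x^T) 0 0 + 2^-1 * (u0 *m (resolvent S V *m V) *m u0^T) 0 0.
Proof.
have E (M N : 'M[C]_1) : (M + 2^-1 *: N) 0 0 = M 0 0 + 2^-1 * N 0 0 by rewrite !mxE.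
rewrite /Aform /symres /S /u0; case: (p) => W z; rewrite -/(resolvent _ _) !mulmxDl -!scalemxAl.
by rewrite (E _ (_ *m x^T)) !mulmxA.
Qed.

Lemma tr11 (M : 'M[C]_1) : M 0 0 = M^T 0 0. Proof. by rewrite mxE. Qed.

Lemma Aform_z q (l : 'I_n) (h : C) : siegel_jacobi_disk q ->
  Aform (q.1, q.2 + h *: delta_mx 0 l) p =
  Aform q p + h * (kernel_vec q 0 l + h * (2^-1 * symres q.1 l l)).
Proof.
case: q => V x [DV _]; rewrite /kernel_vec !AformE /= linearD /= [(h *: _)^T]linearZ /=.
rewrite /= in DV; set e : 'rV[C]_n := delta_mx 0 l; set T := symres V; set Q := resolvent S V.
have hl (y : 'rV[C]_n) : (y *m e^T) 0 0 = y 0 l by rewrite trmx_delta -colE mxE.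
have E1 : (e *m T *m x^T) 0 0 = (x *m T) 0 l.
  have Ts : T^T = T by exact: symres_sym.
  by rewrite tr11 trmx_mul trmxK (trmx_mul e) Ts mulmxA hl.
have E2 : (e *m T *m e^T) 0 0 = T l l by rewrite hl -rowE mxE.
have -> : (u0 *m Q *m (x^T + h *: e^T)) 0 0 = (u0 *m Q *m x^T) 0 0 + h * (u0 *m Q) 0 l.
  by rewrite mulmxDr -scalemxAr mxE [X in _ + X]mxE hl.
have -> : ((x + h *: e) *m T *m (x^T + h *: e^T)) 0 0 =
    (x *m T *m x^T) 0 0 + 2 * h * (x *m T) 0 l + h ^+ 2 * T l l.
  have -> : x + h *: e = x - (- h) *: e by rewrite scaleNr opprK.
  have -> : x^T + h *: e^T = x^T - (- h) *: e^T by rewrite scaleNr opprK.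
  by rewrite form_expand E1 E2 hl; ring.
by rewrite [(u0 *m Q + x *m T) 0 l]mxE; field.
Qed.

Lemma kernel_vec_z q (j l : 'I_n) (h : C) :
  kernel_vec (q.1, q.2 + h *: delta_mx 0 j) 0 l = kernel_vec q 0 l + h * symres q.1 j l.
Proof. by rewrite /kernel_vec /= mulmxDl -scalemxAl addrA -rowE [LHS]mxE [X in _ + X]mxE [X in _ * X]mxE. Qed.

(** A Hamilton-Jacobi relation: the derivative in [W] is half the square of the gradient in [z]. It
    matches the squared first derivatives in the equations; the determinant accounts for the second
    derivatives of [Aform]. *)
Lemma cderiv_Aform_W q E : E^T = E -> siegel_jacobi_disk q ->
  cderiv (fun h => Aform (q.1 + h *: E, q.2) p) 0 (2^-1 * (kernel_vec q *m E *m (kernel_vec q)^T) 0 0).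
Proof.
case: q => V x Es [DV _]; rewrite /kernel_vec [_.1]/= [_.2]/=; rewrite /= in DV.
set T := symres V; set Q := resolvent S V.
have Ts : T^T = T by exact: symres_sym.
have QT : Q^T = T *m V + 1%:M by apply: resolvent_trE; [exact: Ss|have [] := DV|exact: res_unit].
pose P h := resolvent S (V + h *: E).
have PQ i j : flim small (fun h => P h i j) (Q i j).
  apply: flim_invmx; first exact: res_unit.
  apply: flim_oneB => [? ?|]; first exact: flim_cst.
  by apply: flim_mulmx => a b; [exact: flim_line|exact: flim_cst].
have lin a b (M : 'M[C]_(a, n)) (N : 'M[C]_(n, b)) i j :
    flim small (fun h => (M *m P h *m N) i j) ((M *m Q *m N) i j).
  apply: flim_mulmx => [|? ?]; last exact: flim_cst.
  by apply: flim_mulmx => [? ?|]; [exact: flim_cst|exact: PQ].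
(* The quotients of the three terms of [AformE], obtained from [resolvent_sub]; in the limit they
   combine to the square of [kernel_vec]. *)
apply/cderivP; exists (fun h => (u0 *m P h *m (E *m T *m x^T)) 0 0
  + 2^-1 * ((x *m S) *m P h *m (E *m T *m x^T)) 0 0 + 2^-1 * (u0 *m P h *m (E *m Q^T *m u0^T)) 0 0).
split; last first.
  have -> : 2^-1 * ((u0 *m Q + x *m T) *m E *m (u0 *m Q + x *m T)^T) 0 0 =
     (u0 *m Q *m (E *m T *m x^T)) 0 0 + 2^-1 * ((x *m S) *m Q *m (E *m T *m x^T)) 0 0
     + 2^-1 * (u0 *m Q *m (E *m Q^T *m u0^T)) 0 0.
    have cr : (x *m T *m E *m (u0 *m Q)^T) 0 0 = (u0 *m Q *m (E *m T *m x^T)) 0 0.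
      by rewrite tr11 (trmx_mul (x *m T *m E)) trmxK (trmx_mul (x *m T)) (trmx_mul x) Es Ts !mulmxA.
    have D1 (M N : 'M[C]_1) : (M + N) 0 0 = M 0 0 + N 0 0 by rewrite mxE.
    have xT : x *m T = x *m S *m Q by rewrite mulmxA.
    have xTt : (x *m T)^T = T *m x^T by rewrite trmx_mul Ts.
    have aa : (u0 *m Q *m E *m (u0 *m Q)^T) 0 0 = (u0 *m Q *m (E *m Q^T *m u0^T)) 0 0.
      by rewrite (trmx_mul u0) !mulmxA.
    have ab : (u0 *m Q *m E *m (x *m T)^T) 0 0 = (u0 *m Q *m (E *m T *m x^T)) 0 0.
      by rewrite xTt !mulmxA.
    have bb : (x *m T *m E *m (x *m T)^T) 0 0 = (x *m S *m Q *m (E *m T *m x^T)) 0 0.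
      by rewrite xTt -xT !mulmxA.
    rewrite linearD /= (mulmxDl _ _ E) mulmxDr !mulmxDl !D1 aa ab bb cr.
    move: ((u0 *m Q *m _) 0 0) ((x *m S *m Q *m _) 0 0) ((u0 *m Q *m _) 0 0) => X Y Z.
    by field.
  by apply: flimD; [apply: flimD|]; [exact: lin|apply: flimZ; exact: lin|apply: flimZ; exact: lin].
have := near_siegel_line Es DV; apply: filterS => h Dh.
rewrite add0r scale0r addr0.
have sub := resolvent_sub (res_unit DV) (res_unit Dh).
rewrite -/(P h) -/Q -/T in sub.
have lin1 (a : 'rV[C]_n) (M N K : 'M[C]_n) (b : 'cV[C]_n) : M = N + h *: K ->
    (a *m M *m b) 0 0 = (a *m N *m b) 0 0 + h * (a *m K *m b) 0 0.
  by move=> ->; rewrite mulmxDr -scalemxAr mulmxDl -scalemxAl !mxE.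
have c1 : P h = Q + h *: (P h *m E *m T) by rewrite -sub addrC subrK.
have c2 : S *m P h = T + h *: (S *m (P h *m E *m T)).
  by rewrite {1}c1 mulmxDr -scalemxAr.
have c3 : P h *m (V + h *: E) = Q *m V + h *: (P h *m E *m Q^T).
  have PV : P h *m V = Q *m V + h *: (P h *m E *m T *m V) by rewrite {1}c1 mulmxDl -scalemxAl.
  rewrite (mulmxDr (P h) V) PV -(scalemxAr h (P h)) -addrA -scalerDr; congr (_ + _ *: _).
  by rewrite QT (mulmxDr (P h *m E)) mulmx1 !mulmxA.
rewrite !AformE -/(P h) -/Q -/T -/(symres _); have -> : symres (V + h *: E) = S *m P h by [].
move: (P h) c1 c2 c3 {sub PQ lin Dh} => G c1 c2 c3.
rewrite (lin1 u0 _ _ _ _ c1) (lin1 x _ _ _ _ c2) (lin1 u0 _ _ _ _ c3).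
have -> : x *m S *m G *m (E *m T *m x^T) = x *m (S *m (G *m E *m T)) *m x^T by rewrite !mulmxA.
have -> : u0 *m G *m (E *m T *m x^T) = u0 *m (G *m E *m T) *m x^T by rewrite !mulmxA.
have -> : u0 *m G *m (E *m Q^T *m u0^T) = u0 *m (G *m E *m Q^T) *m u0^T by rewrite !mulmxA.
move: ((u0 *m (G *m E *m T) *m x^T) 0 0) ((u0 *m (G *m E *m Q^T) *m u0^T) 0 0) => X4 X6.
move: ((x *m (S *m (G *m E *m T)) *m x^T) 0 0) => X5.
move: ((u0 *m Q *m x^T) 0 0) ((x *m T *m x^T) 0 0) ((u0 *m (Q *m V) *m u0^T) 0 0) => X1 X2 X3.
clear; ring.
Qed.

End KernelDerivatives.

(** * The kernel solves the equations *)

Section KernelPde.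
Variables (R : realType) (n : nat) (m : R).
Notation C := R[i].
Implicit Types (V : 'M[C]_n) (q : sjpoint R n) (f : sjpoint R n -> C).

Lemma dz_cderiv f l q a : q.1^T = q.1 ->
  cderiv (fun h => f (q.1, q.2 + h *: delta_mx 0 l)) 0 a -> dz l f q = a.
Proof.
move=> qs hf; rewrite /dz; apply: derive_val; apply: cderiv_is_derive; apply: cderiv_ext hf.
apply: filterE => h; rewrite add0r; case: q qs => V x /= qs.
by rewrite /in_coords /= scaler0 addr0 symU_id.
Qed.

Lemma ddir_cderiv f j l q a : q.1^T = q.1 ->
  cderiv (fun h => f (q.1 + h *: (delta_mx j l + delta_mx l j), q.2)) 0 a ->
  ddir m f (inl (j, l)) q = a.
Proof.
move=> qs hf; rewrite /ddir; apply: derive_val; apply: cderiv_is_derive; apply: cderiv_ext hf.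
apply: filterE => h; rewrite add0r; case: q qs => V x /= qs.
rewrite /in_coords /= scaler0 addr0 symU_id //.
rewrite linearD linearZ /= qs linearD /= !trmx_delta; congr (_ + _ *: _); exact: addrC.
Qed.

Variable p : sjpoint R n.
Hypothesis Dp : siegel_jacobi_disk p.
Let c : C := (8 * pi * m)%:C.
Let K q := kernel_fun m q p.
Let v := kernel_vec p.
Let T := symres p.

Lemma kernel_cderiv_z (l : 'I_n) q : siegel_jacobi_disk q ->
  cderiv (fun h => K (q.1, q.2 + h *: delta_mx 0 l)) 0 (c * v q 0 l * K q).
Proof.
move=> Dq; pose A h := c * (Aform q p + h * (v q 0 l + h * (2^-1 * T q.1 l l))).
have hA : cderiv A 0 (c * v q 0 l).
  apply: cderivZ; rewrite -[X in cderiv _ _ X]add0r; apply: cderivD; first exact: cderiv_cst.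
  have k : cderiv (fun h => v q 0 l + h * (2^-1 * T q.1 l l)) 0 (0 + (1 * (2^-1 * T q.1 l l) + 0 * 0)).
    by apply: cderivD; [exact: cderiv_cst|apply: cderivM; [exact: cderiv_id|exact: cderiv_cst]].
  by have := cderivM (cderiv_id 0) k; rewrite !mul0r mul1r !addr0.
have hE := cderivZ (det_invsqrt (q.1, p.1)) (cderiv_comp hA (cderiv_expC (A 0))).
have -> : c * v q 0 l * K q = det_invsqrt (q.1, p.1) * (expC (A 0) * (c * v q 0 l)).
  by rewrite /A mul0r addr0 /K /kernel_fun; ring.
apply: cderiv_ext hE; apply: filterE => h.
by rewrite add0r /K /kernel_fun (Aform_z Dp l h Dq).
Qed.

Lemma kernel_dz (l : 'I_n) q : siegel_jacobi_disk q -> dz l K q = c * v q 0 l * K q.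
Proof. by move=> Dq; apply: dz_cderiv; [exact: siegel_sym|exact: kernel_cderiv_z]. Qed.

Lemma kernel_dzz (j l : 'I_n) q : siegel_jacobi_disk q ->
  dz j (dz l K) q = c * (T q.1 j l + c * v q 0 j * v q 0 l) * K q.
Proof.
move=> Dq; apply: dz_cderiv; first exact: siegel_sym.
have hv : cderiv (fun h => c * (v q 0 l + h * T q.1 j l)) 0 (c * (0 + (1 * T q.1 j l + 0 * 0))).
  apply: cderivZ; apply: cderivD; first exact: cderiv_cst.
  by apply: cderivM; [exact: cderiv_id|exact: cderiv_cst].
have := cderivM hv (kernel_cderiv_z j Dq).
have -> : c * (0 + (1 * T q.1 j l + 0 * 0)) * K (q.1, q.2 + 0 *: delta_mx 0 j) +
    c * (v q 0 l + 0 * T q.1 j l) * (c * v q 0 j * K q) =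
    c * (T q.1 j l + c * v q 0 j * v q 0 l) * K q.
  by rewrite scale0r addr0 -surjective_pairing; ring.
apply: cderiv_ext; apply: filterE => h.
rewrite add0r kernel_dz; last by split; [exact: Dq.1|exact: I].
by congr (_ * _ * _); rewrite /v kernel_vec_z.
Qed.

Lemma mxtrace_delta (X : 'M[C]_n) (j l : 'I_n) : \tr (delta_mx j l *m X) = X l j.
Proof.
rewrite -(mul_delta_mx (0 : 'I_1) j l) -mulmxA mxtrace_mulC -mulmxA trace_mx11.
by rewrite -rowE -colE !mxE.
Qed.

(** With [1 - (V + h E) S = (1 - V S) (1 + h X)] the derivative of the determinant becomes the trace
    of [X], here [- 2 T_jl]; the exponent -1/2 leaves [T_jl]. *)
Lemma det_invsqrt_cderiv V (j l : 'I_n) : siegel_disk V ->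
  cderiv (fun h => det_invsqrt (V + h *: (delta_mx j l + delta_mx l j), p.1)) 0
    (det_invsqrt (V, p.1) * T V j l).
Proof.
move=> DV; set E : 'M[C]_n := delta_mx j l + delta_mx l j.
have Es : E^T = E by rewrite linearD /= !trmx_delta addrC.
pose S := conjmat p.1; pose Q := resolvent S V; pose X := - (Q *m E *m S).
have uN : 1%:M - V *m S \in unitmx by apply: siegel_unit2 DV Dp.1.
have trX : \tr X = - (2 * T V j l).
  have Ts := symres_sym Dp DV.
  rewrite /X linearN /= -mulmxA mxtrace_mulC -mulmxA -/(symres p V) mulmxDl linearD /= !mxtrace_delta.
  by rewrite -{1}Ts mxE -/T mulr_natl mulr2n.
have d1 : \det (1%:M + 0 *: X) = 1 by rewrite scale0r addr0 det1.
have hd : cderiv (fun h => (\det (1%:M + h *: X))^-1) 0 (2 * T V j l).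
  have := cderivV _ (cderiv_det1 X); rewrite d1 oner_neq0 => /(_ isT).
  by rewrite expr1n divr1 trX opprK.
have hp := @psqrt_cderiv1 R; rewrite -[X in cderiv _ X _]invr1 -[in X in cderiv _ X _]d1 in hp.
have := cderivZ (det_invsqrt (V, p.1)) (cderiv_comp hd hp).
rewrite (mulrA 2^-1) mulVf ?pnatr_eq0 // mul1r; apply: cderiv_ext.
have := near_line E (det_invsqrt_local DV Dp.1); apply: filterS => h /= k; rewrite add0r.
have Vs : V^T = V by have [] := DV.
have [|Dh ->] := k; first by rewrite linearD linearZ /= Es Vs.
congr (_ * psqrt _).
have -> : 1%:M - (V + h *: E) *m conjmat p.1 = (1%:M - V *m S) *m (1%:M + h *: X).
  rewrite mulmxDr mulmx1 -scalemxAr /X mulmxN !mulmxA mulmxV // mul1mx scalerN.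
  by rewrite mulmxDl opprD addrA scalemxAl.
by rewrite det_mulmx invfM mulrA divff ?mul1r // -unitfE -unitmxE.
Qed.

(** The branch contributes [T_jl] and the exponential [c v_j v_l]; [c] times their sum is the factor
    in [kernel_dzz]. *)
Lemma kernel_ddir (j l : 'I_n) q : siegel_jacobi_disk q ->
  ddir m K (inl (j, l)) q = (T q.1 j l + c * v q 0 j * v q 0 l) * K q.
Proof.
move=> Dq; apply: ddir_cderiv; first exact: siegel_sym.
set E : 'M[C]_n := delta_mx j l + delta_mx l j.
have Es : E^T = E by rewrite linearD /= !trmx_delta addrC.
have vE : (v q *m E *m (v q)^T) 0 0 = 2 * (v q 0 j * v q 0 l).
  have h (a b : 'I_n) : (v q *m delta_mx a b *m (v q)^T) 0 0 = v q 0 a * v q 0 b.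
    by rewrite -(mul_delta_mx (0 : 'I_1) a b) mulmxA -mulmxA -rowE -colE mxE big_ord1 !mxE.
  by rewrite mulmxDr mulmxDl mxE !h; ring.
have hA := cderivZ c (cderiv_Aform_W Dp Es Dq).
rewrite -/v vE (mulrA 2^-1) mulVf ?pnatr_eq0 // mul1r in hA.
have := cderivM (det_invsqrt_cderiv j l Dq.1) (cderiv_comp hA (cderiv_expC _)).
have q0 : (q.1 + 0 *: E, q.2) = q by rewrite scale0r addr0 -surjective_pairing.
rewrite -/E q0 scale0r addr0 [(_ \o _) 0](_ : _ = expC (c * Aform q p)); last first.
  by rewrite -[in RHS]q0.
congr (cderiv _ _ _); rewrite /K /kernel_fun -/c.
by move: (det_invsqrt _) (expC _) => b e; ring.
Qed.

Lemma kernel_pde (j l : 'I_n) q : (j <= l)%N -> siegel_jacobi_disk q ->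
  dz j (dz l K) q = c * (1 + (j == l)%:R) * dW j l K q.
Proof.
move=> jl Dq; rewrite kernel_dzz // -(mulrA c (1 + _)) -(ddir_inl m _ Dq jl).
  by rewrite kernel_ddir // mulrA.
exact: kernel_holomorphic.
Qed.

End KernelPde.

(** * Power series whose partial sums tend to zero *)

Section PowerSeriesZero.
Variable R : realType.
Notation C := R[i].
Implicit Types e : nat -> C.

Lemma geometric_le2 (t : R) k : 0 <= t -> t <= 2^-1 -> \sum_(i < k) t ^+ i <= 2.
Proof.
move=> t0 t1; have := subrX1 t k; set s := \sum_(i < k) _ => h.
have := exprn_ge0 k t0; have s0 : 0 <= s by apply: sumr_ge0 => i _; exact: exprn_ge0.
by nra.
Qed.

(** Convergence at [t = 1] bounds the coefficients, as differences of consecutive partial sums; for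
    small [t] all terms after the first are then negligible. *)
Lemma psum_zero_coef0 e :
  (forall t : R, 0 < t -> flim \oo (fun M => \sum_(N < M) e N * t%:C ^+ N) 0) -> e 0%N = 0.
Proof.
move=> h; have [B B0 hB] : exists2 B : R, 0 < B & forall N, cabs (e N) <= B.
  have [M0 _ hM] := h _ (@ltr01 R) _ (@ltr01 R).
  have s0 : 0 <= \sum_(N < M0) cabs (e N) by apply: sumr_ge0 => i _; exact: cabs_ge0.
  exists (2 + \sum_(N < M0) cabs (e N)) => [|N]; first by rewrite ltr_wpDr.
  have [NM|MN] := ltnP N M0.
    rewrite (bigD1 (Ordinal NM)) //= addrCA lerDl addr_ge0 //.
    by apply: sumr_ge0 => i _; exact: cabs_ge0.
  have h1 := hM N MN; have h2 := hM N.+1 (leqW MN); rewrite /= subr0 in h1; rewrite /= subr0 in h2.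
  rewrite big_ord_recr /= in h2; move: (\sum_(i < N) _) h1 h2 => X h1 h2.
  rewrite rmorph1 expr1n mulr1 in h2.
  have := cabsB (X + e N) X; rewrite addrAC subrr add0r => h3; lra.
apply/cabs_le0P => d d0.
(* Chosen so that [t] is at most one half, for the geometric bound 2, and [2 * B * t <= d / 2]. *)
pose t : R := (d / 2) / (2 * B + d).
have den : 0 < 2 * B + d by rewrite addr_gt0 // mulr_gt0.
have t0 : 0 < t by rewrite !divr_gt0.
have t2 : t <= 2^-1 by rewrite /t ler_pdivrMr //; nra.
have tB : 2 * B * t <= d / 2.
  by rewrite /t mulrA ler_pdivrMr //; nra.
have d2 : 0 < d / 2 by rewrite divr_gt0.
have [M0 _ hM] := h _ t0 _ d2; have := hM M0.+1 (leqnSn M0); rewrite /= subr0 big_ord_recl expr0 mulr1.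
have tail : cabs (\sum_(i < M0) e (bump 0 i) * t%:C ^+ (bump 0 i)) <= d / 2.
  apply: le_trans (cabs_sum _ _ _) _; apply: le_trans tB.
  have -> : 2 * B * t = B * t * 2 by ring.
  apply: (@le_trans _ _ (\sum_(i < M0) B * t * t ^+ i)).
    apply: ler_sum => i _; rewrite cabsM cabsX cabsR ger0_norm ?(ltW t0) // exprS mulrA.
    rewrite ler_wpM2r ?exprn_ge0 ?(ltW t0) // ler_wpM2r ?(ltW t0) //; exact: hB.
  rewrite -mulr_sumr; apply: ler_wpM2l; first exact: mulr_ge0 (ltW B0) (ltW t0).
  exact: geometric_le2 (ltW t0) t2.
move: (\sum_(i < M0) _) tail => X tail hX.
have := cabsB (e 0%N + X) X; rewrite addrK => h3; lra.
Qed.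

Lemma psum_zero_coef e :
  (forall t : R, 0 < t -> flim \oo (fun M => \sum_(N < M) e N * t%:C ^+ N) 0) -> forall N, e N = 0.
Proof.
move=> h N; elim: N e h => [|N IH] e h; first exact: psum_zero_coef0.
apply: (IH (fun i => e i.+1)) => t t0; have e0 := psum_zero_coef0 h.
have t0' : t%:C != 0 :> C by rewrite -cabs_gt0 cabsR normr_gt0 gt_eqF.
have k : flim \oo (fun M => t%:C^-1 * \sum_(N < M) e N * t%:C ^+ N) (t%:C^-1 * 0) by apply: flimZ; exact: h.
rewrite mulr0 in k; move=> d d0; have [M0 _ hM] := k d d0; exists M0 => // M /= MM.
have := hM M.+1 (leqW MM); rewrite /= !subr0 big_ord_recl e0 mul0r add0r mulr_sumr.
congr (cabs _ <= _); apply: eq_bigr => i _.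
by rewrite /= /bump /= exprS; field.
Qed.

End PowerSeriesZero.

(** * Expansion of the kernel *)

Section Kernel.
Variables (R : realType) (n : nat) (m : R).
Hypothesis m_gt0 : 0 < m.
Notation C := R[i].
Implicit Types p q : sjpoint R n.

Lemma kernel_H0 p : siegel_jacobi_disk p -> H0 m ((kernel_fun m)^~ p).
Proof.
move=> Dp; apply: (pde_expand m_gt0 (kernel_holomorphic m Dp)) => j l jl q Dq.
exact: kernel_pde.
Qed.

Lemma disk_origin (z : 'rV[C]_n) : siegel_jacobi_disk (0 : 'M[C]_n, z).
Proof. exact: conj (@siegel0 R n) I. Qed.

(** Both the resolvent and the branch are 1 here. The role of [U] is played by [k z], and the
    coordinates are those of [p] conjugated, whence [genp_conj]. *)
Lemma kernel_origin p (z : 'rV[C]_n) : siegel_jacobi_disk p ->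
  has_sum (fun s => Num.conj (fs m s p) * fs m s (0, z)) (kernel_fun m (0, z) p).
Proof.
move=> Dp; have [_ _ b1] := det_invsqrtP R n.
pose k : C := (kappa m)%:C.
have kE : kernel_fun m (0, z) p = expC (quad (k *: z) (fun i => Num.conj (sjcoord m p i))).
  rewrite /kernel_fun b1; last exact: Dp.1.
  have r0 : resolvent (conjmat p.1) 0 = 1%:M by rewrite /resolvent mul0mx subr0 invmx1.
  rewrite mul1r -(kappaC2 m_gt0) AformE /symres r0 !mulmx1 !mulmx0 mul0mx.
  rewrite [(0 : 'M[C]_1) 0 0]mxE mulr0 addr0.
  have -> : quad (k *: z) (fun i => Num.conj (sjcoord m p i)) =
      quad (k *: z) (zcoord (k *: conjmat p.2) (conjmat p.1)).
    congr quad; apply/funext => -[[j l]|j] /=; rewrite /sjcoord /=.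
      by rewrite fmorph_div /= rmorph_nat mxE.
    by rewrite !mxE rmorphM /= conj_realC.
  rewrite quad_zcoord; congr expC.
  have Z (a : C) (M : 'M[C]_1) : (a *: M) 0 0 = a * M 0 0 by rewrite mxE.
  have zu : (z *m (conjmat p.2)^T) 0 0 = (conjmat p.2 *m z^T) 0 0.
    by rewrite tr11 trmx_mul trmxK.
  have -> : ((k *: z) *m (k *: conjmat p.2)^T) 0 0 = k ^+ 2 * (conjmat p.2 *m z^T) 0 0.
    by rewrite linearZ /= -scalemxAl -scalemxAr !Z zu mulrA.
  have -> : ((k *: z) *m conjmat p.1 *m (k *: z)^T) 0 0 = k ^+ 2 * (z *m conjmat p.1 *m z^T) 0 0.
    by rewrite linearZ /= -!scalemxAl -scalemxAr !Z mulrA.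
  by rewrite -/k; ring.
rewrite kE; have := @genp_generating R n (k *: z) (fun i => Num.conj (sjcoord m p i)).
apply: eq_has_sum => s; rewrite genp_conj fs_W0 fsE // rmorphM /=.
have -> : mpow (k *: z) s = k ^+ mdeg s * mpow z s.
  by rewrite /mpow /mdeg expr_sum -big_split; apply: eq_bigr => i _; rewrite mxE exprMn.
rewrite -(mpow_divmon z s) /sqrt_mfact conj_realC.
have sq : (Num.sqrt (mfact s)%:R)%:C * (Num.sqrt (mfact s)%:R)%:C = (mfact s)%:R :> C.
  by rewrite -rmorphM /= -expr2 sqr_sqrtr // rmorph_nat.
have mf := mfact_neq0 R s.
rewrite -/k; move: (Num.conj _) (k ^+ _) (mpow z s) => a b c.
have -> : (Num.sqrt (mfact s)%:R)%:C * a * ((Num.sqrt (mfact s)%:R)%:C * b * (c / (mfact s)%:R)) =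
   ((Num.sqrt (mfact s)%:R)%:C * (Num.sqrt (mfact s)%:R)%:C) * a * b * (c / (mfact s)%:R) :> C by ring.
by rewrite sq; field.
Qed.

Lemma has_sum_psumH (c : multi n -> C) q l :
  has_sum (fun s => c s * fs m s q) l -> flim \oo (fun M => psumH m c M q) l.
Proof.
move=> h; have g := has_sum_group (fun s N => mem_degs N s) h.
exact: has_sum_nat g.
Qed.

(** Replacing [z] by [t z] turns the difference into a power series in [t], which separates the
    degrees; within one degree the sum is finite and [fs_coef_unique] applies. *)
Lemma H0_coef_unique (c d : multi n -> C) (f : 'rV[C]_n -> C) :
  (forall z, flim \oo (fun M => psumH m c M (0, z)) (f z)) ->
  (forall z, flim \oo (fun M => psumH m d M (0, z)) (f z)) -> c = d.
Proof.
move=> hc hd.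
have hdil (b : multi n -> C) N z t : hpart m b N (0, t *: z) = hpart m b N (0, z) * t ^+ N.
  rewrite /hpart mulr_suml !big_seq; apply: eq_bigr => s; rewrite mem_degs => /eqP sN.
  have -> : (0, t *: z) = dil t (0, z) :> sjpoint R n by rewrite /dil /= scaler0.
  by rewrite fs_dil // sN; ring.
have hcd N z : hpart m c N (0, z) = hpart m d N (0, z).
  apply/eqP; rewrite -subr_eq0; apply/eqP; move: N.
  apply: psum_zero_coef => t t0.
  have k : flim \oo (fun M => psumH m c M (0, t%:C *: z) + - psumH m d M (0, t%:C *: z)) (f (t%:C *: z) + - f (t%:C *: z)).
    by apply: flimD; [exact: hc|apply: flimN; exact: hd].
  rewrite subrr in k; apply: (flim_ext _ k); apply: filterE => M.
  rewrite /psumH -sumrN -big_split; apply: eq_bigr => N _ /=.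
  by rewrite !hdil mulrBl.
apply/funext => s; pose N := mdeg s.
pose r (b : multi n -> C) t := if t \in degs n N then b t else 0.
have hr b z : has_sum (fun t => r b t * fs m t (0, z)) (hpart m b N (0, z)).
  have -> : hpart m b N (0, z) = \sum_(t <- degs n N) r b t * fs m t (0, z).
    by rewrite /hpart !big_seq; apply: eq_bigr => t tN; rewrite /r tN.
  by apply: has_sum_finite => t /negPf tN; rewrite /r tN mul0r.
have hr2 z : has_sum (fun t => r d t * fs m t (0, z)) (hpart m c N (0, z)) by rewrite hcd; exact: hr.
have /(congr1 (fun b => b s)) := fs_coef_unique m_gt0 (hr c) hr2.
by rewrite /r mem_degs eqxx.
Qed.

Lemma kernel_psumH p q : siegel_jacobi_disk p -> siegel_jacobi_disk q ->
  flim \oo (fun M => psumH m (fun s => Num.conj (fs m s p)) M q) (kernel_fun m q p).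
Proof.
move=> Dp; have /H0P[_ [c hc]] := kernel_H0 Dp.
have hq t : siegel_jacobi_disk t -> flim \oo (fun M => psumH m c M t) (kernel_fun m t p).
  move=> Dt e e0; have Kt : [set t] `<=` @siegel_jacobi_disk R n by move=> _ ->.
  have [M0 _ hM] := hc [set t] (@compact_set1 _ t) Kt e e0.
  by exists M0 => // M MM; apply: (hM M MM t).
rewrite -(@H0_coef_unique c (fun s => Num.conj (fs m s p)) (fun z => kernel_fun m (0, z) p)).
- exact: hq.
- by move=> z; apply: hq; exact: disk_origin.
- by move=> z; apply: has_sum_psumH; exact: kernel_origin.
Qed.

Lemma fs_square_bsum p : siegel_jacobi_disk p -> bsum (fun s : multi n => cabs (fs m s p) ^+ 2).
Proof.
move=> Dp; have h := kernel_psumH Dp Dp; set l := kernel_fun m p p in h.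
pose D (s : multi n) := cabs (fs m s p) ^+ 2.
have D0 s : 0 <= D s by rewrite exprn_ge0 ?cabs_ge0.
exists (cabs l + 2) => A; rewrite -/(D _).
(* [D] cut off outside [A]: regrouping this finite family by degree compares the sum over [A] with
   the partial sums [psumH]. *)
have hA : has_sum (fun s => (if s \in A then D s else 0)%:C) (\sum_(s <- A) (if s \in A then D s else 0)%:C).
  by apply: has_sum_finite => s /negPf ->.
have := has_sum_nat (has_sum_group (fun s N => mem_degs N s) hA).
move=> /(_ _ ltr01)[M1 _ h1]; have [M2 _ h2] := h _ ltr01.
have := h1 (maxn M1 M2) (leq_maxl _ _); have := h2 (maxn M1 M2) (leq_maxr _ _); rewrite /=.
move: (maxn _ _) => M h3.
have -> : \sum_(s <- A) (if s \in A then D s else 0)%:C = (\sum_(s <- A) D s)%:C :> C.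
  by rewrite rmorph_sum /= !big_seq; apply: eq_bigr => s ->.
set X := \sum_(N < M) _ => h4.
have S0 : 0 <= \sum_(s <- A) D s by apply: sumr_ge0.
have hX : cabs X <= \sum_(N < M) \sum_(s <- degs n N) D s.
  apply: le_trans (cabs_sum _ _ _) _; apply: ler_sum => N _.
  apply: le_trans (cabs_sum _ _ _) _; apply: ler_sum => s _.
  by rewrite cabsR; case: ifP => _; rewrite ?normr0 // ger0_norm.
have pE : psumH m (fun s => Num.conj (fs m s p)) M p = (\sum_(N < M) \sum_(s <- degs n N) D s)%:C.
  rewrite rmorph_sum; apply: eq_bigr => N _; rewrite rmorph_sum; apply: eq_bigr => s _ /=.
  by rewrite mulrC -normCK normE -rmorphXn.
have h5 : \sum_(N < M) \sum_(s <- degs n N) D s <= cabs l + 1.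
  have hp : cabs (psumH m (fun s => Num.conj (fs m s p)) M p) = \sum_(N < M) \sum_(s <- degs n N) D s.
    rewrite pE cabsR ger0_norm //; apply: sumr_ge0 => N _; apply: sumr_ge0 => s _; exact: D0.
  by have := cabs_triang l (psumH m (fun s => Num.conj (fs m s p)) M p) 0; rewrite !subr0 hp; lra.
have := cabs_triang X (\sum_(s <- A) D s)%:C 0; rewrite !subr0 (cabs_distC _ X) (cabsR (\sum_(s <- A) D s)) (ger0_norm S0); lra.
Qed.

Lemma young (a b : R) : a * b <= a ^+ 2 + b ^+ 2.
Proof. have := sqr_ge0 a; have := sqr_ge0 b; have := sqr_ge0 (a - b); nra. Qed.

Lemma kernel_expansion p q : siegel_jacobi_disk p -> siegel_jacobi_disk q ->
  has_sum (fun s : multi n => fs m s q * Num.conj (fs m s p)) (kernel_fun m q p).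
Proof.
move=> Dp Dq; have [Mp hp] := fs_square_bsum Dp; have [Mq hq] := fs_square_bsum Dq.
have [l hl] : exists l, has_sum (fun s : multi n => fs m s q * Num.conj (fs m s p)) l.
  apply: asum_has_sum; exists (Mp + Mq) => A.
  apply: le_trans (lerD (hp A) (hq A)); rewrite -big_split; apply: ler_sum => s _ /=.
  rewrite cabsM cabsJ; apply: le_trans (young _ _) _.
  by rewrite [leLHS]addrC lexx.
have hd : flim \oo (fun M => psumH m (fun s => Num.conj (fs m s p)) M q) l.
  by apply: has_sum_psumH; apply: eq_has_sum hl => s; rewrite mulrC.
by rewrite (flim_unique (kernel_psumH Dp Dq) hd).
Qed.

End Kernel.

(** * The reproducing property *)

Section Reproducing.
Variables (R : realType) (n : nat) (m : R).
Hypothesis m_gt0 : 0 < m.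
Notation C := R[i].
Implicit Types p : sjpoint R n.

Lemma Fm_coefP (f : sjpoint R n -> C) : Fm m f -> Fm_expansion m f (Fm_coef m f).
Proof.
move=> [_ [c hc]]; rewrite /Fm_coef.
by case: xgetP => [d _ //|/(_ c)[]].
Qed.

Lemma kernel_Fm_expansion p : siegel_jacobi_disk p ->
  Fm_expansion m ((kernel_fun m)^~ p) (fun s : multi n => Num.conj (fs m s p)).
Proof.
move=> Dp; split=> [|q Dq].
  have [l hl] := bsum_has_sum (fun s => exprn_ge0 2 (cabs_ge0 (fs m s p))) (fs_square_bsum m_gt0 Dp).
  rewrite (_ : (fun s => _) = (fun s => (cabs (fs m s p) ^+ 2)%:C)); first exact: cvgP hl.
  by apply/funext => s; rewrite norm_conjC normE rmorphXn.
by apply: eq_has_sum (kernel_expansion m_gt0 Dp Dq) => s; rewrite mulrC.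
Qed.

Lemma kernel_Fm p : siegel_jacobi_disk p -> Fm m ((kernel_fun m)^~ p).
Proof.
move=> Dp; split; first exact: kernel_holomorphic.
by exists (fun s => Num.conj (fs m s p)); exact: kernel_Fm_expansion.
Qed.

(** The points [(0, z)] already determine the coefficients, so the choice made by [Fm_coef] is
    forced. *)
Lemma kernel_Fm_coef p : siegel_jacobi_disk p ->
  Fm_coef m ((kernel_fun m)^~ p) = (fun s : multi n => Num.conj (fs m s p)).
Proof.
move=> Dp; have [_ h1] := Fm_coefP (kernel_Fm Dp); have [_ h2] := kernel_Fm_expansion Dp.
apply: (fs_coef_unique m_gt0 (f := fun z => kernel_fun m (0, z) p)) => z.
  exact: h1 (disk_origin z).
exact: h2 (disk_origin z).
Qed.

Lemma sum_has_sum (I : choiceType) (x : I -> C) l : has_sum x l -> summability.sum x = l.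
Proof.
move=> h; have tf : ProperFilter (@totally I) := totally_filter.
have hd : hausdorff_space C := @norm_hausdorff _ (C : normedModType C).
exact: (@cvg_lim _ hd _ _ tf _ _ h).
Qed.

(** The coefficients of the kernel at [p] are the conjugates of [fs s p], so the inner product with
    it is the expansion of [f] at [p]. *)
Lemma kernel_reproducing : reproducing_kernel (@siegel_jacobi_disk R n) (Fm m) (Fm_ip m) (kernel_fun m).
Proof.
move=> p Dp; split=> [|f hf]; first exact: kernel_Fm.
have [_ hp] := Fm_coefP hf; rewrite /Fm_ip kernel_Fm_coef //.
rewrite (sum_has_sum (l := f p)) //; apply: eq_has_sum (hp p Dp) => s.
by rewrite conjCK.
Qed.

End Reproducing.

Theorem proposition3p2 (R : realType) (n : nat) (m : R)
    (n_ge1 : (1 <= n)%N) (m_gt0 : 0 < m) :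
  [/\ (forall (U : 'rV[R[i]]_n) (W : 'M[R[i]]_n) (z : 'rV[R[i]]_n),
        siegel_jacobi_disk (W, z) ->
        has_sum (fun s : multi n => mpow U s / sqrt_mfact R s * fs m s (W, z))
          (expC ((Num.sqrt (8 * pi * m))%:C * (U *m z^T) 0 0
                 + 2^-1 * (U *m W *m U^T) 0 0))),
      reproducing_kernel (@siegel_jacobi_disk R n) (Fm m) (Fm_ip m)
        (kernel_fun m),
      (forall p p' : sjpoint R n,
        siegel_jacobi_disk p -> siegel_jacobi_disk p' ->
        has_sum (fun s : multi n => fs m s p' * Num.conj (fs m s p))
          (kernel_fun m p' p))
    & (forall f : sjpoint R n -> R[i], holomorphic f ->
        ((forall j k : 'I_n, (j <= k)%N ->
            forall p, siegel_jacobi_disk p ->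
            dz j (dz k f) p
            = (8 * pi * m)%:C * (1 + (j == k)%:R) * dW j k f p)
         <-> H0 m f))].
Proof.
split; first by move=> U W z _; exact: generating_function.
- exact: kernel_reproducing.
- by move=> p p' Dp Dp'; exact: kernel_expansion.
- by move=> f hf; exact: H0_pde.
Qed.
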